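(* Let $\varphi\in L^2(\mathbb{R})$, $\varphi\ne0$, be a compactly supported complex-valued function, so that $\Phi_\varphi$ is a trigonometric polynomial, and suppose that the set $X=\{x_1,\dots,x_s\}\subset\mathbb{T}$ of all zeros of $\Phi_\varphi$ is nonempty. Write $\Phi_\varphi(t)=|\omega(t)|^2P(t)$, where $P>0$ is a trigonometric polynomial, $\omega(t)=\prod_{j=1}^s[\sin\pi(t-x_j)]^{\lambda_j}$, $\lambda_j\in\mathbb{N}$. Put $|\Lambda|=\sum_{j=1}^s\lambda_j$ and let $\Omega\subset\mathbb{Z}$ be a set of $|\Lambda|$ consecutive integers. Then for any $f\in S(\varphi)$ $$\lim_{r\to1-}\Big\|f-\sum_{n=-\infty}^{+\infty}r^{|n|}c_n(f)\,\varphi(\cdot+n)\Big\|_{L^2(\mathbb{R})}=0,$$ where $c_n(f)=\int_{\mathbb{R}}f(x)\overline{\eta_n(x)}\,dx$ for $n\in\mathbb{Z}\setminus\Omega$, and $c_n(f)=0$ for $n\in\Omega$.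
   Context: $\mathbb{T}=\mathbb{R}/\mathbb{Z}$, $\mathbb{N}=\{1,2,\dots\}$. The Fourier transform on $L^2(\mathbb{R})$ is the isometry given for $f\in L^1(\mathbb{R})\cap L^2(\mathbb{R})$ by $\widehat f(y)=\int_{\mathbb{R}}f(x)e^{-2\pi ixy}\,dx$. For $\varphi\in L^2(\mathbb{R})$, $\Phi_\varphi(t)=\sum_{k\in\mathbb{Z}}|\widehat\varphi(t+k)|^2$, a $1$-periodic nonnegative function in $L^1(\mathbb{T})$. $S(\varphi)$ is the closed linear span in $L^2(\mathbb{R})$ of $\{\varphi(\cdot+k):k\in\mathbb{Z}\}$. The functions $\eta_n$: for $n\in\mathbb{Z}\setminus\Omega$ let $T_n(t)=\sum_{k\in\Omega}c_k^{(n)}e^{2\pi ikt}$ be the trigonometric polynomial with frequencies in $\Omega$ which interpolates $e^{2\pi int}$ at every $x_j$ up to order $\lambda_j$, i.e. $T_n^{(m)}(x_j)=\frac{d^m}{dt^m}e^{2\pi int}\big|_{t=x_j}$ for $0\le m\le\lambda_j-1$, $1\le j\le s$. Then $\eta_n\in S(\varphi)$ is defined by $\widehat\eta_n(t)=\widehat\varphi(t)\,\Phi_\varphi(t)^{-1}\,[e^{2\pi int}-T_n(t)]$. The system $\{\eta_n\}_{n\in\mathbb{Z}\setminus\Omega}$ is biorthogonal to $\{\varphi(\cdot+k)\}_{k\in\mathbb{Z}\setminus\Omega}$. *)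

(* Defs.v *)
From HB Require Import structures.
From mathcomp Require Import all_boot all_order all_algebra.
From mathcomp Require Import complex.
From mathcomp Require Import all_classical all_reals all_analysis.

Set Implicit Arguments.
Unset Strict Implicit.
Unset Printing Implicit Defensive.

Import Order.TTheory GRing.Theory Num.Theory.
Import numFieldNormedType.Exports.

Local Open Scope classical_set_scope.
Local Open Scope ring_scope.
Local Open Scope complex_scope.

Section ComplexValued.
Context {R : realType}.
Implicit Types (f g h phi : R -> R[i]) (t y : R).

Local Notation mu := (@lebesgue_measure R).

(* The real-valued modulus; the ring_scope norm on R[i] is R[i]-valued. *)
Definition cmod (z : R[i]) : R := ComplexField.Normc.normc z.

(* e^{i t} *)
Definition cis t : R[i] := cos t +i* sin t.

(* e^{2 pi i n t} *)
Definition expchar (n : int) t : R[i] := cis (2 * pi * n%:~R * t).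

Definition cmeasurable f : Prop :=
  measurable_fun setT (fun x : R => complex.Re (f x)) /\
  measurable_fun setT (fun x : R => complex.Im (f x)).

Definition cintegral f : R[i] :=
  Rintegral mu setT (fun x => complex.Re (f x)) +i*
  Rintegral mu setT (fun x => complex.Im (f x)).

Definition cLnorm (p : \bar R) f : \bar R :=
  Lnorm mu p (fun x => (cmod (f x))%:E).

Definition cL1 f : Prop := cmeasurable f /\ (cLnorm 1 f < +oo)%E.

Definition cL2 f : Prop := cmeasurable f /\ (cLnorm 2%:E f < +oo)%E.

Definition L2dist f g : \bar R := cLnorm 2%:E (fun x => f x - g x).

Definition cderive1n (m : nat) f t : R[i] :=
  derive1n m (fun u => complex.Re (f u)) t +i*
  derive1n m (fun u => complex.Im (f u)) t.

Definition fourier f y : R[i] :=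
  cintegral (fun x => f x * cis (- (2 * pi * x * y))).

(* The unique isometric extension of [fourier] from L^1 `&` L^2 to L^2, given
   through its graph: the closure in L^2 x L^2 of the graph of [fourier] on
   the dense subspace L^1 `&` L^2.  Thus [fourierL2 f g] determines each of f
   and g from the other up to a.e. equality. *)
Definition fourierL2 f g : Prop :=
  [/\ cL2 f, cL2 g &
    forall e : R, 0 < e ->
      exists h, [/\ cL1 h, cL2 h, (L2dist f h < e%:E)%E &
                    (L2dist g (fourier h) < e%:E)%E]].

Definition translate (k : int) phi : R -> R[i] := fun x => phi (x + k%:~R).

Definition compactly_supported phi : Prop :=
  exists K : set R, compact K /\ {ae mu, forall x, ~ K x -> phi x = 0}.

(* Meant for phi in L^1 `&` L^2, whose Fourier transform is defined pointwise. *)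
Definition Phi phi t : \bar R :=
  \esum_(k in [set: int]) ((cmod (fourier phi (t + k%:~R)) ^+ 2)%:E).

Definition shift_space phi : set (R -> R[i]) :=
  [set f | cL2 f /\
    forall e : R, 0 < e ->
      exists (s : seq int) (a : int -> R[i]),
        (L2dist f (fun x => (\sum_(k <- s) a k * translate k phi x)%R)
           < e%:E)%E].

Definition trig_poly (s : seq int) (c : int -> R[i]) t : R[i] :=
  \sum_(k <- s) c k * expchar k t.

Definition is_trig_poly (P : R -> R) : Prop :=
  exists (s : seq int) (c : int -> R[i]), forall t, (P t)%:C = trig_poly s c t.

(* The points of R/Z are represented by reals, so that equality in R/Z is
   congruence modulo 1. *)
Definition eq_mod1 (x y : R) : bool := x - y \is a Num.int.

Definition omega (s : nat) (x : 'I_s -> R) (lam : 'I_s -> nat) t : R :=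
  \prod_(j < s) sin (pi * (t - x j)) ^+ lam j.

(* a, a + 1, ..., a + L - 1 *)
Definition consecutive (a : int) (L : nat) : seq int :=
  [seq a + i%:Z | i <- iota 0 L].

Definition interpolates (s : nat) (x : 'I_s -> R) (lam : 'I_s -> nat) f g
    : Prop :=
  forall (j : 'I_s) (m : nat), (m < lam j)%N ->
    cderive1n m f (x j) = cderive1n m g (x j).

Definition coefficient (Omega : seq int) (eta : int -> R -> R[i]) f (n : int)
    : R[i] :=
  if n \in Omega then 0 else cintegral (fun x => f x * (eta n x)^*).

(* F is the sum in L^2 of the two-sided series of the u n: the partial sums
   over -M <= n <= N tend to F as M and N tend to infinity independently. *)
Definition L2_sum (u : int -> R -> R[i]) (F : R -> R[i]) : Prop :=
  [/\ forall n, cL2 (u n), cL2 F &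
    L2dist F (fun x =>
      \sum_(n <- consecutive (- p.1%:Z) (p.1 + p.2).+1%N) u n x)
      @[p --> filter_prod \oo \oo] --> 0%E].

End ComplexValued.

(* Main.v *)
(**
  Put [z_j = e^(2 pi i x_j)] and let [D] be the difference operator on two-sided
  sequences that composes [b |-> b(n+1) - conj z_j b(n)], each factor taken
  [lam_j] times.  On trigonometric series [D] multiplies by a function of modulus
  [2^L |omega|], [L] the sum of the [lam_j].  By Plancherel and periodization,
  [|| sum_n b_n phi(. + n) ||^2] is the integral over a period of
  [|b|^2 |omega|^2 P], hence comparable with [|| D b ||^2] in [l^2].

  For a finite combination, [c_n = b_n - sum_(k in Omega) b_k conj c^(n)_k].
  Uniqueness of Hermite interpolation shows that [n |-> conj c^(n)_k] is killed by
  [D], so [D c = D b].  By density, [c = c(f)] vanishes on [Omega] and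
  [D c] is in [l^2] with norm controlled by [||f||], for every [f] in [S(phi)].
  The theorem is thereby reduced to: if [c = 0] on [L] consecutive
  integers and [D c] is in [l^2], then [D (r^|n| c_n)] tends to [D c] in [l^2].
  The gap splits this into two one-sided statements, where moving the weight
  through one first-order difference costs the operator
  [(1 - al z) / (1 - r al z)], bounded in [l^2] and strongly convergent to
  the identity as [r] tends to 1.

  Plancherel's formula is proved for continuous functions of compact support with
  the kernel [e^(-eps |y|)], and extended by density.
*)

Require Import Defs.
From HB Require Import structures.
From mathcomp Require Import all_boot all_order all_algebra.
From mathcomp Require Import complex.
From mathcomp Require Import all_classical all_reals all_analysis.
From mathcomp Require Import measurable_realfun.
From mathcomp Require Import ring lra zify.

Import Order.TTheory GRing.Theory Num.Theory.
Import numFieldNormedType.Exports.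

Local Open Scope classical_set_scope.
Local Open Scope ring_scope.
Local Open Scope complex_scope.

Set Implicit Arguments.
Unset Strict Implicit.
Unset Printing Implicit Defensive.

Local Arguments cmod : simpl never.

(** The obstacle is that [Phi] vanishes at the [x j], so the shifts of [phi] form no Riesz basis:
    the coefficients need not lie in l^2, they may grow, and only D c is controlled by the norm of
    f. The kernel of D has dimension L, spanned by polynomials times exponentials, and L consecutive
    zeros are exactly what determines a sequence from its image under D: c is recovered outwards
    from the gap by L first-order recursions in each direction. The recursion 1 / (1 - r al z) has
    l^2 norm at most 1 / (1 - r), and writing (1 - al z) / (1 - r al z) as 1 - (1 - r) al z / (1 - r
    al z) shows that this growth is compensated exactly. The convergence is strong and not in norm,
    whence the separate treatment of heads and tails. The constants comparing || f || with D are
    uniform; bounds on single coefficients are not, and they serve only on a fixed finite window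
    while an approximation error tends to 0. In the same way the weighted coefficients are
    absolutely summable for each fixed r, with bounds that degenerate as r tends to 1, so
    truncations are chosen after r. *)

Section Modulus.
Context {R : realType}.
Implicit Types z w : R[i].

Lemma cmod0 : cmod (0 : R[i]) = 0.
Proof. exact: ComplexField.Normc.normc0. Qed.

Lemma cmod_ge0 z : 0 <= cmod z.
Proof. by case: z => a b; exact: sqrtr_ge0. Qed.

Lemma cmodM z w : cmod (z * w) = cmod z * cmod w.
Proof. exact: ComplexField.Normc.normcM. Qed.

Lemma cmodN z : cmod (- z) = cmod z.
Proof. exact: normcN. Qed.

Lemma cmod_sqr z : cmod z ^+ 2 = complex.Re z ^+ 2 + complex.Im z ^+ 2.
Proof.
by case: z => a b; rewrite /cmod /= sqr_sqrtr// addr_ge0// sqr_ge0.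
Qed.

Lemma cmodD z w : cmod (z + w) <= cmod z + cmod w.
Proof. exact: le_normcD. Qed.

Lemma cmodB z w : cmod (z - w) <= cmod z + cmod w.
Proof. by rewrite (le_trans (cmodD _ _))// cmodN. Qed.

Lemma cmod_conj z : cmod z^* = cmod z.
Proof. by case: z => a b; rewrite /cmod /= sqrrN. Qed.

Lemma cmod_real (x : R) : cmod x%:C = `|x|.
Proof. by rewrite /cmod /= expr0n addr0 sqrtr_sqr. Qed.

Lemma cmodD_sqr z w : cmod (z + w) ^+ 2 <= 2 * cmod z ^+ 2 + 2 * cmod w ^+ 2.
Proof.
rewrite !cmod_sqr; case: z w => a b [c d] /=.
rewrite -subr_ge0.
have -> : 2 * (a ^+ 2 + b ^+ 2) + 2 * (c ^+ 2 + d ^+ 2) -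
  ((a + c) ^+ 2 + (b + d) ^+ 2) = (a - c) ^+ 2 + (b - d) ^+ 2 by ring.
by rewrite addr_ge0// sqr_ge0.
Qed.

Lemma Re_le_cmod z : `|complex.Re z| <= cmod z.
Proof.
rewrite -(@ler_pXn2r _ 2)// ?nnegrE ?cmod_ge0// cmod_sqr.
by rewrite real_normK ?num_real// lerDl sqr_ge0.
Qed.

Lemma Im_le_cmod z : `|complex.Im z| <= cmod z.
Proof.
rewrite -(@ler_pXn2r _ 2)// ?nnegrE ?cmod_ge0// cmod_sqr.
by rewrite real_normK ?num_real// lerDr sqr_ge0.
Qed.

Lemma cmod_le_Re_Im z : cmod z <= `|complex.Re z| + `|complex.Im z|.
Proof.
rewrite -(@ler_pXn2r _ 2)// ?nnegrE ?cmod_ge0 ?addr_ge0//.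
rewrite cmod_sqr sqrrD !real_normK ?num_real// -addrA lerD2l lerDr.
by rewrite mulrn_wge0// mulr_ge0.
Qed.

End Modulus.

(** * Abel means and first-order differences *)

Section AbelOneSided.
Context {R : realType}.
Implicit Types (u v w y : nat -> R[i]) (al be : R[i]) (r : R) (als : seq R[i]).

(** The zero entered at index 0 is where the vanishing on the gap is used: a one-sided sequence is
    taken to be preceded by zeros. *)
Definition delayed u m : R[i] := if m is k.+1 then u k else 0.

Definition ediff al u m : R[i] := u m - al * delayed u m.

Definition ediffs als u := foldl (fun u al => ediff al u) u als.

Definition abel r u m : R[i] := (r ^+ m)%:C * u m.

Definition sqsum u N : R := \sum_(m < N) cmod (u m) ^+ 2.

(** Convolution with 1 / (1 - be z), the two-sided inverse of [ediff be]. *)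
Fixpoint geom be y m : R[i] :=
  if m is k.+1 then be * geom be y k + y m else y 0%N.

Lemma geomE be y m : geom be y m = be * delayed (geom be y) m + y m.
Proof. by case: m => [|m] //=; rewrite mulr0 add0r. Qed.

Lemma ediff_geom be y : ediff be (geom be y) = y.
Proof. by apply/funext => m; rewrite /ediff geomE addrAC subrr add0r. Qed.

Lemma geom_ediff be w : geom be (ediff be w) = w.
Proof.
apply/funext; elim=> [|m IH]; first by rewrite /= /ediff /= mulr0 subr0.
by rewrite /= IH /ediff /= addrC subrK.
Qed.

Lemma ediffC al be u : ediff al (ediff be u) = ediff be (ediff al u).
Proof. by apply/funext => -[|m]; rewrite /ediff /delayed; ring. Qed.

Lemma geom_ediffC al be y : geom be (ediff al y) = ediff al (geom be y).
Proof. by rewrite -[RHS](geom_ediff be) ediffC ediff_geom. Qed.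

(* [abelfactor r al] is convolution with [(1 - al z) / (1 - r al z)]. *)
Definition abelfactor r al y m : R[i] :=
  y m - (1 - r)%:C * al * delayed (geom (r%:C * al) y) m.

Lemma ediff_abelfactor r al be y :
  ediff be (abelfactor r al y) = abelfactor r al (ediff be y).
Proof.
apply/funext => m; rewrite /abelfactor geom_ediffC.
case: m => [|m]; rewrite /ediff /=; first by ring.
by rewrite /delayed; case: m => [|m]; ring.
Qed.

Lemma ediffs_abelfactor r al als y :
  ediffs als (abelfactor r al y) = abelfactor r al (ediffs als y).
Proof. by elim: als y => //= be als IH y; rewrite ediff_abelfactor IH. Qed.

Lemma abel_ediff r al u : abel r (ediff al u) = ediff (r%:C * al) (abel r u).
Proof.
apply/funext => -[|m]; rewrite /abel /ediff /=; first by ring.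
by rewrite exprS rmorphM /=; ring.
Qed.

(** The weight r^m replaces z by r z, so it turns the factor 1 - al z into 1 - r al z. Exchanging
    weight and difference leaves the quotient of the two factors. *)
Lemma ediff_abel r al u : ediff al (abel r u) = abelfactor r al (abel r (ediff al u)).
Proof.
apply/funext => m; rewrite /abelfactor abel_ediff geom_ediff /ediff.
by rewrite rmorphB /= rmorph1; ring.
Qed.

Lemma ediffs_abel r als u :
  ediffs als (abel r u) = foldr (abelfactor r) (abel r (ediffs als u)) als.
Proof.
elim: als u => //= al als IH u.
by rewrite ediff_abel ediffs_abelfactor IH.
Qed.

Lemma sum_delayed (F : R[i] -> R) u N : F 0 = 0 -> (forall z, 0 <= F z) ->
  \sum_(m < N) F (delayed u m) <= \sum_(m < N) F (u m).
Proof.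
move=> F0 Fge0; case: N => [|N]; first by rewrite !big_ord0.
by rewrite big_ord_recl /= F0 add0r big_ord_recr /= lerDl.
Qed.

Lemma sqsum_delayed u N : sqsum (delayed u) N <= sqsum u N.
Proof.
by apply: (sum_delayed (F := fun z => cmod z ^+ 2)) => [|z]; rewrite ?sqr_ge0// cmod0 expr0n.
Qed.

Lemma sqsum_ge0 u N : 0 <= sqsum u N.
Proof. by apply: sumr_ge0 => m _; exact: sqr_ge0. Qed.

Lemma sqsumZ al u N : sqsum (fun m => al * u m) N = cmod al ^+ 2 * sqsum u N.
Proof. by rewrite /sqsum mulr_sumr; apply: eq_bigr => m _; rewrite cmodM exprMn. Qed.

Lemma sqsumD u v N : sqsum (fun m => u m + v m) N <= 2 * sqsum u N + 2 * sqsum v N.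
Proof.
rewrite /sqsum !mulr_sumr -big_split; apply: ler_sum => m _; exact: cmodD_sqr.
Qed.

(** Convexity of the square with weights |be| and 1 - |be| bounds each term by its predecessor and
    one input term; after summation the shifted sum is absorbed on the left. This is the operator
    norm bound 1 / (1 - |be|), valid on every initial section. *)
Lemma geom_sqsum be y N : cmod be < 1 ->
  (1 - cmod be) ^+ 2 * sqsum (geom be y) N <= sqsum y N.
Proof.
set r := cmod be => r1; have r0 : 0 <= r by exact: cmod_ge0.
have q0 : 0 < 1 - r by lra.
have key m : (1 - r) * cmod (geom be y m) ^+ 2 <=
    (1 - r) * (r * cmod (delayed (geom be y) m) ^+ 2) + cmod (y m) ^+ 2.
  rewrite geomE.
  have h : cmod (be * delayed (geom be y) m + y m) <=
      r * cmod (delayed (geom be y) m) + cmod (y m).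
    by rewrite (le_trans (cmodD _ _))// cmodM.
  set p := cmod (delayed _ _) in h *; set q := cmod (y m) in h *.
  have p0 : 0 <= p by exact: cmod_ge0.
  have qq0 : 0 <= q by exact: cmod_ge0.
  have hh : cmod (be * delayed (geom be y) m + y m) ^+ 2 <= (r * p + q) ^+ 2.
    by rewrite ler_pXn2r// nnegrE ?cmod_ge0// addr_ge0// mulr_ge0.
  apply: (le_trans (ler_wpM2l (ltW q0) hh)).
  rewrite -subr_ge0.
  have -> : (1 - r) * (r * p ^+ 2) + q ^+ 2 - (1 - r) * (r * p + q) ^+ 2 =
     r * ((1 - r) * p - q) ^+ 2 by ring.
  by rewrite mulr_ge0// sqr_ge0.
have : (1 - r) * sqsum (geom be y) N <=
    (1 - r) * (r * sqsum (delayed (geom be y)) N) + sqsum y N.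
  rewrite /sqsum !mulr_sumr -big_split /=; apply: ler_sum => m _; exact: key.
have := sqsum_delayed (geom be y) N => h1 h2.
have h3 : (1 - r) * (r * sqsum (delayed (geom be y)) N) <=
   (1 - r) * (r * sqsum (geom be y) N).
  by rewrite ler_wpM2l ?(ltW q0)// ler_wpM2l.
nra.
Qed.

Lemma abel_summable r al u N : 0 <= r < 1 -> cmod al = 1 ->
  (1 - r) * \sum_(m < N) r ^+ m * cmod (u m) <=
  \sum_(m < N) r ^+ m * cmod (ediff al u m).
Proof.
move=> /andP[r0 r1] al1.
have key m : r ^+ m * cmod (u m) <= r ^+ m * cmod (ediff al u m) +
    r * cmod (delayed (abel r u) m).
  have -> : r * cmod (delayed (abel r u) m) = r ^+ m * cmod (al * delayed u m).
    case: m => [|m]; first by rewrite /= mulr0 !cmod0 !mulr0.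
    by rewrite /= !cmodM al1 mul1r cmod_real ger0_norm ?exprn_ge0// exprS mulrA.
  rewrite -mulrDr ler_wpM2l ?exprn_ge0//.
  by apply: le_trans (cmodD _ _); rewrite /ediff subrK.
have h : \sum_(m < N) r ^+ m * cmod (u m) <=
   \sum_(m < N) r ^+ m * cmod (ediff al u m) +
   r * \sum_(m < N) cmod (delayed (abel r u) m).
  by rewrite mulr_sumr -big_split /=; apply: ler_sum => m _; exact: key.
have h2 : \sum_(m < N) cmod (delayed (abel r u) m) <=
    \sum_(m < N) r ^+ m * cmod (u m).
  apply: (le_trans (sum_delayed (F := @cmod R) _ _ _ _)) => //.
  - exact: cmod0.
  - exact: cmod_ge0.
  apply: ler_sum => m _; rewrite /abel cmodM cmod_real ger0_norm//.
  exact: exprn_ge0.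
nra.
Qed.

(** Undoing each difference costs a factor 1 / (1 - r), and summing the weights against a bounded
    sequence costs one more, hence the exponent. Thus the weighted sequence is in l^1 even when [u]
    itself grows. *)
Lemma abel_ediffs_summable r als u V N : 0 <= r < 1 ->
  (forall al, al \in als -> cmod al = 1) ->
  (forall m, cmod (ediffs als u m) <= V) ->
  (1 - r) ^+ (size als).+1 * \sum_(m < N) r ^+ m * cmod (u m) <= V.
Proof.
move=> /andP[r0 r1]; elim: als u => [u _ uV|al als IH u als1 uV].
  rewrite /= expr1.
  have V0 : 0 <= V by exact: le_trans (cmod_ge0 _) (uV 0%N).
  have -> : V = V * 1 by rewrite mulr1.
  have h : \sum_(m < N) r ^+ m * cmod (u m) <= V * \sum_(m < N) r ^+ m.
    rewrite mulr_sumr; apply: ler_sum => m _; rewrite mulrC ler_wpM2r//.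
    exact: exprn_ge0.
  apply: (le_trans (ler_wpM2l _ h)); first by lra.
  rewrite mulrCA ler_wpM2l//.
  have -> : (1 - r) * \sum_(m < N) r ^+ m = 1 - r ^+ N.
    elim: N {h} => [|N IH]; first by rewrite big_ord0 mulr0 expr0 subrr.
    by rewrite big_ord_recr /= mulrDr IH exprS; ring.
  by rewrite lerBlDr lerDl exprn_ge0.
have /= := IH (ediff al u) _ uV; move=> {}IH.
rewrite exprSr -mulrA; apply: le_trans (IH _).
  rewrite ler_wpM2l ?exprn_ge0//; first by lra.
  by apply: abel_summable; rewrite ?r0// als1// mem_head.
by move=> be bels; apply: als1; rewrite inE bels orbT.
Qed.

(** Convergence in l^2 as r increases to 1, expressed through partial sums with a bound uniform in
    their length; [e] bounds the square of the norm. *)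
Definition l2cvg (y : R -> nat -> R[i]) v :=
  forall e : R, 0 < e -> \forall r \near 1^'-,
    forall N, sqsum (fun m => y r m - v m) N <= e.

Definition l2bounded v := exists V : R, forall N, sqsum v N <= V.

Lemma near_left1 (d : R) : 0 < d ->
  \forall r \near 1^'-, 0 <= r < 1 /\ 1 - r <= d.
Proof.
move=> d0; near=> r; split.
  apply/andP; split; last by near: r; exact: nbhs_left_lt.
  by apply: ltW; near: r; exact: nbhs_left_gt.
rewrite lerBlDr -lerBlDl; apply: ltW; near: r; apply: nbhs_left_gt.
by rewrite ltrBlDr ltrDl.
Unshelve. all: by end_near. Qed.

Lemma sqsumS u N : sqsum u N.+1 = sqsum u N + cmod (u N) ^+ 2.
Proof. by rewrite /sqsum big_ord_recr. Qed.

Lemma le_sqsum u v N : (forall m, cmod (u m) <= cmod (v m)) -> sqsum u N <= sqsum v N.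
Proof.
by move=> uv; apply: ler_sum => m _; rewrite ler_pXn2r// nnegrE cmod_ge0.
Qed.

Definition tailseq K u m : R[i] := if (m < K)%N then 0 else u m.

Definition headseq K u m : R[i] := if (m < K)%N then u m else 0.

Lemma head_tailseq K u m : u m = headseq K u m + tailseq K u m.
Proof. by rewrite /headseq /tailseq; case: ifP; rewrite ?addr0 ?add0r. Qed.

Lemma sqsum_tailseq K u N : (K <= N)%N ->
  sqsum u N = sqsum u K + sqsum (tailseq K u) N.
Proof.
elim: N => [|N IH]; first by rewrite leqn0 => /eqP ->; rewrite /sqsum !big_ord0 addr0.
rewrite leq_eqVlt => /predU1P[->|KN]; last first.
  by rewrite !sqsumS IH// addrA /tailseq ltnNge -ltnS KN.
rewrite [X in _ + X](_ : _ = 0) ?addr0//; apply: big1 => m _.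
by rewrite /tailseq ltn_ord cmod0 expr0n.
Qed.

(** The supremum of the partial sums plays the part of the squared norm: once a partial sum is
    within [e] of it, all later terms together contribute at most [e]. *)
Lemma sqsum_tail_small v (e : R) : l2bounded v -> 0 < e ->
  exists K, forall N, sqsum (tailseq K v) N <= e.
Proof.
move=> [V vV] e0.
have hs : has_sup (range (sqsum v)).
  by split; [exists (sqsum v 0%N), 0%N|exists V => _ [N _ <-]].
have [_ [K _ <-] Ke] := sup_adherent e0 hs.
exists K => N; have [KN|/ltnW NK] := leqP K N.
  have := ub_le_sup hs.2 (ex_intro2 _ _ N I erefl : range (sqsum v) (sqsum v N)).
  by rewrite (sqsum_tailseq _ KN); lra.
rewrite /sqsum big1 ?(ltW e0)// => m _.
by rewrite /tailseq (leq_trans (ltn_ord m) NK) cmod0 expr0n.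
Qed.

Lemma geom_l1 be y N : cmod be < 1 ->
  (1 - cmod be) * \sum_(m < N) cmod (geom be y m) <= \sum_(m < N) cmod (y m).
Proof.
move=> be1.
have h : \sum_(m < N) cmod (geom be y m) <=
  cmod be * \sum_(m < N) cmod (delayed (geom be y) m) + \sum_(m < N) cmod (y m).
  rewrite mulr_sumr -big_split /=; apply: ler_sum => m _.
  by rewrite geomE (le_trans (cmodD _ _))// cmodM.
have := @sum_delayed (@cmod R) (geom be y) N cmod0 cmod_ge0.
have := cmod_ge0 be; nra.
Qed.

Lemma geom_bound be y m : cmod be <= 1 ->
  cmod (geom be y m) <= \sum_(k < m.+1) cmod (y k).
Proof.
move=> be1; elim: m => [|m IH]; first by rewrite big_ord1.
rewrite big_ord_recr /= (le_trans (cmodD _ _))// lerD// cmodM.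
apply: le_trans IH; have := cmod_ge0 (geom be y m); nra.
Qed.

Lemma geomD be y w m : geom be (fun k => y k + w k) m = geom be y m + geom be w m.
Proof. by elim: m => //= m ->; ring. Qed.

Lemma sum_headseq (F : R[i] -> R) K v M : F 0 = 0 -> (forall z, 0 <= F z) ->
  \sum_(m < M) F (headseq K v m) <= \sum_(m < K) F (v m).
Proof.
move=> F0 Fge0.
have -> : \sum_(m < K) F (v m) = \sum_(m < K) F (headseq K v m).
  by apply: eq_bigr => m _; rewrite /headseq ltn_ord.
have : forall m, (K <= m)%N -> headseq K v m = 0.
  by move=> m Km; rewrite /headseq ltnNge Km.
move: (headseq K v) => h h0; have [KM|/ltnW MK] := leqP K M; last first.
  by rewrite -(subnKC MK) big_split_ord /= lerDl sumr_ge0.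
rewrite -(subnKC KM) big_split_ord /= [X in _ + X](_ : _ = 0) ?addr0//.
by apply: big1 => m _; rewrite h0 ?leq_addr.
Qed.

(** For a finitely supported input the output is bounded in sup norm by A and in l^1 by A / (1 -
    |be|). Their product bounds the squared l^2 norm and gains one power of 1 - |be| over
    [geom_sqsum]. *)
Lemma geom_head_sqsum be K v N : cmod be < 1 ->
  (1 - cmod be) ^+ 2 * sqsum (geom be (headseq K v)) N <=
  (1 - cmod be) * (\sum_(m < K) cmod (v m)) ^+ 2.
Proof.
move=> be1; set A := \sum_(m < K) _.
have A0 : 0 <= A by apply: sumr_ge0 => m _; exact: cmod_ge0.
have hA M : \sum_(m < M) cmod (headseq K v m) <= A.
  exact: (sum_headseq (F := @cmod R) _ _ _ cmod0 cmod_ge0).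
have h1 : sqsum (geom be (headseq K v)) N <=
    A * \sum_(m < N) cmod (geom be (headseq K v) m).
  rewrite mulr_sumr; apply: ler_sum => m _; rewrite expr2 ler_wpM2r ?cmod_ge0//.
  by apply: (le_trans (geom_bound _ _ (ltW be1))).
have h2 := le_trans (geom_l1 (headseq K v) N be1) (hA N).
have q0 : 0 < 1 - cmod be by lra.
move: q0 h1 h2; move: (1 - cmod be) (sqsum _ _) (\sum_(m < N) _) => q S T q0 h1 h2.
have -> : q * A ^+ 2 = q * (A * A) by ring.
rewrite expr2 -mulrA ler_wpM2l ?(ltW q0)//.
apply: (le_trans (ler_wpM2l (ltW q0) h1)).
by rewrite mulrCA ler_wpM2l.
Qed.

(** Strong convergence to 0 of (1 - r) / (1 - r al z). Tails of [v] are handled by the uniform bound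
    [geom_sqsum], the head by the extra power of 1 - r in [geom_head_sqsum]. *)
Lemma geom_cvg0 al v (e : R) : cmod al = 1 -> l2bounded v -> 0 < e ->
  \forall r \near 1^'-, forall N,
    (1 - r) ^+ 2 * sqsum (geom (r%:C * al) v) N <= e.
Proof.
move=> al1 bv e0.
(* [ltr0Sn _ 3] makes the tolerance e / 4, because [sqsumD] doubles both the head and the tail. *)
have [K vK] := sqsum_tail_small bv (divr_gt0 e0 (ltr0Sn _ 3)).
set A := (\sum_(m < K) cmod (v m)) ^+ 2.
have A0 : 0 <= A by exact: sqr_ge0.
have d0 : 0 < e / 4 / (A + 1) by rewrite !divr_gt0// ltr_wpDl.
apply: filterS (near_left1 d0) => r [/andP[r0 r1] rd] N.
set be := r%:C * al.
have ber : cmod be = r by rewrite cmodM al1 mulr1 cmod_real ger0_norm.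
have be1 : cmod be < 1 by rewrite ber.
have h1 := geom_head_sqsum K v N be1.
have h2 := le_trans (geom_sqsum (tailseq K v) N be1) (vK N).
have -> : geom be v = fun m => geom be (headseq K v) m + geom be (tailseq K v) m.
  apply/funext => m; rewrite -geomD; congr (geom _ _ _).
  by apply/funext => k; exact: head_tailseq.
apply: (le_trans (ler_wpM2l (sqr_ge0 _) (sqsumD _ _ _))).
rewrite ber -/A in h1 h2.
have h3 : (1 - r) * A <= e / 4.
  have := ler_wpM2r (_ : 0 <= A + 1) rd; rewrite divfK ?gt_eqF ?ltr_wpDl//.
  move=> /(_ (addr_ge0 A0 ler01)); have q0 : 0 <= 1 - r by lra.
  nra.
lra.
Qed.

(** Both the operator and its argument depend on r. The difference [y r - v] is controlled by the
    uniform operator bound, the fixed limit [v] by strong convergence. *)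
Lemma abelfactor_cvg al (y : R -> nat -> R[i]) v : cmod al = 1 ->
  l2bounded v -> l2cvg y v -> l2cvg (fun r => abelfactor r al (y r)) v.
Proof.
move=> al1 bv yv e e0.
have e8 : 0 < e / 16 by rewrite divr_gt0.
have := yv _ e8; apply: filterS3 (geom_cvg0 al1 bv e8) (near_left1 ltr01).
move=> r hg [/andP[r0 r1] _] hy N.
set be := r%:C * al.
have ber : cmod be = r by rewrite cmodM al1 mulr1 cmod_real ger0_norm.
have be1 : cmod be < 1 by rewrite ber.
pose d m := y r m - v m.
have -> : (fun m => abelfactor r al (y r) m - v m) = fun m => d m +
    (- ((1 - r)%:C * al)) * (delayed (geom be d) m + delayed (geom be v) m).
  apply/funext => m; rewrite /abelfactor.
  have -> : delayed (geom be (y r)) m = delayed (geom be d) m + delayed (geom be v) m.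
    case: m => [|m] /=; first by rewrite addr0.
    by rewrite -geomD; congr geom; apply/funext => k; rewrite /d subrK.
  by rewrite /d; ring.
apply: (le_trans (sqsumD _ _ _)); rewrite sqsumZ cmodN cmodM al1 mulr1 cmod_real.
rewrite real_normK ?num_real//.
have h1 := sqsumD (delayed (geom be d)) (delayed (geom be v)) N.
have h2 := sqsum_delayed (geom be d) N.
have h3 := sqsum_delayed (geom be v) N.
have h4 := geom_sqsum d N be1; rewrite ber in h4.
have h5 := hy N; rewrite -/d in h5.
have h6 := hg N; rewrite -/be in h6.
have q0 : 0 <= (1 - r) ^+ 2 by exact: sqr_ge0.
have h7 : sqsum (fun m => delayed (geom be d) m + delayed (geom be v) m) N <=
  2 * sqsum (geom be d) N + 2 * sqsum (geom be v) N by lra.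
have := ler_wpM2l q0 h7; lra.
Qed.

Lemma abel_cvg v : l2bounded v -> l2cvg (abel ^~ v) v.
Proof.
move=> bv e e0; have [V vV] := bv.
have V0 : 0 <= V by exact: le_trans (sqsum_ge0 _ _) (vV 0%N).
have [K vK] := sqsum_tail_small bv (divr_gt0 e0 (ltr0Sn _ 3)).
(* On the first K terms 1 - r^m is at most K (1 - r) by Bernoulli's inequality, so the head
   contributes at most (1 - r)^2 A. *)
pose A := K%:R ^+ 2 * V.
have A0 : 0 <= A by rewrite mulr_ge0// sqr_ge0.
have d0 : 0 < Num.min 1 (e / 4 / (A + 1)).
  by rewrite lt_min ltr01 !divr_gt0// ltr_wpDl.
apply: filterS (near_left1 d0) => r [/andP[r0 r1]].
rewrite le_min => /andP[rd1 rd] N.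
have q0 : 0 <= 1 - r by lra.
have pow m : 0 <= 1 - r ^+ m <= m%:R * (1 - r).
  rewrite subr_ge0 exprn_ile1 ?(ltW r1)//=.
  elim: m => [|m IH]; first by rewrite expr0 subrr mul0r.
  rewrite exprS -natr1; have := exprn_ge0 m r0; have := exprn_ile1 m r0 (ltW r1).
  nra.
have -> : (fun m => abel r v m - v m) = fun m =>
   ((r ^+ m)%:C - 1) * headseq K v m + ((r ^+ m)%:C - 1) * tailseq K v m.
  by apply/funext => m; rewrite -mulrDr -head_tailseq /abel mulrBl mul1r.
have cm m : cmod ((r ^+ m)%:C - 1) = 1 - r ^+ m.
  rewrite -(rmorph1 (real_complex R)) -rmorphB cmod_real distrC ger0_norm//.
  by case/andP: (pow m).
apply: (le_trans (sqsumD _ _ _)).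
have h1 : sqsum (fun m => ((r ^+ m)%:C - 1) * tailseq K v m) N <= e / 4.
  apply: le_trans (vK N); apply: le_sqsum => m; rewrite cmodM cm.
  have := cmod_ge0 (tailseq K v m); have /andP[] := pow m.
  have := exprn_ge0 m r0; nra.
have h2 : sqsum (fun m => ((r ^+ m)%:C - 1) * headseq K v m) N <= (1 - r) ^+ 2 * A.
  have -> : (1 - r) ^+ 2 * A = cmod (K%:R * (1 - r))%:C ^+ 2 * V.
    by rewrite cmod_real real_normK ?num_real// /A exprMn; ring.
  apply: (@le_trans _ _ (cmod (K%:R * (1 - r))%:C ^+ 2 * sqsum v N)); last first.
    by rewrite ler_wpM2l// sqr_ge0.
  rewrite -sqsumZ; apply: le_sqsum => m.
  rewrite !cmodM cm cmod_real ger0_norm ?mulr_ge0//.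
  rewrite /headseq; case: ifP => mK; last first.
    by rewrite cmod0 mulr0 !mulr_ge0// cmod_ge0.
  rewrite ler_wpM2r ?cmod_ge0//; have /andP[_ /le_trans] := pow m; apply.
  by rewrite ler_wpM2r// ler_nat ltnW.
have h3 : (1 - r) ^+ 2 * A <= e / 4.
  have := ler_wpM2r (_ : 0 <= A + 1) rd; rewrite divfK ?gt_eqF ?ltr_wpDl//.
  move=> /(_ (addr_ge0 A0 ler01)); have : (1 - r) ^+ 2 <= 1 - r by nra.
  move=> /(ler_wpM2r A0); nra.
lra.
Qed.

(** The factors of [ediffs_abel] each preserve convergence to [ediffs als u], so they are applied
    one at a time to the weighted sequence. *)
Lemma ediffs_abel_cvg als u : (forall al, al \in als -> cmod al = 1) ->
  l2bounded (ediffs als u) ->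
  l2cvg (fun r => ediffs als (abel r u)) (ediffs als u).
Proof.
move=> als1 bv.
have -> : (fun r => ediffs als (abel r u)) =
   (fun r => foldr (abelfactor r) (abel r (ediffs als u)) als).
  by apply/funext => r; rewrite ediffs_abel.
move: (ediffs als u) bv => v bv.
elim: als als1 => [_|al als IH als1] /=; first exact: abel_cvg.
apply: abelfactor_cvg => //; first by rewrite als1// mem_head.
by apply: IH => be bels; rewrite als1// inE bels orbT.
Qed.

Lemma ediff_sqsum al u N : cmod al = 1 -> sqsum (ediff al u) N <= 4 * sqsum u N.
Proof.
move=> al1; have -> : ediff al u = fun m => u m + (- al) * delayed u m.
  by apply/funext => m; rewrite mulNr.
have := sqsumD u (fun m => (- al) * delayed u m) N.
rewrite sqsumZ cmodN al1 expr1n mul1r; have := sqsum_delayed u N; lra.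
Qed.

Lemma ediffs_sqsum als u N : (forall al, al \in als -> cmod al = 1) ->
  sqsum (ediffs als u) N <= 4 ^+ size als * sqsum u N.
Proof.
elim: als u => [|al als IH] u als1; first by rewrite expr0 mul1r.
apply: (le_trans (IH _ _)) => [be bels|]; first by rewrite als1// inE bels orbT.
by rewrite exprSr -mulrA ler_wpM2l ?exprn_ge0// ediff_sqsum// als1// mem_head.
Qed.

Lemma ediffsD als u w :
  ediffs als (fun m => u m + w m) = fun m => ediffs als u m + ediffs als w m.
Proof.
elim: als u w => //= al als IH u w; rewrite -IH; congr ediffs.
by apply/funext => -[|m]; rewrite /ediff /=; ring.
Qed.

Lemma ediffsZ als k u :
  ediffs als (fun m => k * u m) = fun m => k * ediffs als u m.
Proof.
elim: als u => //= al als IH u; rewrite -IH; congr ediffs.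
by apply/funext => -[|m]; rewrite /ediff /=; ring.
Qed.

(** Counted from the edge of the gap, the weight r^|n| need not be a power of r in the new index:
    the origin may lie further out. It is a multiple of r^m from some index [K] on, and the earlier
    weights, finitely many, all tend to 1. *)
Lemma ediffs_weighted_cvg als u (w : R -> nat -> R) (k : R -> R) K :
  (forall al, al \in als -> cmod al = 1) -> l2bounded (ediffs als u) ->
  k r @[r --> 1^'-] --> (1 : R) ->
  (forall m, (m < K)%N -> w r m @[r --> 1^'-] --> (1 : R)) ->
  (\forall r \near 1^'-, forall m, (K <= m)%N -> w r m = k r * r ^+ m) ->
  l2cvg (fun r => ediffs als (fun m => (w r m)%:C * u m)) (ediffs als u).
Proof.
move=> als1 bv k1 w1 wk e e0.
have Wv := ediffs_abel_cvg als1 bv.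
have [V vV] := bv.
have V0 : 0 <= V by exact: le_trans (sqsum_ge0 _ _) (vV 0%N).
set v := ediffs als u in bv vV Wv *.
pose U := 4 ^+ size als * sqsum u K + 1.
have U0 : 0 < U by rewrite ltr_wpDl// mulr_ge0 ?exprn_ge0// sqsum_ge0.
have d0 : 0 < Num.min 1 (e / 16 / U) by rewrite lt_min ltr01 !divr_gt0.
have d'0 : 0 < Num.min 1 (e / 16 / (V + 1)).
  by rewrite lt_min ltr01 !divr_gt0// ltr_wpDl.
have e64 : 0 < e / 64 by rewrite divr_gt0.
have rho0 (m : 'I_K) : \forall r \near 1^'-,
    `|w r m - k r * r ^+ m| <= Num.min 1 (e / 16 / U).
  apply: cvgr0_norm_le d0.
  have <- : 1 - 1 * 1 = 0 :> R by rewrite mulr1 subrr.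
  apply: cvgB; first by apply: w1.
  apply: cvgM => //; rewrite -[X in _ --> X](expr1n R m).
  by apply: cvg_at_left_filter; exact: exprn_continuous.
have {}rho0 : \forall r \near 1^'-, forall m : 'I_K,
    `|w r m - k r * r ^+ m| <= Num.min 1 (e / 16 / U).
  exact: filter_forall.
have kd : \forall r \near 1^'-, `|k r - 1| <= Num.min 1 (e / 16 / (V + 1)).
  move/cvgrPdist_le: k1 => /(_ _ d'0); apply: filterS => r; by rewrite distrC.
near=> r => N.
have rhor : forall m : 'I_K, `|w r m - k r * r ^+ m| <= Num.min 1 (e / 16 / U).
  by near: r.
have wkr : forall m, (K <= m)%N -> w r m = k r * r ^+ m by near: r.
have Wvr : forall N, sqsum (fun m => ediffs als (abel r u) m - v m) N <= e / 64.
  by near: r; exact: Wv.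
have kdr : `|k r - 1| <= Num.min 1 (e / 16 / (V + 1)) by near: r.
(* The discrepancy from the pure weight [k r * r ^+ m] lives on the first [K] indices, so the
   differences of it are bounded by [4 ^+ size als] times a vanishing multiple of [sqsum u K]. *)
pose rho m := (w r m - k r * r ^+ m)%:C * u m.
have -> : (fun m => ediffs als (fun m => (w r m)%:C * u m) m - v m) = fun m =>
   (k r)%:C * (ediffs als (abel r u) m - v m) +
   ((k r - 1)%:C * v m + ediffs als rho m).
  have -> : (fun m => (w r m)%:C * u m) = fun m => (k r)%:C * abel r u m + rho m.
    by apply/funext => m; rewrite /rho /abel !rmorphB rmorphM /=; ring.
  rewrite ediffsD ediffsZ; apply/funext => m.
  by rewrite rmorphB /= rmorph1; ring.
have h1 := sqsumD (fun m => (k r)%:C * (ediffs als (abel r u) m - v m))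
  (fun m => (k r - 1)%:C * v m + ediffs als rho m) N.
have h2 := sqsumD (fun m => (k r - 1)%:C * v m) (ediffs als rho) N.
have h3 := ediffs_sqsum rho N als1.
move: h1 h2; rewrite !sqsumZ !cmod_real !real_normK ?num_real// => h1 h2.
move: kdr; rewrite le_min => /andP[kd1 kd2].
have kr2 : k r ^+ 2 <= 4.
  by move: kd1; rewrite ler_norml => /andP[? ?]; nra.
have h4 : k r ^+ 2 * sqsum (fun m => ediffs als (abel r u) m - v m) N <= e / 16.
  have := Wvr N; have := sqsum_ge0 (fun m => ediffs als (abel r u) m - v m) N.
  by have := sqr_ge0 (k r); nra.
have h5 : (k r - 1) ^+ 2 * sqsum v N <= e / 16.
  have : (k r - 1) ^+ 2 <= e / 16 / (V + 1).
    apply: le_trans kd2; rewrite -real_normK ?num_real//.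
    by have := normr_ge0 (k r - 1); nra.
  rewrite ler_pdivlMr ?ltr_wpDl//; have := vV N; have := sqsum_ge0 v N.
  have := sqr_ge0 (k r - 1); nra.
have h6 : 4 ^+ size als * sqsum rho N <= e / 16.
  set d := Num.min 1 (e / 16 / U) in rhor d0.
  have h : sqsum rho N <= d ^+ 2 * sqsum u K.
    have hd : d ^+ 2 = cmod d%:C ^+ 2 by rewrite cmod_real real_normK ?num_real.
    apply: (@le_trans _ _ (d ^+ 2 * sqsum (headseq K u) N)); last first.
      rewrite ler_wpM2l ?sqr_ge0//.
      apply: (sum_headseq (F := fun z => cmod z ^+ 2)) => [|z]; last exact: sqr_ge0.
      by rewrite cmod0 expr0n.
    rewrite hd -sqsumZ; apply: le_sqsum => m; rewrite !cmodM !cmod_real.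
    rewrite (ger0_norm (ltW d0)) /headseq; case: ifPn => mK; last first.
      by rewrite -leqNgt in mK; rewrite wkr// subrr normr0 mul0r cmod0 mulr0.
    by rewrite ler_wpM2r ?cmod_ge0//; exact: (rhor (Ordinal mK)).
  have dd : d ^+ 2 * U <= e / 16.
    have d1 : d <= 1 by rewrite /d ge_min lexx.
    have : d <= e / 16 / U by rewrite /d ge_min lexx orbT.
    rewrite ler_pdivlMr// => dU; apply: le_trans dU.
    by rewrite ler_wpM2r ?(ltW U0)//; nra.
  have f0 : 0 <= 4 ^+ size als :> R by rewrite exprn_ge0.
  have := ler_wpM2l f0 h.
  have := sqr_ge0 d; move: dd; rewrite /U; nra.
lra.
Unshelve. all: by end_near. Qed.

Lemma ediffs_abel_int_cvg als u (n : int) :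
  (forall al, al \in als -> cmod al = 1) -> l2bounded (ediffs als u) ->
  l2cvg (fun r => ediffs als (fun m => (r ^+ `|n + m%:Z|)%:C * u m)) (ediffs als u).
Proof.
move=> als1 bv.
have pow (j : nat) : (r : R) ^+ j @[r --> 1^'-] --> (1 : R).
  rewrite -[X in _ --> X](expr1n _ j).
  by apply: cvg_at_left_filter; exact: exprn_continuous.
case: n => n.
  apply: (ediffs_weighted_cvg als1 bv (k := fun r => r ^+ n) (K := 0%N)) => //.
  by apply: nearW => r m _; rewrite -PoszD absz_nat exprD.
(* From the base point -(n + 1) the absolute value falls until m = n + 1 and then equals m - (n +
   1), hence the factor r^-(n + 1). *)
apply: (ediffs_weighted_cvg als1 bv (k := fun r => (r ^+ n.+1)^-1) (K := n.+1)) => //.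
  by rewrite -[X in _ --> X]invr1; apply: cvgV => //; rewrite oner_eq0.
have := @nbhs_left_gt R 1 0 ltr01; apply: filterS => r r0 m nm.
have -> : Negz n + m%:Z = (m - n.+1)%N%:Z by lia.
by rewrite absz_nat -{2}(subnK nm) exprD mulrCA mulVf ?mulr1// expf_neq0// gt_eqF.
Qed.

End AbelOneSided.

(** * Two-sided sequences vanishing on a gap *)

Section TwoSided.
Context {R : realType}.
Implicit Types (c : int -> R[i]) (zs : seq R[i]) (a : int) (r : R).

Definition zdiff (w : R[i]) c (n : int) : R[i] := c (n + 1) - w * c n.

Definition zdiffs (ws : seq R[i]) c := foldl (fun c w => zdiff w c) c ws.

Lemma mem_consecutive a L n : (n \in consecutive a L) = (a <= n < a + L%:Z).
Proof.
apply/mapP/idP => [[i + ->]|/andP[an nL]].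
  by rewrite mem_iota; lia.
by exists `|n - a|%N; [rewrite mem_iota; lia|lia].
Qed.

(** Each forward difference loses one index at the right end of the gap. There are as many
    differences as gap indices, so to the right of the gap the operator acts as on a one-sided
    sequence preceded by zeros. *)
Lemma zdiffs_pos ws c a : {in consecutive a (size ws), forall n, c n = 0} ->
  forall m : nat, zdiffs ws c (a + m%:Z) =
    ediffs ws (fun k => c (a + (size ws)%:Z + k%:Z)) m.
Proof.
elim: ws c => [|w ws IH] c c0 m /=; first by rewrite addr0.
rewrite IH => [|n].
  congr ediffs; apply/funext => -[|k]; rewrite /zdiff /ediff /=.
    by rewrite [c (a + _ + 0)]c0 ?mem_consecutive /=; [congr (c _ - _ * _); lia|lia].
  by congr (c _ - _ * c _); lia.
rewrite mem_consecutive => an; rewrite /zdiff !c0 ?mulr0 ?subr0// mem_consecutive /=; lia.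
Qed.

(** Reading leftwards, c(n + 1) - conj z c(n) equals - conj z times c(n) - z c(n + 1) because |z| =
    1. The conjugated nodes thus become the nodes themselves, up to a unimodular constant. *)
Lemma zdiffs_neg zs c a : (forall z, z \in zs -> cmod z = 1) ->
  {in consecutive a (size zs), forall n, c n = 0} ->
  forall m : nat, zdiffs (map conjc zs) c (a - 1 - m%:Z) =
    \prod_(z <- zs) (- z^*) * ediffs zs (fun k => c (a - 1 - k%:Z)) m.
Proof.
elim: zs c => [|z zs IH] c zs1 c0 m /=; first by rewrite big_nil mul1r.
rewrite IH => [|w wzs|n]; last 2 first.
- by rewrite zs1// inE wzs orbT.
- by rewrite mem_consecutive => an; rewrite /zdiff !c0 ?mulr0 ?subr0// mem_consecutive /=; lia.
have z1 : z^* * z = 1.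
  have : cmod z ^+ 2 = 1 by rewrite zs1 ?mem_head// expr1n.
  rewrite cmod_sqr; case: (z) => x y /= h; simpc; congr (_ +i* _); last by ring.
  by rewrite -h; ring.
have -> : (fun k : nat => zdiff z^* c (a - 1 - k%:Z)) = fun k : nat =>
    (- z^*) * ediff z (fun k : nat => c (a - 1 - k%:Z)) k.
  apply/funext => -[|k]; rewrite /zdiff /ediff /=.
    rewrite [c (a - 1 - 0 + 1)]c0 ?mem_consecutive /=; last by lia.
    by ring.
  rewrite mulrBr mulrA [(- z^*) * z]mulNr z1.
  rewrite (_ : a - 1 - k.+1%:Z + 1 = a - 1 - k%:Z); last by lia.
  by ring.
by rewrite ediffsZ big_cons; ring.
Qed.

(** Sum of squares over the 2N integers from a - N to a + N - 1, split at [a] to match [zdiffs_pos]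
    and [zdiffs_neg]. *)
Definition wsum a c N : R :=
  sqsum (fun m : nat => c (a + m%:Z)) N + sqsum (fun m : nat => c (a - 1 - m%:Z)) N.

Definition wl1 a (F : int -> R) N : R :=
  \sum_(m < N) (F (a + m%:Z) + F (a - 1 - m%:Z)).

Lemma wsum_ge0 a c N : 0 <= wsum a c N.
Proof. by rewrite addr_ge0// sqsum_ge0. Qed.

Lemma cmod_prodN_conj zs : (forall z, z \in zs -> cmod z = 1) ->
  cmod (\prod_(z <- zs) (- z^*)) = 1.
Proof.
elim: zs => [_|z zs IH zs1]; first by rewrite big_nil /cmod ComplexField.Normc.normc1.
rewrite big_cons cmodM cmodN cmod_conj zs1 ?mem_head// mul1r IH// => w wzs.
by rewrite zs1// inE wzs orbT.
Qed.

Definition abelz r c (n : int) : R[i] := (r ^+ `|n|)%:C * c n.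

Lemma zdiffs_abel_cvg zs c a : (forall z, z \in zs -> cmod z = 1) ->
  {in consecutive a (size zs), forall n, c n = 0} ->
  (exists V, forall N, wsum a (zdiffs (map conjc zs) c) N <= V) ->
  forall e : R, 0 < e -> \forall r \near 1^'-, forall N,
    wsum a (fun n => zdiffs (map conjc zs) (abelz r c) n - zdiffs (map conjc zs) c n) N <= e.
Proof.
move=> zs1 c0 [V cV] e e0.
have c0' r : {in consecutive a (size zs), forall n, abelz r c n = 0}.
  by move=> n /c0; rewrite /abelz => ->; rewrite mulr0.
have zs1' w : w \in map conjc zs -> cmod w = 1.
  by move=> /mapP[z zzs ->]; rewrite cmod_conj zs1.
have e2 : 0 < e / 2 by rewrite divr_gt0.
have posE d : {in consecutive a (size zs), forall n, d n = 0} ->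
    (fun m : nat => zdiffs (map conjc zs) d (a + m%:Z)) =
    ediffs (map conjc zs) (fun k : nat => d (a + (size zs)%:Z + k%:Z)).
  by move=> d0; apply/funext => m; rewrite zdiffs_pos size_map.
have negE d : {in consecutive a (size zs), forall n, d n = 0} ->
    (fun m : nat => zdiffs (map conjc zs) d (a - 1 - m%:Z)) = fun m =>
    \prod_(z <- zs) (- z^*) * ediffs zs (fun k : nat => d (a - 1 - k%:Z)) m.
  by move=> d0; apply/funext => m; rewrite zdiffs_neg.
have P1 := cmod_prodN_conj zs1.
have bpos : l2bounded (ediffs (map conjc zs) (fun k : nat => c (a + (size zs)%:Z + k%:Z))).
  exists V => N; rewrite -posE//; apply: le_trans (cV N).
  by rewrite lerDl sqsum_ge0.
have bneg : l2bounded (ediffs zs (fun k : nat => c (a - 1 - k%:Z))).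
  exists V => N; apply: le_trans (cV N); rewrite /wsum (negE c c0) sqsumZ P1.
  by rewrite expr1n mul1r lerDr sqsum_ge0.
(* On the left half |a - 1 - k| = |(1 - a) + k|, so the weights start from the base point 1 - a. *)
have := ediffs_abel_int_cvg (1 - a) zs1 bneg e2.
apply: filterS2 (ediffs_abel_int_cvg (a + (size zs)%:Z) zs1' bpos e2) => r hp hn N.
rewrite /wsum [e](_ : _ = e / 2 + e / 2); last by lra.
apply: lerD.
  rewrite (_ : (fun m : nat => _) = fun m : nat =>
     ediffs (map conjc zs) (fun k : nat => abelz r c (a + (size zs)%:Z + k%:Z)) m -
     ediffs (map conjc zs) (fun k : nat => c (a + (size zs)%:Z + k%:Z)) m); last first.
    by apply/funext => m; rewrite !zdiffs_pos ?size_map.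
  exact: hp.
rewrite (_ : (fun m : nat => _) = fun m : nat => \prod_(z <- zs) (- z^*) *
   (ediffs zs (fun k : nat => abelz r c (a - 1 - k%:Z)) m -
    ediffs zs (fun k : nat => c (a - 1 - k%:Z)) m)); last first.
  by apply/funext => m; rewrite !zdiffs_neg// mulrBr.
rewrite sqsumZ P1 expr1n mul1r.
rewrite (_ : (fun k : nat => abelz r c (a - 1 - k%:Z)) = fun k : nat =>
  (r ^+ absz (1 - a + k%:Z)%R)%:C * c (a - 1 - k%:Z)); first exact: hn.
apply/funext => k; rewrite /abelz; congr ((r ^+ _)%:C * _); lia.
Qed.

(** [abel_ediffs_summable] uses weights counted from the gap, whereas [abelz] counts from the
    origin; the two differ by a bounded shift of the exponent, which costs a constant factor. *)
Lemma zdiffs_abel_summable zs c a r : (forall z, z \in zs -> cmod z = 1) ->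
  {in consecutive a (size zs), forall n, c n = 0} ->
  (exists V, forall N, wsum a (zdiffs (map conjc zs) c) N <= V) ->
  0 <= r < 1 ->
  exists B, forall N, wl1 a (fun n => cmod (abelz r c n)) N <= B.
Proof.
move=> zs1 c0 [V cV] /andP[r0 r1].
have zs1' w : w \in map conjc zs -> cmod w = 1.
  by move=> /mapP[z zzs ->]; rewrite cmod_conj zs1.
have V0 : 0 <= V by exact: le_trans (wsum_ge0 _ _ _) (cV 0%N).
have P1 := cmod_prodN_conj zs1.
have sqb (u : nat -> R[i]) : (forall N, sqsum u N <= V) -> forall m, cmod (u m) <= V + 1.
  move=> uV m; have := uV m.+1; rewrite sqsumS; have := sqsum_ge0 u m.
  by have := cmod_ge0 (u m); nra.
(* A ratio between r and 1 that stays positive when r = 0, so that division by t^K is allowed. *)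
pose t := (1 + r) / 2.
have [t0 t1 rt] : [/\ 0 < t, t < 1 & r <= t] by rewrite /t; split; lra.
have t01 : 0 <= t < 1 by rewrite (ltW t0).
have q0 : 0 < (1 - t) ^+ (size zs).+1 by rewrite exprn_gt0// subr_gt0.
have weight (k : nat) (n : int) : (k <= `|n|)%N -> r ^+ `|n| <= t ^+ k.
  move=> kn; apply: (@le_trans _ _ (t ^+ `|n|)).
    by rewrite lerXn2r// ?nnegrE// ltW.
  by rewrite ler_wiXn2l// ltW.
(* K is at least the distance from the origin to the first index of either half, so an index counted
   from the gap is at most |n| + K. *)
pose K : nat := (`|a| + size zs + 1)%N.
have tK : 0 < t ^+ K by exact: exprn_gt0.
have weight' (m : nat) (n : int) : (m <= `|n| + K)%N -> r ^+ `|n| <= t ^+ m / t ^+ K.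
  move=> mn; rewrite ler_pdivlMr//.
  apply: (@le_trans _ _ (t ^+ (`|n| + K))); last by rewrite ler_wiXn2l// ltW.
  rewrite exprD ler_wpM2r ?(ltW tK)//; exact: weight.
have pos (u : nat -> R[i]) ws (n : nat -> int) N : size ws = size zs ->
    (forall w, w \in ws -> cmod w = 1) -> (forall N, sqsum (ediffs ws u) N <= V) ->
    (forall m, (m <= `|n m| + K)%N) ->
    \sum_(m < N) r ^+ `|n m| * cmod (u m) <= (V + 1) / (1 - t) ^+ (size zs).+1 / t ^+ K.
  move=> wszs ws1 bu nK; rewrite ler_pdivlMr// mulr_suml ler_pdivlMr// mulrC -wszs.
  apply: le_trans (abel_ediffs_summable N t01 ws1 (sqb _ bu)).
  rewrite ler_wpM2l; first by [].
    by rewrite exprn_ge0// subr_ge0 ltW.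
  apply: ler_sum => m _; rewrite mulrAC ler_wpM2r ?cmod_ge0//.
  by rewrite -ler_pdivlMr// weight'.
pose B := (V + 1) / (1 - t) ^+ (size zs).+1 / t ^+ K.
exists (B + B) => N; rewrite /wl1 big_split /=; apply: lerD; last first.
  rewrite (eq_bigr (fun m : 'I_N => r ^+ absz (a - 1 - (m : nat)%:Z)%R * cmod (c (a - 1 - (m : nat)%:Z)))).
    apply: (pos (fun k : nat => c (a - 1 - k%:Z)) zs (fun m : nat => a - 1 - m%:Z)) => //.
      move=> M; apply: le_trans (cV M); rewrite /wsum.
      rewrite [X in _ + sqsum X _](_ : _ = fun m : nat => \prod_(z <- zs) (- z^*) *
        ediffs zs (fun k : nat => c (a - 1 - k%:Z)) m).
        by rewrite sqsumZ P1 expr1n mul1r lerDr sqsum_ge0.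
      by apply/funext => m; rewrite zdiffs_neg.
    by move=> m; rewrite /K; lia.
  by move=> m _; rewrite /abelz cmodM cmod_real ger0_norm// exprn_ge0.
(* The right half starts inside the gap. Lengthening the sum by the gap and dropping its zero terms
   makes it start at a + size zs. *)
apply: (@le_trans _ _ (\sum_(m < size zs + N) cmod (abelz r c (a + (m : nat)%:Z)))).
  by rewrite addnC big_split_ord /= lerDl; apply: sumr_ge0 => m _; exact: cmod_ge0.
rewrite big_split_ord /= [X in X + _](_ : _ = 0) ?add0r; last first.
  apply: big1 => m _; rewrite /abelz c0 ?mulr0 ?cmod0// mem_consecutive.
  by have := ltn_ord m; lia.
rewrite (eq_bigr (fun m : 'I_N => r ^+ absz (a + (size zs)%:Z + (m : nat)%:Z)%R * cmod (c (a + (size zs)%:Z + (m : nat)%:Z)))).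
  apply: (pos (fun k : nat => c (a + (size zs)%:Z + k%:Z)) (map conjc zs) (fun m : nat => a + (size zs)%:Z + m%:Z)) => //.
  - by rewrite size_map.
  - move=> M; apply: le_trans (cV M); rewrite /wsum.
    rewrite [X in sqsum X _ + _](_ : _ = ediffs (map conjc zs)
       (fun k : nat => c (a + (size zs)%:Z + k%:Z))).
      by rewrite lerDl sqsum_ge0.
    by apply/funext => m; rewrite zdiffs_pos size_map.
  - by move=> m; rewrite /K; lia.
move=> m _; rewrite /abelz cmodM cmod_real ger0_norm ?exprn_ge0//.
by rewrite PoszD addrA.
Qed.

End TwoSided.

(** * Hermite interpolation by exponentials *)

Section EulerOperator.
Context {F : numFieldType}.
Implicit Types (p s : {poly F}) (z nu : F).

(* [X d/dX + nu]: on [X^(i + nu)] this is the Euler operator, with the factor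
   [X^nu] removed so that negative exponents are allowed. *)
Definition euler nu p : {poly F} := 'X * p^`() + nu *: p.

Lemma coef_iter_euler nu m p i :
  (iter m (euler nu) p)`_i = (nu + i%:R) ^+ m * p`_i.
Proof.
elim: m p i => [|m IH] p i; first by rewrite expr0 mul1r.
rewrite iterSr IH /euler coefD coefZ coefXM coef_deriv exprSr -mulrA.
congr (_ * _); case: i => [|i] /=; first by rewrite add0r mulr0n addr0.
by rewrite -[X in X + _]mulr_natl; ring.
Qed.

Lemma euler_XsubC_exp nu z k s : euler nu (('X - z%:P) ^+ k.+1 * s) =
  ('X - z%:P) ^+ k * (k.+1%:R *: ('X * s) + ('X - z%:P) * euler nu s).
Proof.
rewrite /euler derivM deriv_exp derivXsubC mul1r /= exprS -mulr_natl.
by rewrite -!mul_polyC polyC_natr; ring.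
Qed.

(** Each application lowers the order of the zero at z by one. Of the two resulting terms only the
    one where the power is differentiated survives at z, and it contributes the order times z. *)
Lemma iter_euler_XsubC_exp nu z k s :
  (iter k (euler nu) (('X - z%:P) ^+ k * s)).[z] = k`!%:R * z ^+ k * s.[z].
Proof.
elim: k s => [|k IH] s; first by rewrite /= expr0 fact0 !mul1r.
rewrite iterSr euler_XsubC_exp IH !hornerE subrr mul0r addr0 factS natrM exprS.
by rewrite /=; ring.
Qed.

(** Induction on the order: when l factors have been split off, the l-th condition says that the
    cofactor vanishes at z, since l! z^l is nonzero. *)
Lemma euler_dvd_exp nu z l p : z != 0 ->
  (forall m, (m < l)%N -> (iter m (euler nu) p).[z] = 0) ->
  ('X - z%:P) ^+ l %| p.
Proof.
move=> z0; elim: l => [|l IH] pz; first by rewrite expr0 dvd1p.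
have /dvdpP[s ps] := IH (fun m ml => pz m (ltnW ml)).
have h := pz l (ltnSn l); move: h; rewrite {1}ps mulrC iter_euler_XsubC_exp => /eqP.
rewrite !mulf_eq0 pnatr_eq0 -leqn0 leqNgt fact_gt0 /= expf_eq0 (negbTE z0) andbF /=.
rewrite -/(root s z) -dvdp_XsubCl => /dvdpP[t st].
by rewrite ps st -mulrA -exprS dvdp_mull.
Qed.

Lemma prod_XsubC_exp_dvd (n : nat) (z : 'I_n -> F) (l : 'I_n -> nat) p :
  injective z -> (forall j, ('X - (z j)%:P) ^+ l j %| p) ->
  \prod_(j < n) ('X - (z j)%:P) ^+ l j %| p.
Proof.
move=> zi zp; have := enum_uniq 'I_n; rewrite -big_enum /=.
elim: (enum 'I_n) => [_|j s IH /= /andP[js us]]; first by rewrite big_nil dvd1p.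
rewrite big_cons Gauss_dvdp ?zp ?IH//.
have : coprimep ('X - (z j)%:P) (\prod_(i <- s) ('X - (z i)%:P) ^+ l i).
  elim: s js {IH us} => [|i s IH]; first by rewrite big_nil coprimep1.
  rewrite inE negb_or => /andP[ji js]; rewrite big_cons coprimepMr IH// andbT.
  apply: coprimep_expr; rewrite coprimep_XsubC root_XsubC.
  by rewrite (inj_eq zi) eq_sym.
exact: coprimep_expl.
Qed.

(** The sums are the iterated Euler operator of q = sum_i p_i X^i evaluated at the nodes. Hence q is
    divisible by a polynomial of degree L while having degree less than L, and so q = 0. *)
Lemma interpolation_unique (n : nat) (z : 'I_n -> F) (l : 'I_n -> nat) nu
    (p : nat -> F) : injective z -> (forall j, z j != 0) ->
  (forall j m, (m < l j)%N ->
     \sum_(i < \sum_(j < n) l j) (nu + i%:R) ^+ m * p i * z j ^+ i = 0) ->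
  forall i, (i < \sum_(j < n) l j)%N -> p i = 0.
Proof.
move=> zi z0 hp i iL; set L := (\sum_(j < n) l j)%N in hp iL *.
pose q := \poly_(i < L) p i.
have : \prod_(j < n) ('X - (z j)%:P) ^+ l j %| q.
  apply: prod_XsubC_exp_dvd => // j; apply: (@euler_dvd_exp nu) => // m ml.
  rewrite (@horner_coef_wide _ L); last first.
    apply/leq_sizeP => k Lk; rewrite coef_iter_euler coef_poly ltnNge Lk mulr0//.
  rewrite -[RHS](hp j m ml); apply: eq_bigr => k _.
  by rewrite coef_iter_euler coef_poly ltn_ord.
have szP : size (\prod_(j < n) ('X - (z j)%:P) ^+ l j) = L.+1.
  rewrite size_prod => [|j _]; last by rewrite expf_neq0// polyXsubC_eq0.
  under eq_bigr do rewrite size_exp_XsubC.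
  rewrite (eq_bigr (fun j => (l j + 1)%N)); last by move=> j _; rewrite addn1.
  by rewrite big_split /= sum1_card subSn ?leq_addl// addnK.
have q0 : q = 0 -> p i = 0.
  by move=> /(congr1 (fun r : {poly F} => r`_i)); rewrite coef_poly iL coef0.
move=> dv; apply: q0; apply/eqP; apply: contraTT dv => q0.
by apply: contraL (size_poly L p) => /(dvdp_leq q0); rewrite szP -ltnNge.
Qed.

End EulerOperator.

Section Annihilation.
Context {R : realType}.
Implicit Types (ws : seq R[i]) (p : {poly R[i]}).

(** p(X + 1) and p have the same leading coefficient. *)
Lemma size_comp_XaddC1_sub p : (size (p \Po ('X + 1) - p)%R <= (size p).-1)%N.
Proof.
have [->|p0] := eqVneq p 0; first by rewrite comp_poly0 subr0 size_poly0.
have sX : size ('X + 1 : {poly R[i]}) = 2%N by rewrite -[1]/(1%:P) size_XaddC.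
have s1 : size (p \Po ('X + 1)) = size p by rewrite size_comp_poly2.
apply/leq_sizeP => j; rewrite leq_eqVlt => /predU1P[<-|].
  rewrite coefB -[X in _ - X]/(lead_coef p) -{1}s1 -[X in X - _]/(lead_coef _).
  rewrite lead_coef_comp ?sX// -[1]/(1%:P) lead_coefXaddC expr1n mulr1.
  by rewrite subrr.
rewrite prednK ?size_poly_gt0// => pj.
by rewrite coefB !nth_default ?subrr// s1.
Qed.

(** On p(n) z^n the difference with w = z replaces p by a multiple of p(X + 1) - p, of lower degree;
    any other w does not raise the degree. Enough factors equal to z therefore reduce p to 0. *)
Lemma zdiffs_annihilate (z : R[i]) ws p : z != 0 ->
  (size p <= count_mem z ws)%N ->
  zdiffs ws (fun n : int => p.[n%:~R] * z ^ n) = fun=> 0.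
Proof.
move=> z0; elim: ws p => [|w ws IH] p /=.
  rewrite leqn0 size_poly_eq0 => /eqP ->; apply/funext => n.
  by rewrite horner0 mul0r.
move=> sp; pose q := z *: (p \Po ('X + 1)) - w *: p.
have -> : zdiff w (fun n : int => p.[n%:~R] * z ^ n) = fun n => q.[n%:~R] * z ^ n.
  apply/funext => n; rewrite /zdiff /q !hornerE horner_comp !hornerE.
  by rewrite expfzDr// expr1z rmorphD /= rmorph1; ring.
apply: IH; rewrite /q; move: sp; case: (eqVneq w z) => [->|wz] /= sp.
  rewrite -scalerBr; apply: (leq_trans (size_scale_leq _ _)).
  apply: (leq_trans (size_comp_XaddC1_sub _)); move: sp; rewrite ?eqxx add1n.
  by case: (size p).
rewrite (leq_trans (size_polyD _ _))// geq_max size_polyN.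
rewrite !(leq_trans (size_scale_leq _ _))//.
by rewrite size_comp_poly2// -[1]/(1%:P) size_XaddC.
Qed.

Lemma zdiffs_sum (I : Type) (s : seq I) ws (a : I -> R[i]) (c : I -> int -> R[i]) :
  zdiffs ws (fun n => \sum_(i <- s) a i * c i n) =
  fun n => \sum_(i <- s) a i * zdiffs ws (c i) n.
Proof.
elim: ws c => //= w ws IH c; rewrite -IH; congr zdiffs; apply/funext => n.
rewrite /zdiff mulr_sumr -sumrB; apply: eq_bigr => i _; ring.
Qed.

End Annihilation.

(** * Characters, trigonometric polynomials and their derivatives *)

Section Exponentials.
Context {R : realType}.
Implicit Types (t u : R) (n k : int).

Lemma cis0 : cis 0 = 1 :> R[i].
Proof. by rewrite /cis cos0 sin0. Qed.

Lemma cisD t u : cis (t + u) = cis t * cis u.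
Proof. by rewrite /cis cosD sinD; simpc; congr (_ +i* _); rewrite addrC. Qed.

Lemma cisN t : cis (- t) = (cis t)^*.
Proof. by rewrite /cis cosN sinN. Qed.

Lemma cmod_cis t : cmod (cis t) = 1.
Proof. by rewrite /cmod /= cos2Dsin2 sqrtr1. Qed.

Lemma cis_neq0 t : cis t != 0.
Proof.
apply/eqP => /(congr1 (@cmod R)); rewrite cmod_cis cmod0 => /eqP.
by rewrite oner_eq0.
Qed.

Lemma cisV t : cis (- t) = (cis t)^-1.
Proof.
apply: (mulIf (cis_neq0 t)); rewrite mulVf ?cis_neq0//.
by rewrite -cisD addNr cis0.
Qed.

Lemma expchar_exprz n t : expchar n t = cis (2 * pi * t) ^ n.
Proof.
have nat_case (m : nat) : expchar m t = cis (2 * pi * t) ^+ m.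
  rewrite /expchar; elim: m => [|m IH].
    by rewrite expr0 mulr0 mul0r cis0.
  by rewrite exprS -IH -cisD -pmulrn -natr1; congr cis; ring.
case: n => n; first by rewrite nat_case.
rewrite -[RHS]/((cis (2 * pi * t) ^+ n.+1)^-1) -nat_case -cisV /expchar NegzE.
by congr cis; rewrite rmorphN /=; ring.
Qed.

Lemma expcharD n k t : expchar (n + k) t = expchar n t * expchar k t.
Proof. by rewrite !expchar_exprz expfzDr// cis_neq0. Qed.

Lemma expchar0 t : expchar 0 t = 1.
Proof. by rewrite expchar_exprz expr0z. Qed.

Lemma expcharN n t : expchar (- n) t = (expchar n t)^*.
Proof. by rewrite /expchar -cisN rmorphN /=; congr cis; ring. Qed.

Lemma cis_2pi : cis (2 * pi) = 1 :> R[i].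
Proof. by rewrite /cis mulrC -[2]/(1 *+ 2) mulr_natr cos2pi sin2pi. Qed.

Lemma expchar_int n k : expchar n (k%:~R : R) = 1.
Proof.
rewrite /expchar -mulrA -rmorphM /= (_ : 2 * pi * _ = 2 * pi * (n * k)%:~R * 1).
  by rewrite -[LHS]/(expchar _ _) expchar_exprz mulr1 cis_2pi exp1rz.
by rewrite mulr1.
Qed.

Lemma expchar_translate n t u : expchar n (t + u) = expchar n t * expchar n u.
Proof. by rewrite /expchar mulrDr cisD. Qed.

Lemma expchar_periodic n t k : expchar n (t + k%:~R) = expchar n t.
Proof. by rewrite expchar_translate expchar_int mulr1. Qed.

Lemma cis_2pi_eq1 t : cis (2 * pi * t) = 1 -> t \is a Num.int.
Proof.
move=> t1; set k := Num.floor t; pose f := t - k%:~R.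
have f01 : 0 <= f < 1.
  by rewrite /f subr_ge0 floor_le_tmp /= ltrBlDl -intrD1 floorD1_gt.
have : expchar 1 f = 1.
  rewrite -(expchar_periodic 1 f k) /f subrK /expchar mulr1z mulr1//.
rewrite /expchar mulr1 => -[].
rewrite -mulrA mulrC -[2]/(1 *+ 2) mulr_natr cos_mulr2n cos2sin2 => h _.
have s0 : sin (pi * f) = 0.
  apply/eqP; rewrite -sqrf_eq0; apply/eqP; move: h; rewrite -mulr_natr; lra.
case/andP: f01; rewrite le_eqVlt => /predU1P[f0 _|f0 f1].
  by move/esym/eqP: f0; rewrite subr_eq0 => /eqP ->; rewrite intr_int.
have : 0 < sin (pi * f).
  by apply: sin_gt0_pi; rewrite mulr_gt0 ?pi_gt0//= gtr_pMr ?pi_gt0.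
by rewrite s0 ltxx.
Qed.

Lemma cis_2pi_inj_mod1 t u : cis (2 * pi * t) = cis (2 * pi * u) -> eq_mod1 t u.
Proof.
move=> tu; apply: cis_2pi_eq1; rewrite mulrBr cisD cisV tu.
by rewrite mulfV ?cis_neq0.
Qed.

(** The chord between two points of the unit circle has length 2 |sin pi (t - u)|. Multiplied over
    the nodes this yields 2^L |omega|. *)
Lemma cmod_expchar_sub t u :
  cmod (expchar 1 t - cis (2 * pi * u)) ^+ 2 = 4 * sin (pi * (t - u)) ^+ 2.
Proof.
rewrite /expchar mulr1 cmod_sqr /cis /=.
have e v : 2 * pi * v = (pi * v) *+ 2 by rewrite -[RHS]mulr_natl mulrA.
have -> : 4 * sin (pi * (t - u)) ^+ 2 = 2 - 2 * cos (2 * pi * (t - u)).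
  by rewrite e cos_mulr2n -mulr_natr cos2sin2; ring.
rewrite mulrBr cosB; have := cos2Dsin2 (2 * pi * t); have := cos2Dsin2 (2 * pi * u).
move: (cos (2 * pi * t)) (sin (2 * pi * t)) (cos (2 * pi * u)) (sin (2 * pi * u)).
move=> a b c d h1 h2.
have -> : (a - c) ^+ 2 + (b - d) ^+ 2 = (a ^+ 2 + b ^+ 2) + (c ^+ 2 + d ^+ 2) - 2 * (a * c + b * d) by ring.
by rewrite h1 h2.
Qed.

(** The number 2 pi i n by which differentiation multiplies the character of frequency n. *)
Definition freq n : R[i] := 0 +i* (2 * pi * n%:~R).

Lemma is_derive_trig_poly (s : seq int) (c : int -> R[i]) t :
  is_derive t 1 (fun u => complex.Re (trig_poly s c u))
    (complex.Re (trig_poly s (fun k => freq k * c k) t)) /\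
  is_derive t 1 (fun u => complex.Im (trig_poly s c u))
    (complex.Im (trig_poly s (fun k => freq k * c k) t)).
Proof.
rewrite /trig_poly; elim: s => [|k s [IHr IHi]].
  rewrite big_nil /=; split.
    under [X in is_derive _ _ X _]eq_fun do rewrite big_nil /=.
    exact: is_derive_cst.
  under [X in is_derive _ _ X _]eq_fun do rewrite big_nil /=.
  exact: is_derive_cst.
pose al : R := 2 * pi * k%:~R.
have dc : is_derive t 1 (fun u => cos (al * u)) (- (al * sin (al * t))).
  apply: is_derive_eq; rewrite /GRing.scale /=; ring.
have ds : is_derive t 1 (fun u => sin (al * u)) (al * cos (al * t)).
  apply: is_derive_eq; rewrite /GRing.scale /=; ring.
have E (d : int -> R[i]) u : \sum_(j <- k :: s) d j * expchar j u =
   d k * expchar k u + \sum_(j <- s) d j * expchar j u by rewrite big_cons.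
case ck : (c k) => [p q]; split.
  have -> : (fun u => complex.Re (\sum_(j <- k :: s) c j * expchar j u)) = fun u =>
      (p * cos (al * u) - q * sin (al * u)) +
      complex.Re (\sum_(j <- s) c j * expchar j u).
    by apply/funext => u; rewrite E ck; case: (\sum_(j <- s) _).
  apply: is_derive_eq; rewrite E ck /freq; case: (\sum_(j <- s) _) => y z /=.
  by rewrite /GRing.scale /= /expchar /cis /= -/al; ring.
have -> : (fun u => complex.Im (\sum_(j <- k :: s) c j * expchar j u)) = fun u =>
      (p * sin (al * u) + q * cos (al * u)) +
      complex.Im (\sum_(j <- s) c j * expchar j u).
  by apply/funext => u; rewrite E ck; case: (\sum_(j <- s) _).
apply: is_derive_eq; rewrite E ck /freq; case: (\sum_(j <- s) _) => y z /=.
by rewrite /GRing.scale /= /expchar /cis /= -/al; ring.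
Qed.

Lemma cderive1n_trig_poly m (s : seq int) (c : int -> R[i]) t :
  cderive1n m (trig_poly s c) t = trig_poly s (fun k => freq k ^+ m * c k) t.
Proof.
elim: m c => [|m IH] c.
  rewrite /cderive1n /= /trig_poly.
  under [in RHS]eq_bigr do rewrite expr0 mul1r.
  by case: (\sum_(k <- s) _).
transitivity (cderive1n m (trig_poly s (fun k => freq k * c k)) t).
  rewrite /cderive1n !derive1Sn; congr (_ +i* _); congr (derive1n _ _ _).
    apply/funext => u; rewrite derive1E.
    by have [h _] := is_derive_trig_poly s c u; rewrite derive_val.
  apply/funext => u; rewrite derive1E.
  by have [_ h] := is_derive_trig_poly s c u; rewrite derive_val.
rewrite IH /trig_poly; apply: eq_bigr => k _; rewrite exprSr; ring.
Qed.

End Exponentials.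

(** * The interpolation coefficients as sequences in n *)

Section Interpolation.
Context {R : realType}.
Variables (s : nat) (x : 'I_s -> R) (lam : 'I_s -> nat).

(** The points z_j repeated with multiplicity, so that products over the zeros and the operator D
    are folds over one list. *)
Definition nodes : seq R[i] :=
  flatten [seq nseq (lam j) (cis (2 * pi * x j)) | j <- enum 'I_s].

Lemma size_nodes : size nodes = (\sum_(j < s) lam j)%N.
Proof.
rewrite size_flatten /shape -map_comp sumnE big_map big_enum /=.
by apply: eq_bigr => j _; rewrite size_nseq.
Qed.

Lemma mem_nodes z : z \in nodes -> exists j, z = cis (2 * pi * x j).
Proof.
move=> /flattenP[w /mapP[j _ ->]]; rewrite mem_nseq => /andP[_ /eqP ->].
by exists j.
Qed.

Lemma cmod_nodes z : z \in nodes -> cmod z = 1.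
Proof. by move=> /mem_nodes[j ->]; exact: cmod_cis. Qed.

Lemma prod_nodes (T : comNzRingType) (F : R[i] -> T) :
  \prod_(z <- nodes) F z = \prod_(j < s) F (cis (2 * pi * x j)) ^+ lam j.
Proof.
rewrite big_flatten big_map big_enum /=; apply: eq_bigr => j _.
by rewrite big_nseq iter_mulr_1.
Qed.

Lemma count_nodes j : (lam j <= count_mem (cis (2 * pi * x j)) nodes)%N.
Proof.
rewrite count_flatten -map_comp sumnE big_map big_enum /= (bigD1 j)//=.
by rewrite count_nseq /= eqxx mul1n leq_addr.
Qed.

Lemma prod_cmod_nodes t : \prod_(z <- nodes) cmod (expchar 1 t - z) ^+ 2 =
  4 ^+ (\sum_(j < s) lam j) * `|omega x lam t| ^+ 2.
Proof.
rewrite prod_nodes real_normK ?num_real// /omega -prodrXl expr_sum -big_split /=.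
apply: eq_bigr => j _; rewrite cmod_expchar_sub exprMn; congr (_ * _).
by rewrite -!exprM mulnC.
Qed.

Hypothesis x_distinct : forall i j : 'I_s, eq_mod1 (x i) (x j) -> i = j.
Variables (a : int) (Omega : seq int).
Hypothesis Omega_def : Omega = consecutive a (\sum_(j < s) lam j)%N.
Variable c : int -> int -> R[i].
Hypothesis T_interp : forall n : int, n \notin Omega ->
  interpolates x lam (trig_poly Omega (c n)) (expchar n).

(* Coefficients of [T_n], with the convention [T_n = e_n] for [n] in [Omega]. *)
Definition interp_coef (n k : int) : R[i] :=
  if n \in Omega then (n == k)%:R else c n k.

(** Outside [Omega] this is the condition on the m-th derivative divided by (2 pi i)^m; inside it
    holds by the convention. Being valid for every n, it may be acted upon by difference operators
    in n. *)
Lemma interp_coefP n j m : (m < lam j)%N ->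
  \sum_(k <- Omega) interp_coef n k * (k%:~R ^+ m * cis (2 * pi * x j) ^ k) =
  n%:~R ^+ m * cis (2 * pi * x j) ^ n.
Proof.
move=> mj; rewrite /interp_coef; case: (boolP (n \in Omega)) => nO.
  have uO : uniq Omega.
    have inj : injective (fun i : nat => a + i%:Z) by move=> i i' /addrI [].
    by rewrite Omega_def /consecutive (map_inj_uniq inj) iota_uniq.
  rewrite (bigD1_seq n)//= eqxx mul1r big1 ?addr0// => k kn.
  by rewrite eq_sym (negbTE kn) mul0r.
have := T_interp nO mj; rewrite cderive1n_trig_poly.
have -> : expchar n = trig_poly [:: n] (fun=> 1) :> (R -> _).
  by apply/funext => t; rewrite /trig_poly big_seq1 mul1r.
rewrite cderive1n_trig_poly /trig_poly big_seq1 mulr1.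
pose w : R[i] := 0 +i* (2 * pi).
have w0 : w != 0.
  apply/eqP => -[] /eqP; rewrite mulf_eq0 pnatr_eq0 /= gt_eqF//; exact: pi_gt0.
have freqE k : freq k = w * k%:~R.
  rewrite /freq /w -(rmorph_int (real_complex R)); apply/eqP.
  by rewrite eq_complex /=; apply/andP; split; apply/eqP; ring.
move=> h; apply: (mulfI (expf_neq0 m w0)).
rewrite mulrA -exprMn -freqE -expchar_exprz -h mulr_sumr; apply: eq_bigr => k _.
by rewrite freqE exprMn expchar_exprz; ring.
Qed.

(** By [interp_coefP], n^m z_j^n is a combination over k of the sequences n |-> coef(n, k) with
    factors k^m z_j^k. The differences kill n^m z_j^n for m < lam_j, so their values on these
    sequences solve the homogeneous interpolation problem, whose only solution is 0. *)
Lemma zdiffs_interp_coef k n : k \in Omega ->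
  zdiffs nodes (interp_coef ^~ k) n = 0.
Proof.
move=> kO; pose p (i : nat) := zdiffs nodes (interp_coef ^~ (a + i%:Z)) n.
suff p0 i : (i < \sum_(j < s) lam j)%N -> p i = 0.
  move: kO; rewrite Omega_def mem_consecutive => kO.
  have -> : k = a + (`|k - a|%N)%:Z by lia.
  by apply: p0; lia.
apply: (@interpolation_unique _ s (fun j => cis (2 * pi * x j)) lam a%:~R).
- by move=> i1 i2 /cis_2pi_inj_mod1/x_distinct.
- by move=> j; exact: cis_neq0.
move=> j m mj; set z := cis _.
have z0 : z != 0 by exact: cis_neq0.
(* Multiplying by z^a turns the index i back into the frequency a + i of [Omega]. *)
apply: (mulfI (expfz_neq0 a z0)); rewrite mulr0.
have := zdiffs_annihilate (z := z) (ws := nodes) (p := 'X^m) z0.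
rewrite size_polyXn => /(_ (leq_trans mj (count_nodes j))).
have -> : (fun n0 : int => ('X^m).[n0%:~R] * z ^ n0) = fun n0 : int =>
    \sum_(k <- Omega) (k%:~R ^+ m * z ^ k) * interp_coef n0 k.
  apply/funext => n0; rewrite hornerXn -(interp_coefP n0 mj).
  by apply: eq_bigr => k' _; rewrite mulrC.
rewrite zdiffs_sum => /(congr1 (@^~ n)) /= h; rewrite -[RHS]h.
rewrite [in RHS]Omega_def /consecutive big_map.
have -> L : iota 0 L = index_iota 0 L by rewrite /index_iota subn0.
rewrite big_mkord mulr_sumr; apply: eq_bigr => i0 _.
by rewrite /p expfzDr// rmorphD /= -exprnP -pmulrn; ring.
Qed.

Lemma zdiffs_conj (ws : seq R[i]) (d : int -> R[i]) n :
  zdiffs (map conjc ws) (fun n => (d n)^*) n = (zdiffs ws d n)^*.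
Proof.
elim: ws d => //= w ws IH d; rewrite -IH; congr (zdiffs _ _ _).
by apply/funext => k; rewrite /zdiff rmorphB rmorphM.
Qed.

End Interpolation.

(** * Changes of variable on the line *)

Section Affine.
Context {R : realType}.
Local Notation mu := (@lebesgue_measure R).

Definition affine (al be : R) (t : R) : R := al * t + be.

Lemma measurable_affine al be : measurable_fun setT (affine al be).
Proof.
by apply: measurable_funD => //; exact: measurable_funM.
Qed.

(** The right-hand side is a measure in A, so half-open intervals suffice; for negative [al] their
    preimages are closed at the other end. *)
Lemma lebesgue_measure_affine al be (A : set R) : al != 0 -> measurable A ->
  (mu A = `|al|%:E * mu (affine al be @^-1` A))%E.
Proof.
move=> al0 mA.
pose aff : measurableTypeR R -> measurableTypeR R := affine al be.
pose m0 : {measure set (measurableTypeR R) -> \bar R} :=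
  mscale (NngNum (normr_ge0 al)) (pushforward mu aff).
pose m := m0 (measurable_affine al be).
rewrite -[RHS]/(m A); apply: lebesgue_measure_unique => // X [[p q] _ <-] /=.
rewrite /m /m0 /mscale /= /pushforward.
have [al_gt0|al_lt0|] := ltgtP al 0; last by move/eqP: al0.
- have -> : aff @^-1` `]p, q] = `[(q - be) / al, (p - be) / al[%classic.
    apply/seteqP; split => t /=; rewrite !in_itv /= /aff /affine.
      by rewrite ler_ndivrMr// ltr_ndivlMr// => /andP[h1 h2]; apply/andP; split; lra.
    by rewrite ler_ndivrMr// ltr_ndivlMr// => /andP[h1 h2]; apply/andP; split; lra.
  rewrite !lebesgue_measure_itv /= !lte_fin ltr_nM2r ?invr_lt0// ltrD2r.
  case: ifPn => _; last by rewrite mule0.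
  rewrite -!EFinB -EFinM ltr0_norm//; congr EFin; field.
  by rewrite lt_eqF.
- have -> : aff @^-1` `]p, q] = `](p - be) / al, (q - be) / al]%classic.
    apply/seteqP; split => t /=; rewrite !in_itv /= /aff /affine.
      by rewrite ler_pdivlMr// ltr_pdivrMr// => /andP[h1 h2]; apply/andP; split; lra.
    by rewrite ler_pdivlMr// ltr_pdivrMr// => /andP[h1 h2]; apply/andP; split; lra.
  rewrite !lebesgue_measure_itv /= !lte_fin ltr_pM2r ?invr_gt0// ltrD2r.
  case: ifPn => _; last by rewrite mule0.
  rewrite -!EFinB -EFinM gtr0_norm//; congr EFin; field.
  by rewrite gt_eqF.
Qed.

Lemma ge0_integral_affine al be (f : R -> \bar R) : al != 0 ->
  measurable_fun setT f -> (forall t, 0 <= f t)%E ->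
  (\int[mu]_t f t = `|al|%:E * \int[mu]_t f (affine al be t))%E.
Proof.
move=> al0 mf f0.
pose aff : measurableTypeR R -> measurableTypeR R := affine al be.
pose m0 : {measure set (measurableTypeR R) -> \bar R} :=
  mscale (NngNum (normr_ge0 al)) (pushforward mu aff).
pose m := m0 (measurable_affine al be).
rewrite (@eq_measure_integral _ _ _ setT m); last first.
  by move=> A mA _; exact: lebesgue_measure_affine.
rewrite ge0_integral_mscale//= ge0_integral_pushforward//=.
exact: measurable_affine.
Qed.

Lemma integrable_affine al be (f : R -> \bar R) : al != 0 ->
  mu.-integrable setT f -> mu.-integrable setT (f \o affine al be).
Proof.
move=> al0 intf; have mf : measurable_fun setT f by apply: measurable_int intf.
have mfa : measurable_fun setT (f \o affine al be).
  exact: measurableT_comp mf (measurable_affine _ _).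
apply/integrableP; split => //.
have /integrableP[_] := intf.
rewrite (@ge0_integral_affine al be (fun t => `|f t|%E))//; last exact: measurableT_comp.
case: (\int[mu]_x _)%E => [r _||]//=; first exact: ltry.
by rewrite gt0_muley ?lte_fin ?normr_gt0.
Qed.

Lemma integral_affine al be (f : R -> \bar R) : al != 0 ->
  mu.-integrable setT f ->
  (\int[mu]_t f t = `|al|%:E * \int[mu]_t f (affine al be t))%E.
Proof.
move=> al0 intf; have mf : measurable_fun setT f by apply: measurable_int intf.
have intfa := integrable_affine be al0 intf.
rewrite integralE [in RHS]integralE muleBr//; last first.
  by rewrite fin_num_adde_defl// fin_numN; exact: (integrable_neg_fin_num _ intfa).
rewrite (ge0_integral_affine be al0)//; last exact: measurable_funepos.
rewrite [in LHS](@ge0_integral_affine al be (f^\-)%E)//; last exact: measurable_funeneg.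
congr (_ - _)%E; congr (_ * _)%E; apply: eq_integral => t _.
 by rewrite !funeposE.
 by rewrite !funenegE.
Qed.

End Affine.

Section Translation.
Context {R : realType}.
Local Notation mu := (@lebesgue_measure R).

Lemma ge0_integral_translate (u : R) (f : R -> \bar R) :
  measurable_fun setT f -> (forall t, 0 <= f t)%E ->
  (\int[mu]_t f (t + u)%R = \int[mu]_t f t)%E.
Proof.
move=> mf f0; rewrite (@ge0_integral_affine R 1 u f) ?oner_eq0// normr1 mul1e.
by apply: eq_integral => t _; rewrite /affine mul1r.
Qed.

Lemma integral_translate (u : R) (f : R -> \bar R) : mu.-integrable setT f ->
  (\int[mu]_t f (t + u)%R = \int[mu]_t f t)%E.
Proof.
move=> intf; rewrite [RHS](@integral_affine R 1 u f) ?oner_eq0// normr1 mul1e.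
by apply: eq_integral => t _; rewrite /affine mul1r.
Qed.

Lemma Rintegral_translate (u : R) (f : R -> R) : mu.-integrable setT (EFin \o f) ->
  \int[mu]_t f (t + u) = \int[mu]_t f t.
Proof. by move=> /(integral_translate u) h; rewrite /Rintegral -h. Qed.

Lemma measurable_translate (u : R) : measurable_fun setT (fun t : R => t + u).
Proof. exact: measurable_funD. Qed.

Lemma ae_translate (u : R) (P : R -> Prop) :
  {ae mu, forall t, P t} -> {ae mu, forall t, P (t + u)}.
Proof.
move=> [N [mN N0 PN]]; exists ((fun t => t + u) @^-1` N); split.
- by rewrite -[X in measurable X]setTI; exact: measurable_translate.
- have := @lebesgue_measure_affine R 1 u N (oner_neq0 R) mN.
  rewrite N0 normr1 mul1e => h; rewrite [RHS]h; congr (mu _).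
  by apply/seteqP; split => t /=; rewrite /affine mul1r.
- by move=> t /= nP; exact: PN.
Qed.

(** An enumeration of the integers, nonnegative ones at even positions, through which sums over
    [int] become series. *)
Definition int_of_natb (n : nat) : int := if odd n then Negz n./2 else n./2%:Z.

Lemma int_of_natb_bij : set_bij [set: nat] [set: int] int_of_natb.
Proof.
split => [//| |].
- move=> m n _ _; rewrite /int_of_natb => h.
  rewrite -(odd_double_half m) -(odd_double_half n).
  by move: h; case: (odd m); case: (odd n) => // -[->].
- move=> [n|n] _.
    by exists n.*2 => //; rewrite /int_of_natb odd_double doubleK.
  by exists n.*2.+1 => //; rewrite /int_of_natb /= odd_double /= uphalf_double.
Qed.

Lemma floor_unique (t : R) (k l : int) :
  k%:~R <= t < k%:~R + 1 -> l%:~R <= t < l%:~R + 1 -> k = l.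
Proof.
move=> /andP[kt tk] /andP[lt tl].
have h1 : k%:~R < (l + 1)%:~R :> R by rewrite rmorphD /= rmorph1; lra.
have h2 : l%:~R < (k + 1)%:~R :> R by rewrite rmorphD /= rmorph1; lra.
by move: h1 h2; rewrite !ltr_int; lia.
Qed.

Lemma ge0_integral_periodize (f : R -> \bar R) :
  measurable_fun setT f -> (forall t, 0 <= f t)%E ->
  (\int[mu]_t f t = \int[mu]_(t in `[0%R, 1%R[) \esum_(k in [set: int]) f (t + k%:~R)%R)%E.
Proof.
move=> mf f0.
pose F n : set R := `[(int_of_natb n)%:~R, (int_of_natb n)%:~R + 1[%classic.
have FT : [set: R] = \bigcup_n F n.
  apply/seteqP; split => // t _; have [_ _ /(_ (Num.floor t) I)[n _ nt]] := int_of_natb_bij.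
  exists n => //; rewrite /F /= in_itv /= nt floor_le_tmp /=.
  by rewrite -intrD1 floorD1_gt.
have mF n : measurable (F n) by exact: measurable_itv.
have mft (u : R) : measurable_fun setT (fun t : R => f (t + u)).
  exact: measurableT_comp mf (measurable_translate u).
rewrite {1}FT ge0_integral_bigcup//; last 2 first.
- by rewrite -FT.
- apply/trivIsetP => m n _ _ mn; rewrite -subset0 => t [] /=; rewrite /F /= !in_itv /=.
  move=> h1 h2; have := floor_unique h1 h2.
  have [_ inj _] := int_of_natb_bij.
  by move=> /(inj m n (mem_set I) (mem_set I)) /eqP; rewrite (negbTE mn).
transitivity (\sum_(0 <= n <oo) \int[mu]_(t in `[0%R, 1%R[) f (t + (int_of_natb n)%:~R)%R)%E.
  apply: eq_eseriesr => n _; set k := (int_of_natb n)%:~R.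
  rewrite integral_mkcond -(@ge0_integral_translate k (f \_ (F n))); last 2 first.
  - apply: (iffLR (measurable_restrictT _ _)) => //; exact: measurable_funTS.
  - by move=> t; rewrite /patch; case: ifP.
  rewrite [RHS]integral_mkcond; apply: eq_integral => t _; rewrite /patch.
  rewrite (_ : (t + k \in F n) = (t \in `[0%R, 1%R[%classic))//.
  apply/idP/idP; rewrite !inE /F /= !in_itv /= -/k => /andP[h1 h2];
    by apply/andP; split; lra.
rewrite -integral_nneseries//; last by move=> n; exact: (measurable_funTS (mft _)).
apply: eq_integral => t _.
rewrite nneseries_esumT// (reindex_esum setT setT int_of_natb)//.
exact: int_of_natb_bij.
Qed.

End Translation.

(** * Plancherel's formula *)

Section AbelKernel.
Context {R : realType}.
Local Notation mu := (@lebesgue_measure R).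
Implicit Types (e b y : R).

Lemma derivable_continuous_at (f : R -> R) y : derivable f y 1 -> {for y, continuous f}.
Proof. by move=> /derivable1_diffP/differentiable_continuous. Qed.

Definition expabs e y := expR (- (e * `|y|)).

Lemma expabs_ge0 e y : 0 <= expabs e y.
Proof. exact: expR_ge0. Qed.

Lemma continuous_expabs e : continuous (expabs e).
Proof.
move=> y; apply: continuous_comp; last exact: continuous_expR.
apply: continuousN; apply: continuousM; first exact: cst_continuous.
exact: norm_continuous.
Qed.

Lemma continuous_cosM b : continuous (fun y => cos (b * y)).
Proof.
move=> y; apply: continuous_comp; last exact: continuous_cos.
by apply: continuousM => //; exact: cst_continuous.
Qed.

Lemma cos_primitive e b : 0 < e -> forall y,
  is_derive y 1 (fun y => - expR (- (e * y)) / e +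
     expR (- (e * y)) * (b * sin (b * y) - e * cos (b * y)) / (e ^+ 2 + b ^+ 2))
   (expR (- (e * y)) * (1 + cos (b * y))).
Proof.
move=> e0 y; apply: is_derive_eq; rewrite /GRing.scale /=.
have e2 : e ^+ 2 + b ^+ 2 != 0 by rewrite gt_eqF// ltr_wpDr ?sqr_ge0// exprn_gt0.
by field; rewrite e2 gt_eqF.
Qed.

Lemma cvg_expR_scale e : 0 < e -> expR (- (e * y)) @[y --> +oo] --> (0 : R).
Proof.
move=> e0; apply: (@cvg_comp _ _ _ (fun y => e * y) (fun z => expR (- z)) _ +oo).
  by apply: gt0_cvgMry => //; exact: cvg_id.
exact: cvgr_expR.
Qed.

(** Adding 1 to the cosine makes the integrand nonnegative, so no prior integrability is required.
    The case b = 0 then gives the integral of [expabs], and the cosine integral follows by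
    subtraction. *)
Lemma integral_expabs_cos_ge0 e b : 0 < e ->
  (\int[mu]_y (expabs e y * (1 + cos (b * y)))%:E =
   (2 * (e^-1 + e / (e ^+ 2 + b ^+ 2)))%:E)%E.
Proof.
move=> e0.
have e2 : e ^+ 2 + b ^+ 2 != 0 by rewrite gt_eqF// ltr_wpDr ?sqr_ge0// exprn_gt0.
have ge0 y : 0 <= expabs e y * (1 + cos (b * y)).
  by rewrite mulr_ge0 ?expabs_ge0//; have := cos_geN1 (b * y); lra.
have cf : continuous (fun y => expabs e y * (1 + cos (b * y))).
  move=> y; apply: continuousM; first exact: continuous_expabs.
  by apply: continuousD; [exact: cst_continuous|exact: continuous_cosM].
rewrite ge0_symfun_integralT//; last first.
  by move=> y /=; rewrite /expabs normrN mulrN cosN.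
rewrite (_ : [set y | 0 <= y] = `[0, +oo[%classic); last first.
  by apply/seteqP; split => y /=; rewrite in_itv /= andbT.
pose F y := - expR (- (e * y)) / e +
     expR (- (e * y)) * (b * sin (b * y) - e * cos (b * y)) / (e ^+ 2 + b ^+ 2).
have -> : (\int[mu]_(y in `[0%R, +oo[) (expabs e y * (1 + cos (b * y)))%:E =
   0%:E - (F 0)%:E)%E.
  apply: ge0_continuous_FTC2y => //.
  - by apply: continuous_subspaceT.
  - rewrite /F.
    have Ey := cvg_expR_scale e0.
    have -> : 0 = - 0 / e + 0 :> R by rewrite oppr0 mul0r addr0.
    apply: cvgD; first by apply: cvgMr_tmp; apply: cvgN.
    pose K := (`|b| + e) / (e ^+ 2 + b ^+ 2).
    have hK : expR (- (e * y)) * K @[y --> +oo] --> (0 : R).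
      by rewrite -(mul0r K); apply: cvgMr_tmp.
    apply/cvgr0Pnorm_le => d d0; move/cvgr0Pnorm_le: hK => /(_ d d0) hK.
    near=> y.
    apply: (@le_trans _ _ `|expR (- (e * y)) * K|); last first.
      by near: y.
    rewrite -mulrA !normrM ler_wpM2l//.
    rewrite ler_wpM2r// [X in _ <= X]ger0_norm; last by rewrite addr_ge0// ltW.
    rewrite (le_trans (ler_normB _ _))// lerD// normrM.
      by rewrite ler_piMr// sin_max.
    by rewrite (gtr0_norm e0) ler_piMr ?(ltW e0)// cos_max.
  - apply: cvg_at_right_filter; apply: (@derivable_continuous_at F).
    have h := cos_primitive b e0 0; apply: ex_derive.
  - move=> y; rewrite in_itv /= andbT => y0; rewrite derive1E.
    have h := cos_primitive b e0 y.
    by rewrite derive_val /expabs ger0_norm// ltW.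
rewrite /F !mulr0 oppr0 expR0 sin0 cos0 -EFinB -EFinM; congr EFin.
by field; rewrite e2 gt_eqF.
Unshelve. all: by end_near. Qed.

Lemma integral_expabs e : 0 < e -> (\int[mu]_y (expabs e y)%:E = (2 / e)%:E)%E.
Proof.
move=> e0; have := integral_expabs_cos_ge0 0 e0.
under eq_integral do rewrite mul0r cos0 mulrC EFinM.
have mE : measurable_fun setT (fun y => (expabs e y)%:E).
  by apply/measurable_EFinP; apply: continuous_measurable_fun; exact: continuous_expabs.
rewrite ge0_integralZl//; last first.
  by move=> y _; rewrite lee_fin expabs_ge0.
have h2 : (2^-1%:E * (1 + 1)%:E = 1 :> \bar R)%E.
  by rewrite -EFinM; congr EFin; field.
move=> /(congr1 (fun z => 2^-1%:E * z)%E); rewrite muleA h2 mul1e => ->.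
by rewrite -EFinM; congr EFin; field; rewrite gt_eqF.
Qed.

Lemma integrable_expabs e : 0 < e -> mu.-integrable setT (EFin \o expabs e).
Proof.
move=> e0; apply/integrableP; split.
  apply/measurable_EFinP; apply: continuous_measurable_fun.
  exact: continuous_expabs.
under eq_integral do rewrite /= ger0_norm ?expabs_ge0//.
by rewrite integral_expabs// ltry.
Qed.

Lemma Rintegral_expabs_cos e b : 0 < e ->
  \int[mu]_y (expabs e y * cos (b * y)) = 2 * e / (e ^+ 2 + b ^+ 2).
Proof.
move=> e0; have ie := integrable_expabs e0.
have ic : mu.-integrable setT (EFin \o (fun y => expabs e y * cos (b * y))).
  apply: le_integrable ie => //.
    apply/measurable_EFinP; apply: continuous_measurable_fun => y.
    apply: continuousM; [exact: continuous_expabs|exact: continuous_cosM].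
  move=> y _ /=; rewrite lee_fin normrM ler_piMr//; exact: cos_max.
have h : \int[mu]_y (expabs e y + expabs e y * cos (b * y)) =
    2 * (e^-1 + e / (e ^+ 2 + b ^+ 2)).
  rewrite /Rintegral.
  under eq_integral do rewrite -[X in X + _]mulr1 -mulrDr.
  by rewrite integral_expabs_cos_ge0.
move: h; rewrite RintegralD// [X in X + _]/Rintegral integral_expabs//= => h.
have e2 : e ^+ 2 + b ^+ 2 != 0 by rewrite gt_eqF// ltr_wpDr ?sqr_ge0// exprn_gt0.
apply: (addrI (2 / e)); rewrite h; field.
by rewrite e2 gt_eqF.
Qed.

(** The cosine transform of e^(-|y|): a probability density whose dilates form an approximate
    identity. *)
Definition cauchy (y : R) : R := 2 / (1 + (2 * pi * y) ^+ 2).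

Lemma cauchy_ge0 y : 0 <= cauchy y.
Proof. by rewrite divr_ge0// addr_ge0// sqr_ge0. Qed.

Lemma continuous_cauchy : continuous cauchy.
Proof.
move=> y; apply: cvgMl_tmp.
apply: (@continuous_comp _ _ _ (fun y => 2 * pi * y) (fun x => (oneDsqr x)^-1)); last first.
  exact: continuous_oneDsqrV.
exact: mulrl_continuous.
Qed.

Lemma integral_cauchy : (\int[mu]_y (cauchy y)%:E = 1)%E.
Proof.
have pi2 : 2 * pi != 0 :> R by rewrite mulf_neq0// gt_eqF// pi_gt0.
have moneD : measurable_fun setT (fun x : R => ((oneDsqr x)^-1)%:E).
  by apply/measurable_EFinP; apply: continuous_measurable_fun; exact: continuous_oneDsqrV.
have oneD0 (x : R) : (0 <= ((oneDsqr x)^-1)%:E)%E by rewrite lee_fin invr_ge0.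
have h : (\int[mu]_x ((oneDsqr x)^-1)%:E = pi%:E)%E.
  rewrite ge0_symfun_integralT//.
  - rewrite (_ : [set y | 0 <= y] = `[0, +oo[%classic); last first.
      by apply/seteqP; split => y /=; rewrite in_itv /= andbT.
    by rewrite integral0y_oneDsqr -EFinM; congr EFin; field.
  - exact: continuous_oneDsqrV.
  - by move=> x /=; rewrite /oneDsqr sqrrN.
have := @ge0_integral_affine R (2 * pi) 0 _ pi2 moneD oneD0.
rewrite h => /(congr1 (fun z => pi^-1%:E * z)%E).
rewrite -EFinM mulVf ?gt_eqF ?pi_gt0// => ->.
rewrite muleA -EFinM ger0_norm ?mulr_ge0 ?pi_ge0// mulrCA mulVf ?gt_eqF ?pi_gt0//.
rewrite mulr1 -ge0_integralZl//; last first.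
  apply: measurableT_comp moneD _; exact: measurable_affine.
by apply: eq_integral => y _; rewrite -EFinM /affine addr0.
Qed.

End AbelKernel.

Section BoundedFubini.
Context {R : realType}.
Local Notation mu := (@lebesgue_measure R).

Lemma integrable_mul_bounded (D : set R) (f g : R -> R) (M : R) :
  measurable D -> mu.-integrable D (EFin \o f) -> measurable_fun D g ->
  (forall t, `|g t| <= M) -> mu.-integrable D (EFin \o (fun t => f t * g t)).
Proof.
move=> mD intf mg gM.
have mf : measurable_fun D f by apply/measurable_EFinP; exact: measurable_int intf.
have M0 : 0 <= M := le_trans (normr_ge0 _) (gM 0).
have iM : mu.-integrable D (fun t => M%:E * (f t)%:E)%E.
  exact: integrableZl.
apply: le_integrable iM => //.
  by apply/measurable_EFinP; exact: measurable_funM.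
move=> t _ /=; rewrite lee_fin !normrM mulrC ler_wpM2r// (ger0_norm M0).
exact: gM.
Qed.

Lemma integrableZ_EFin (D : set R) (f : R -> R) (k : R) : measurable D ->
  mu.-integrable D (EFin \o f) -> mu.-integrable D (EFin \o (fun t => k * f t)).
Proof.
move=> mD h; have : mu.-integrable D (fun t => k%:E * (f t)%:E)%E.
  exact: integrableZl.
by apply: eq_integrable.
Qed.

Lemma Rintegral_bound (f g : R -> R) (M : R) :
  mu.-integrable setT (EFin \o f) -> measurable_fun setT g ->
  (forall t, `|g t| <= M) ->
  `|\int[mu]_t (f t * g t)| <= M * \int[mu]_t `|f t|.
Proof.
move=> intf mg gM.
have ifg := integrable_mul_bounded measurableT intf mg gM.
have inf_ : mu.-integrable setT (EFin \o (fun t => `|f t|)).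
  exact: integrable_norm.
apply: (le_trans (le_normr_Rintegral _ ifg)) => //.
rewrite -RintegralZl//; apply: le_Rintegral => //.
- exact: integrable_norm.
- exact: integrableZ_EFin.
- by move=> t _; rewrite normrM mulrC ler_wpM2r.
Qed.

Lemma bounded_Fubini (a b : R -> R) (h : R -> R -> R) (M : R) :
  mu.-integrable setT (EFin \o a) -> mu.-integrable setT (EFin \o b) ->
  measurable_fun setT (fun z : R * R => h z.1 z.2) ->
  (forall s t, `|h s t| <= M) ->
  \int[mu]_s (a s * \int[mu]_t (b t * h s t)) =
  \int[mu]_t (b t * \int[mu]_s (a s * h s t)).
Proof.
move=> ia ib mh hM.
have ma : measurable_fun setT a by apply/measurable_EFinP; exact: measurable_int ia.
have mb : measurable_fun setT b by apply/measurable_EFinP; exact: measurable_int ib.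
have mh1 s : measurable_fun setT (h s).
  exact: (measurableT_comp mh (pair1_measurable s)).
have mh2 t : measurable_fun setT (h ^~ t).
  exact: (measurableT_comp mh (pair2_measurable t)).
pose F (z : R * R) := (a z.1 * b z.2 * h z.1 z.2)%:E.
have mF : measurable_fun setT F.
  apply/measurable_EFinP; apply: measurable_funM => //; apply: measurable_funM.
    exact: measurableT_comp ma measurable_fst.
  exact: measurableT_comp mb measurable_snd.
have M0 : 0 <= M := le_trans (normr_ge0 _) (hM 0 0).
have iF : (mu \x mu)%E.-integrable setT F.
  apply/(integrable12ltyP mu mu mF).
  have iNb : mu.-integrable setT (EFin \o (fun t => `|b t|)) by exact: integrable_norm.
  have iNa : mu.-integrable setT (EFin \o (fun t => `|a t|)) by exact: integrable_norm.
  have /integrableP[_ fb] := ib; have /integrableP[_ fa] := ia.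
  set B := (\int[mu]_t `|(EFin \o b) t|)%E in fb.
  have B0 : (0 <= B)%E by apply: integral_ge0.
  have hB : (\int[mu]_s \int[mu]_t `|F (s, t)| <=
     \int[mu]_s (M%:E * B * `|(EFin \o a) s|))%E.
    apply: ge0_le_integral => //.
    - by move=> s _; apply: integral_ge0.
    - apply: (@measurable_fun_fubini_tonelli_F _ _ _ _ _ mu (fun z => `|F z|%E)) => //.
      exact: measurableT_comp.
    - by apply: emeasurable_funM => //; apply/measurable_EFinP; exact: measurableT_comp.
    - move=> s _; rewrite muleAC /B -ge0_integralZl//; last 2 first.
      + by apply/measurable_EFinP; exact: measurableT_comp.
      + by rewrite mule_ge0.
      apply: ge0_le_integral => //.
      * apply: measurableT_comp => //; apply/measurable_EFinP.
        apply: (measurable_funM (f := fun t => a s * b t) (g := h s)) => //.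
        by apply: (measurable_funM (f := fun=> a s) (g := b)).
      * apply: emeasurable_funM => //; apply: measurableT_comp => //.
        exact/measurable_EFinP.
      * move=> t _ /=; rewrite -!EFinM lee_fin !normrM mulrC mulrA ler_wpM2r//.
        by rewrite ler_wpM2r.
  apply: (le_lt_trans hB); rewrite ge0_integralZl//; last 2 first.
  - by apply/measurable_EFinP; exact: measurableT_comp.
  - by rewrite mule_ge0.
  by rewrite !lte_mul_pinfty// ?mule_ge0// fin_numM// ge0_fin_numE.
have e1 : (\int[mu]_s \int[mu]_t F (s, t) =
    \int[mu]_s (a s * \int[mu]_t (b t * h s t))%:E)%E.
  apply: eq_integral => s _; rewrite EFinM.
  have i1 := integrable_mul_bounded measurableT ib (mh1 s) (hM s).
  rewrite /Rintegral fineK; last exact: integrable_fin_num.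
  rewrite -integralZl//; apply: eq_integral => t _.
  by rewrite /F /= -EFinM mulrA.
have e2 : (\int[mu]_t \int[mu]_s F (s, t) =
    \int[mu]_t (b t * \int[mu]_s (a s * h s t))%:E)%E.
  apply: eq_integral => t _; rewrite EFinM.
  have i1 := integrable_mul_bounded measurableT ia (mh2 t) (fun s => hM s t).
  rewrite /Rintegral fineK; last exact: integrable_fin_num.
  rewrite -integralZl//; apply: eq_integral => s _.
  by rewrite /F /= -EFinM mulrA [b t * _]mulrC.
by rewrite /Rintegral -e1 -e2 (Fubini iF).
Qed.

End BoundedFubini.

(** * Cosine and sine transforms of real functions *)

Section RealPlancherel.
Context {R : realType}.
Local Notation mu := (@lebesgue_measure R).
Implicit Types (f g : R -> R) (y t e : R).

Definition costr f y : R := \int[mu]_t (f t * cos (2 * pi * t * y)).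
Definition sintr f y : R := \int[mu]_t (f t * sin (2 * pi * t * y)).

Lemma measurable_cos : measurable_fun setT (@cos R).
Proof. by apply: continuous_measurable_fun; exact: continuous_cos. Qed.

Lemma measurable_sin : measurable_fun setT (@sin R).
Proof. by apply: continuous_measurable_fun; exact: continuous_sin. Qed.

Lemma measurable_cos2 : measurable_fun setT (fun z : R * R => cos (2 * pi * z.1 * z.2)).
Proof.
apply: (measurableT_comp measurable_cos).
apply: measurable_funM => //; apply: measurable_funM => //.
Qed.

Lemma measurable_sin2 : measurable_fun setT (fun z : R * R => sin (2 * pi * z.1 * z.2)).
Proof.
apply: (measurableT_comp measurable_sin).
apply: measurable_funM => //; apply: measurable_funM => //.
Qed.

Lemma measurable_cos_l y : measurable_fun setT (fun t => cos (2 * pi * t * y)).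
Proof. exact: (measurableT_comp measurable_cos2 (pair2_measurable y)). Qed.

Lemma measurable_sin_l y : measurable_fun setT (fun t => sin (2 * pi * t * y)).
Proof. exact: (measurableT_comp measurable_sin2 (pair2_measurable y)). Qed.

Lemma integrable_cos f y : mu.-integrable setT (EFin \o f) ->
  mu.-integrable setT (EFin \o (fun t => f t * cos (2 * pi * t * y))).
Proof.
move=> intf; apply: (@integrable_mul_bounded _ _ _ _ 1) => //.
  exact: measurable_cos_l.
by move=> t; exact: cos_max.
Qed.

Lemma integrable_sin f y : mu.-integrable setT (EFin \o f) ->
  mu.-integrable setT (EFin \o (fun t => f t * sin (2 * pi * t * y))).
Proof.
move=> intf; apply: (@integrable_mul_bounded _ _ _ _ 1) => //.
  exact: measurable_sin_l.
by move=> t; exact: sin_max.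
Qed.

Lemma costr_bound f y : mu.-integrable setT (EFin \o f) ->
  `|costr f y| <= \int[mu]_t `|f t|.
Proof.
move=> intf; rewrite -[leRHS]mul1r; apply: Rintegral_bound => //.
  exact: measurable_cos_l.
by move=> t; exact: cos_max.
Qed.

Lemma sintr_bound f y : mu.-integrable setT (EFin \o f) ->
  `|sintr f y| <= \int[mu]_t `|f t|.
Proof.
move=> intf; rewrite -[leRHS]mul1r; apply: Rintegral_bound => //.
  exact: measurable_sin_l.
by move=> t; exact: sin_max.
Qed.

Lemma continuous_costr f : mu.-integrable setT (EFin \o f) -> continuous (costr f).
Proof.
move=> intf y.
have h := @continuity_under_integral R _ _ mu (fun y t => f t * cos (2 * pi * t * y))
  setT measurableT (y - 1) (y + 1) _ _ (fun t => `|f t|) _ _ y.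
apply: h.
- by move=> z _; exact: integrable_cos.
- apply: nearW => t _ z _; apply: cvgMl_tmp.
  exact: (@continuous_cosM R (2 * pi * t)).
- exact: integrable_norm.
- move=> z _; apply: nearW => t _; rewrite normrM ler_piMr//; exact: cos_max.
- by rewrite inE /= in_itv /=; apply/andP; split; lra.
Qed.

Lemma continuous_sintr f : mu.-integrable setT (EFin \o f) -> continuous (sintr f).
Proof.
move=> intf y.
have h := @continuity_under_integral R _ _ mu (fun y t => f t * sin (2 * pi * t * y))
  setT measurableT (y - 1) (y + 1) _ _ (fun t => `|f t|) _ _ y.
apply: h.
- by move=> z _; exact: integrable_sin.
- apply: nearW => t _ z _; apply: cvgMl_tmp.
  apply: (@continuous_comp _ _ _ (fun z => 2 * pi * t * z) sin).
    exact: mulrl_continuous.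
  exact: continuous_sin.
- exact: integrable_norm.
- move=> z _; apply: nearW => t _; rewrite normrM ler_piMr//; exact: sin_max.
- by rewrite inE /= in_itv /=; apply/andP; split; lra.
Qed.

Lemma measurable_costr f : mu.-integrable setT (EFin \o f) -> measurable_fun setT (costr f).
Proof. by move=> intf; apply: continuous_measurable_fun; exact: continuous_costr. Qed.

Lemma measurable_sintr f : mu.-integrable setT (EFin \o f) -> measurable_fun setT (sintr f).
Proof. by move=> intf; apply: continuous_measurable_fun; exact: continuous_sintr. Qed.

(** The squared modulus of the Fourier transform of the real function [f]. *)
Definition energy f y : R := costr f y ^+ 2 + sintr f y ^+ 2.

Lemma energy_ge0 f y : 0 <= energy f y.
Proof. by rewrite addr_ge0// sqr_ge0. Qed.

Lemma measurable_energy f : mu.-integrable setT (EFin \o f) ->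
  measurable_fun setT (energy f).
Proof.
move=> intf; apply: measurable_funD; apply: measurable_funX.
  exact: measurable_costr.
exact: measurable_sintr.
Qed.

Lemma energyE f y : mu.-integrable setT (EFin \o f) -> energy f y =
  \int[mu]_t (f t * (cos (2 * pi * t * y) * costr f y + sin (2 * pi * t * y) * sintr f y)).
Proof.
move=> intf.
rewrite /energy !expr2 {1}/costr {1}/sintr.
rewrite -!RintegralZr//; [|exact: integrable_sin|exact: integrable_cos].
rewrite -RintegralD//.
- by apply: eq_Rintegral => t _; ring.
- have := integrableZ_EFin (costr f y) measurableT (integrable_cos y intf).
  by apply: eq_integrable => // t _ /=; rewrite mulrC.
- have := integrableZ_EFin (sintr f y) measurableT (integrable_sin y intf).
  by apply: eq_integrable => // t _ /=; rewrite mulrC.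
Qed.

Lemma cos_sub_tr f s y : mu.-integrable setT (EFin \o f) ->
  cos (2 * pi * s * y) * costr f y + sin (2 * pi * s * y) * sintr f y =
  \int[mu]_t (f t * cos (2 * pi * (t - s) * y)).
Proof.
move=> intf; rewrite -!RintegralZl//; [|exact: integrable_sin|exact: integrable_cos].
rewrite -RintegralD//.
- apply: eq_Rintegral => t _.
  by rewrite mulrBr mulrBl cosB; ring.
- exact: (integrableZ_EFin _ measurableT (integrable_cos y intf)).
- exact: (integrableZ_EFin _ measurableT (integrable_sin y intf)).
Qed.

(** The energy is the double integral of f(s) f(t) cos(2 pi (t - s) y). The damping factor is
    integrable, so Fubini applies twice and the integral in y produces the Poisson kernel at t -
    s. *)
Lemma integral_expabs_energy e f : 0 < e -> mu.-integrable setT (EFin \o f) ->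
  \int[mu]_y (expabs e y * energy f y) =
  \int[mu]_s (f s * \int[mu]_t (f t * (2 * e / (e ^+ 2 + (2 * pi * (t - s)) ^+ 2)))).
Proof.
move=> e0 intf; have iw := integrable_expabs e0.
pose A := \int[mu]_t `|f t|.
have h s y : `|cos (2 * pi * s * y) * costr f y + sin (2 * pi * s * y) * sintr f y| <= A + A.
  rewrite (le_trans (ler_normD _ _))// lerD// normrM.
    have := costr_bound y intf; have := cos_max (2 * pi * s * y).
    rewrite -/A; have := normr_ge0 (costr f y); have := normr_ge0 (cos (2 * pi * s * y)).
    nra.
  have := sintr_bound y intf; have := sin_max (2 * pi * s * y).
  rewrite -/A; have := normr_ge0 (sintr f y); have := normr_ge0 (sin (2 * pi * s * y)).
  nra.
transitivity (\int[mu]_y (expabs e y * \int[mu]_s (f s *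
   (cos (2 * pi * s * y) * costr f y + sin (2 * pi * s * y) * sintr f y)))).
  by apply: eq_Rintegral => y _; rewrite energyE.
rewrite -(bounded_Fubini (M := A + A) (h := fun s y => cos (2 * pi * s * y) * costr f y + sin (2 * pi * s * y) * sintr f y))//; last first.
  apply: measurable_funD; apply: measurable_funM.
  - exact: measurable_cos2.
  - exact: (measurableT_comp (measurable_costr intf) measurable_snd).
  - exact: measurable_sin2.
  - exact: (measurableT_comp (measurable_sintr intf) measurable_snd).
apply: eq_Rintegral => s _; congr (_ * _).
transitivity (\int[mu]_y (expabs e y * \int[mu]_t (f t * cos (2 * pi * (t - s) * y)))).
  by apply: eq_Rintegral => y _; rewrite cos_sub_tr.
rewrite -(bounded_Fubini (M := 1) (h := fun t y => cos (2 * pi * (t - s) * y)))//.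
- by apply: eq_Rintegral => t _; rewrite Rintegral_expabs_cos.
- apply: (measurableT_comp measurable_cos).
  apply: measurable_funM => //; apply: measurable_funM => //.
  exact: measurable_funB.
- by move=> t y; exact: cos_max.
Qed.

End RealPlancherel.

(** * Plancherel for bounded continuous integrable functions *)

Section PlancherelContinuous.
Context {R : realType}.
Local Notation mu := (@lebesgue_measure R).
Implicit Types (f g : R -> R) (y t e : R).

Lemma Rintegral_dominated_cvg (f_ : nat -> R -> R) f g :
  (forall n, measurable_fun setT (f_ n)) ->
  (forall t, f_ ^~ t @ \oo --> f t) ->
  (forall n t, `|f_ n t| <= g t) -> mu.-integrable setT (EFin \o g) ->
  \int[mu]_t f_ n t @[n --> \oo] --> \int[mu]_t f t.
Proof.
move=> mf_ f_f f_g ig.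
have cf t : (f_ n t)%:E @[n --> \oo] --> (f t)%:E by apply: cvg_EFin; [exact: nearW|exact: f_f].
have mef n : measurable_fun setT (EFin \o f_ n) by apply/measurable_EFinP.
have fg n t : (`|(f_ n t)%:E| <= (EFin \o g) t)%E by rewrite lee_fin f_g.
have mf : measurable_fun setT (EFin \o f).
  by apply/measurable_EFinP; apply: (@measurable_fun_cvg _ _ _ _ f_) => // t _; exact: f_f.
have h1 : {ae mu, forall t, [set: R] t -> (f_ n t)%:E @[n --> \oo] --> (f t)%:E}.
  by apply: nearW => t _; exact: cf.
have h2 : {ae mu, forall t n, [set: R] t -> (`|(f_ n t)%:E| <= (EFin \o g) t)%E}.
  by apply: nearW => t n _; exact: fg.
have [intf _ h] := @dominated_convergence _ _ _ mu setT measurableT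
  (fun n => EFin \o f_ n) (EFin \o f) (EFin \o g) mef mf h1 ig h2.
apply: fine_cvg; rewrite fineK; first exact: h.
exact: integrable_fin_num.
Qed.

Lemma integrable_cauchy : mu.-integrable setT (EFin \o (@cauchy R)).
Proof.
apply/integrableP; split.
  by apply/measurable_EFinP; apply: continuous_measurable_fun; exact: continuous_cauchy.
under eq_integral do rewrite /= ger0_norm ?cauchy_ge0//.
by rewrite integral_cauchy ltry.
Qed.

Lemma Rintegral_affine al be f : al != 0 -> mu.-integrable setT (EFin \o f) ->
  \int[mu]_t f t = `|al| * \int[mu]_t f (affine al be t).
Proof.
move=> al0 intf; have := integral_affine be al0 intf; rewrite /Rintegral => ->.
rewrite fineM//; apply: integrable_fin_num => //.
exact: (integrable_affine be al0 intf).
Qed.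

(** The substitution t = e v + s moves the dependence on [e] from the kernel into the argument of f,
    where continuity can be used. *)
Lemma poisson_scale e f s : 0 < e -> mu.-integrable setT (EFin \o f) ->
  \int[mu]_t (f t * (2 * e / (e ^+ 2 + (2 * pi * (t - s)) ^+ 2))) =
  \int[mu]_v (f (e * v + s) * cauchy v).
Proof.
move=> e0 intf.
have den t : 0 < e ^+ 2 + (2 * pi * (t - s)) ^+ 2.
  by rewrite ltr_wpDr ?sqr_ge0// exprn_gt0.
pose K t := 2 * e / (e ^+ 2 + (2 * pi * (t - s)) ^+ 2).
have KE t : K t = e^-1 * cauchy (e^-1 * (t - s)).
  rewrite /K /cauchy; have := den t; move: (pi : R) => p h; field.
  by rewrite !gt_eqF.
have mK : measurable_fun setT K.
  have -> : K = (fun u => e^-1 * cauchy (e^-1 * u)) \o (fun t => t + - s).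
    by apply/funext => t; rewrite /= KE.
  have mc : measurable_fun setT (@cauchy R).
    by apply: continuous_measurable_fun; exact: continuous_cauchy.
  have m1 : measurable_fun setT (fun u => e^-1 * cauchy (e^-1 * u)).
    by apply: measurable_funM => //; apply: (measurableT_comp mc); exact: measurable_funM.
  exact: (measurableT_comp m1 (measurable_translate (- s))).
have bK t : `|K t| <= 2 / e.
  have ei : 0 < e^-1 by rewrite invr_gt0.
  have c2 u : cauchy u <= 2.
    have d0 : 0 < 1 + (2 * pi * u) ^+ 2 by rewrite ltr_wpDr ?sqr_ge0.
    by rewrite /cauchy ler_pdivrMr// ler_peMr// lerDl sqr_ge0.
  rewrite KE ger0_norm; last by rewrite mulr_ge0 ?cauchy_ge0// ltW.
  by rewrite [leLHS]mulrC; apply: ler_wpM2r; [exact: ltW|exact: c2].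
have iK := integrable_mul_bounded measurableT intf mK bK.
rewrite (Rintegral_affine s (lt0r_neq0 e0) iK) (gtr0_norm e0) -RintegralZl//; last first.
  exact: (integrable_affine s (lt0r_neq0 e0) iK).
apply: eq_Rintegral => v _; rewrite /affine KE.
have -> : e^-1 * (e * v + s - s) = v by field; rewrite gt_eqF.
by move: (cauchy v) (f _) => p q; field; rewrite gt_eqF.
Qed.

(** The damping 1 / (n + 1) tends to 0 in [integral_expabs_energy]: monotone convergence on the
    left; on the right dominated convergence, since the averages of f against the shrinking kernel
    stay below M and tend to f pointwise. *)
Lemma energy_continuous f M : continuous f -> (forall t, `|f t| <= M) ->
  mu.-integrable setT (EFin \o f) ->
  (\int[mu]_y (energy f y)%:E = (\int[mu]_t (f t ^+ 2))%:E)%E.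
Proof.
move=> cf fM intf; pose e n : R := n.+1%:R^-1.
have e0 n : 0 < e n by rewrite invr_gt0.
have M0 : 0 <= M := le_trans (normr_ge0 _) (fM 0).
have mf : measurable_fun setT f by exact: continuous_measurable_fun.
have iMc : mu.-integrable setT (EFin \o (fun v => M * cauchy v)).
  exact: (integrableZ_EFin _ measurableT integrable_cauchy).
have mcauchy : measurable_fun setT (@cauchy R).
  by apply: continuous_measurable_fun; exact: continuous_cauchy.
have bnd n s v : `|f (e n * v + s) * cauchy v| <= M * cauchy v.
  by rewrite normrM (ger0_norm (cauchy_ge0 v)) ler_wpM2r ?cauchy_ge0.
have mfe n s : measurable_fun setT (fun v => f (e n * v + s) * cauchy v).
  apply: measurable_funM => //.
  exact: (measurableT_comp mf (measurable_affine (e n) s)).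
pose A n s := \int[mu]_v (f (e n * v + s) * cauchy v).
have AM n s : `|A n s| <= M.
  have ifc : mu.-integrable setT (EFin \o (fun v => f (e n * v + s) * cauchy v)).
    apply: le_integrable iMc => //; first by apply/measurable_EFinP; exact: mfe.
    move=> v _ /=; rewrite lee_fin (le_trans (bnd n s v))//.
    by rewrite ger0_norm// mulr_ge0// cauchy_ge0.
  apply: (le_trans (le_normr_Rintegral _ ifc)) => //.
  apply: (@le_trans _ _ (\int[mu]_v (M * cauchy v))).
    by apply: le_Rintegral => //; exact: integrable_norm.
  rewrite RintegralZl//; last exact: integrable_cauchy.
  by rewrite /Rintegral integral_cauchy /= mulr1.
have cA n : continuous (A n).
  move=> s.
  have h := @continuity_under_integral R _ _ mu (fun s v => f (e n * v + s) * cauchy v)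
    setT measurableT (s - 1) (s + 1) _ _ (fun v => M * cauchy v) iMc _ s.
  apply: h.
  - move=> z _; apply: le_integrable iMc => //; first by apply/measurable_EFinP; exact: mfe.
    move=> v _ /=; rewrite lee_fin (le_trans (bnd n z v))//.
    by rewrite ger0_norm// mulr_ge0// cauchy_ge0.
  - apply: nearW => v _ z _; apply: cvgMr_tmp.
    apply: (@continuous_comp _ _ _ (fun s => e n * v + s) f); last exact: cf.
    by apply: cvgD; [exact: cvg_cst|exact: cvg_id].
  - by move=> z _; apply: nearW => v _; exact: bnd.
  - by rewrite inE /= in_itv /=; apply/andP; split; lra.
have Af s : A n s @[n --> \oo] --> f s.
  have -> : f s = \int[mu]_v (f s * cauchy v).
    rewrite RintegralZl//; last exact: integrable_cauchy.
    by rewrite /Rintegral integral_cauchy /= mulr1.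
  apply: (@Rintegral_dominated_cvg _ _ (fun v => M * cauchy v)) => // v.
  apply: cvgMr_tmp; apply: (@cvg_comp _ _ _ (fun n => e n * v + s) f _ (nbhs s)); last exact: cf.
  have h : e n * v + s @[n --> \oo] --> 0 * v + s.
    by apply: cvgD; [apply: cvgMr_tmp; exact: cvg_harmonic|exact: cvg_cst].
  by rewrite mul0r add0r in h.
have lim1 : \int[mu]_s (f s * A n s) @[n --> \oo] --> \int[mu]_t (f t ^+ 2).
  apply: (@Rintegral_dominated_cvg _ _ (fun s => M * `|f s|)).
  - move=> n; apply: measurable_funM => //; exact: continuous_measurable_fun.
  - by move=> s; rewrite expr2; apply: cvgMl_tmp.
  - by move=> n s; rewrite normrM mulrC ler_wpM2r.
  - by apply: integrableZ_EFin => //; exact: integrable_norm.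
have iwe n : mu.-integrable setT (EFin \o (fun y => expabs (e n) y * energy f y)).
  apply: (@integrable_mul_bounded _ _ _ _ ((\int[mu]_t `|f t|) ^+ 2 + (\int[mu]_t `|f t|) ^+ 2)) => //.
  - exact: integrable_expabs.
  - exact: measurable_energy.
  move=> y; rewrite ger0_norm ?energy_ge0// /energy lerD//.
    have := costr_bound y intf; have := normr_ge0 (costr f y).
    by rewrite -[costr f y ^+ 2]real_normK ?num_real//; nra.
  have := sintr_bound y intf; have := normr_ge0 (sintr f y).
  by rewrite -[sintr f y ^+ 2]real_normK ?num_real//; nra.
have eqn n : (\int[mu]_y (expabs (e n) y * energy f y)%:E = (\int[mu]_s (f s * A n s))%:E)%E.
  rewrite -(fineK (integrable_fin_num measurableT (iwe n))) /=; congr EFin.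
  rewrite -[LHS]/(\int[mu]_y (expabs (e n) y * energy f y)) integral_expabs_energy//.
  by apply: eq_Rintegral => s _; rewrite poisson_scale.
have lim2 : (\int[mu]_y (expabs (e n) y * energy f y)%:E @[n --> \oo] --> \int[mu]_y (energy f y)%:E)%E.
  have h := @cvg_monotone_convergence _ _ _ mu setT measurableT
    (fun n y => (expabs (e n) y * energy f y)%:E).
  rewrite (_ : (\int[mu]_y (energy f y)%:E = \int[mu]_y (limn (fun n => (expabs (e n) y * energy f y)%:E)))%E).
    apply: h.
    - by move=> n; exact: measurable_int (iwe n).
    - by move=> n y _; rewrite lee_fin mulr_ge0 ?expabs_ge0 ?energy_ge0.
    - move=> y _ m n mn; rewrite lee_fin ler_wpM2r ?energy_ge0// /expabs ler_expR.
      by rewrite lerN2 ler_wpM2r// /e lef_pV2 ?posrE// ler_nat.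
  apply: eq_integral => y _; apply/esym/cvg_lim => //; apply: cvg_EFin; first exact: nearW.
  rewrite -[X in _ --> X]mul1r; apply: cvgMr_tmp.
  rewrite -expR0 -[X in expR X](oppr0); apply: (@cvg_comp _ _ _ _ (@expR R) _ (nbhs (- 0)));
    last exact: continuous_expR.
  apply: cvgN; rewrite -(mul0r `|y|); apply: cvgMr_tmp; exact: cvg_harmonic.
have lim3 : (\int[mu]_y (expabs (e n) y * energy f y)%:E @[n --> \oo] -->
    (\int[mu]_t (f t ^+ 2))%:E)%E.
  rewrite (_ : (fun n => _) = fun n => (\int[mu]_s (f s * A n s))%:E); last exact/funext.
  by apply: cvg_EFin; first exact: nearW.
exact: (cvg_unique _ lim2 lim3).
Qed.

End PlancherelContinuous.

(** * Density of bounded continuous functions in L^1 and L^2 at once *)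

Section Density.
Context {R : realType}.
Local Notation mu := (@lebesgue_measure R).
Implicit Types (f g h : R -> R).

Definition l1n f : \bar R := (\int[mu]_t `|f t|%:E)%E.
Definition l2n f : \bar R := (\int[mu]_t (f t ^+ 2)%:E)%E.

Lemma l2n_ge0 f : (0 <= l2n f)%E.
Proof. by apply: integral_ge0 => t _; rewrite lee_fin sqr_ge0. Qed.

Lemma measurable_norm_EFin f : measurable_fun setT f ->
  measurable_fun setT (fun t => `|f t|%:E).
Proof. by move=> mf; apply/measurable_EFinP; exact: measurableT_comp. Qed.

Lemma measurable_sqr_EFin f : measurable_fun setT f ->
  measurable_fun setT (fun t => (f t ^+ 2)%:E).
Proof. by move=> mf; apply/measurable_EFinP; exact: measurable_funX. Qed.

Lemma integrable_l1n f : measurable_fun setT f -> (l1n f < +oo)%E ->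
  mu.-integrable setT (EFin \o f).
Proof. by move=> mf lf; apply/integrableP; split => //; apply/measurable_EFinP. Qed.

Lemma l1n_integrable f : mu.-integrable setT (EFin \o f) ->
  (l1n f < +oo)%E /\ measurable_fun setT f.
Proof. by move=> /integrableP[/measurable_EFinP mf lf]. Qed.

Lemma l1nD f g : measurable_fun setT f -> measurable_fun setT g ->
  (l1n (fun t => f t + g t)%R <= l1n f + l1n g)%E.
Proof.
move=> mf mg; rewrite /l1n -ge0_integralD//; last 2 first.
- exact: measurable_norm_EFin.
- exact: measurable_norm_EFin.
apply: ge0_le_integral => //.
- by apply: measurable_norm_EFin; exact: measurable_funD.
- by apply: emeasurable_funD; exact: measurable_norm_EFin.
- by move=> t _; rewrite -EFinD lee_fin ler_normD.
Qed.

(** From 2 f g <= d f^2 + g^2 / d. Letting d tend to 0 keeps the factor of f close to 1, which the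
    sharp inequality [htn_le] relies on. *)
Lemma l2nD_weighted (d : R) f g : 0 < d -> measurable_fun setT f -> measurable_fun setT g ->
  (l2n (fun t => f t + g t)%R <= (1 + d)%:E * l2n f + (1 + d^-1)%:E * l2n g)%E.
Proof.
move=> d0 mf mg.
have d1 : 0 <= 1 + d by rewrite addr_ge0// ltW.
have d2 : 0 <= 1 + d^-1 by rewrite addr_ge0// invr_ge0 ltW.
have mf2 := measurable_sqr_EFin mf; have mg2 := measurable_sqr_EFin mg.
have pos h t : (0 <= (h t ^+ 2)%:E)%E by rewrite lee_fin sqr_ge0.
rewrite /l2n -!ge0_integralZl// -ge0_integralD//; last 4 first.
- by move=> t _; rewrite mule_ge0.
- exact: measurable_funeM.
- by move=> t _; rewrite mule_ge0.
- exact: measurable_funeM.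
apply: ge0_le_integral => //.
- by apply: measurable_sqr_EFin; exact: measurable_funD.
- by apply: emeasurable_funD; exact: measurable_funeM.
move=> t _; rewrite -!EFinM -EFinD lee_fin -subr_ge0.
have -> : (1 + d) * f t ^+ 2 + (1 + d^-1) * g t ^+ 2 - (f t + g t) ^+ 2 =
   d * (f t - d^-1 * g t) ^+ 2 by field; rewrite gt_eqF.
by rewrite mulr_ge0 ?sqr_ge0// ltW.
Qed.

Lemma l2nD f g : measurable_fun setT f -> measurable_fun setT g ->
  (l2n (fun t => f t + g t)%R <= 2%:E * l2n f + 2%:E * l2n g)%E.
Proof. by move=> mf mg; have := l2nD_weighted ltr01 mf mg; rewrite invr1. Qed.

Lemma truncation_dense f (e : R) : 0 < e -> mu.-integrable setT (EFin \o f) ->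
  (l2n f < +oo)%E -> exists (K : nat) (b : R -> R), [/\ measurable_fun setT b,
    forall t, `|b t| <= K%:R, forall t, K%:R < `|t| -> b t = 0,
    (l1n (fun t => f t - b t)%R <= e%:E)%E & (l2n (fun t => f t - b t)%R <= e%:E)%E].
Proof.
move=> e0 intf f2; have [_ mf] := l1n_integrable intf.
(* Truncation in both the variable and the value, so that [b] is bounded with bounded support. *)
pose A (k : nat) : set R := `[- k%:R, k%:R]%classic `&` (f @^-1` `[- k%:R, k%:R]%classic).
have mA k : measurable (A k).
  apply: measurableI => //; rewrite -[X in measurable X]setTI; exact: mf.
pose b k := f \_ (A k).
have AE k t : (t \in A k) = (`|t| <= k%:R) && (`|f t| <= k%:R).
  apply/idP/idP; rewrite inE /A /= !in_itv /= !ler_norml; first by move=> [-> ->].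
  by move=> /andP[-> ->].
have mb k : measurable_fun setT (b k).
  by apply: (iffLR (measurable_restrictT _ _)) => //; exact: measurable_funTS.
have fb k t : `|f t - b k t| <= `|f t|.
  by rewrite /b /patch; case: ifP; rewrite ?subrr ?normr0 ?subr0.
have cvg0 t : \forall k \near \oo, f t - b k t = 0.
  exists (absz (Num.ceil (Num.max `|t| `|f t|))) => // k /= hk.
  have : Num.max `|t| `|f t| <= k%:R.
    apply: (le_trans (ceil_ge _)); rewrite -[k%:R]/((k%:Z)%:~R) ler_int.
    by rewrite (le_trans (ler_norm _))// -abszE lez_nat.
  by rewrite ge_max /b /patch AE => ->; rewrite subrr.
have c1 : \int[mu]_t `|f t - b k t| @[k --> \oo] --> \int[mu]_t (0 : R).
  apply: (@Rintegral_dominated_cvg _ _ _ (fun t => `|f t|)) => //.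
  - by move=> k; apply: measurableT_comp => //; exact: measurable_funB.
  - move=> t; apply: cvg_near_cst; apply: filterS (cvg0 t) => k ->; exact: normr0.
  - by move=> k t; rewrite normr_id.
  - exact: integrable_norm.
have i2 : mu.-integrable setT (EFin \o (fun t => f t ^+ 2)).
  apply: integrable_l1n; first exact: measurable_funX.
  by rewrite /l1n; under eq_integral do rewrite ger0_norm ?sqr_ge0//.
have c2 : \int[mu]_t ((f t - b k t) ^+ 2) @[k --> \oo] --> \int[mu]_t (0 : R).
  apply: (@Rintegral_dominated_cvg _ _ _ (fun t => f t ^+ 2)) => //.
  - by move=> k; apply: measurable_funX; exact: measurable_funB.
  - move=> t; apply: cvg_near_cst; apply: filterS (cvg0 t) => k ->; exact: expr0n.
  - move=> k t; rewrite ger0_norm ?sqr_ge0// -real_normK ?num_real//.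
    by rewrite -[leRHS]real_normK ?num_real// lerXn2r ?nnegrE.
have I0 : \int[mu]_t (0 : R) = 0 by rewrite /Rintegral integral0.
rewrite I0 in c1 c2.
have [k h1 h2] : exists2 k, \int[mu]_t `|f t - b k t| <= e & \int[mu]_t ((f t - b k t) ^+ 2) <= e.
  move/cvgrPdist_le: c1 => /(_ e e0) c1; move/cvgrPdist_le: c2 => /(_ e e0) c2.
  have [k [h1 h2]] := filter_ex (filterI c1 c2).
  by exists k; [move: h1|move: h2]; rewrite sub0r normrN => /ler_normlW.
have i1 : mu.-integrable setT (EFin \o (fun t => `|f t - b k t|)).
  apply: le_integrable intf => //.
    exact: (measurable_norm_EFin (measurable_funB mf (mb k))).
  by move=> t _ /=; rewrite lee_fin normr_id.
have i3 : mu.-integrable setT (EFin \o (fun t => (f t - b k t) ^+ 2)).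
  apply: le_integrable i2 => //.
    by apply: measurable_sqr_EFin; exact: measurable_funB.
  move=> t _ /=; rewrite lee_fin !ger0_norm ?sqr_ge0//.
  by rewrite -real_normK ?num_real// -[leRHS]real_normK ?num_real// lerXn2r ?nnegrE.
exists k, (b k); split => //.
- by move=> t; rewrite /b /patch AE; case: ifP => [/andP[_ ->]//|_]; rewrite normr0.
- by move=> t kt; rewrite /b /patch AE leNgt kt.
- by rewrite /l1n -(fineK (integrable_fin_num measurableT i1)) lee_fin.
- by rewrite /l2n -(fineK (integrable_fin_num measurableT i3)) lee_fin.
Qed.

(** Approximation in L^1 on a bounded interval gives approximation in L^2 as soon as both functions
    are bounded by K, because (b - g)^2 <= 2 K |b - g|. *)
Lemma continuous_dense_bounded (K : nat) (b : R -> R) (e : R) : 0 < e ->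
  measurable_fun setT b -> (forall t, `|b t| <= K%:R) ->
  (forall t, K%:R < `|t| -> b t = 0) ->
  exists g, [/\ continuous g, forall t, `|g t| <= K%:R,
    (l1n g < +oo)%E, (l1n (fun t => b t - g t)%R <= e%:E)%E &
    (l2n (fun t => b t - g t)%R <= e%:E)%E].
Proof.
move=> e0 mb bK b0.
pose E : set R := `[- (K%:R + 1), K%:R + 1]%classic.
have EE t : (t \in E) = (`|t| <= K%:R + 1) by rewrite /E mem_setE in_itv /= ler_norml.
have mE : measurable E by exact: measurable_itv.
have muE : (mu E < +oo)%E.
  by rewrite lebesgue_measure_itv /= lte_fin; case: ifP => _; rewrite ?ltry// -EFinB ltry.
have ib : mu.-integrable E (EFin \o b).
  apply: measurable_bounded_integrable => //; first exact: measurable_funTS.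
  by exists K%:R; split; rewrite ?num_real// => x Kx t _; apply: le_trans (bK t) _; exact: ltW.
(* Small enough for both norms: e' <= e and 2 K e' <= e. *)
pose e' := e / (2 * K%:R + 1).
have e'0 : 0 < e' by rewrite divr_gt0// ltr_wpDl// mulr_ge0.
have [h_ [ch ih cvgh]] := approximation_continuous_integrable mE muE ib.
have [n hn] : exists n, (\int[mu]_(z in E) `|(b z - h_ n z)%:E| < e'%:E)%E.
  move/fine_cvgP : cvgh => [fin /cvgrPdist_lt /(_ e' e'0) h].
  have [n [fn hn]] := filter_ex (filterI fin h); exists n.
  rewrite -(fineK fn) lte_fin; apply: le_lt_trans hn.
  by rewrite sub0r normrN; exact: ler_norm.
(* Clipping to [-K, K] does not increase the distance to b, and [chi] differs from 1 only where b
   vanishes, so neither operation spoils the approximation while together they make g bounded and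
   integrable. *)
pose clip (x : R) : R := Num.max (- K%:R) (Num.min x K%:R).
pose chi (t : R) : R := Num.max 0 (Num.min 1 (K%:R + 1 - `|t|)).
pose g t := chi t * clip (h_ n t).
have K0 : 0 <= K%:R :> R by [].
have clipK x : `|clip x| <= K%:R.
  rewrite ler_norml /clip le_max lexx /= ge_max ge_min lexx orbT andbT.
  by rewrite (le_trans _ K0)// oppr_le0.
have clipx x : `|clip x| <= `|x|.
  rewrite /clip; case: (leP x K%:R) => xK.
    case: (leP (- K%:R) x) => Kx //.
    by rewrite normrN ger0_norm// ltr0_norm; lra.
  by rewrite (_ : Num.max _ _ = K%:R) ?ger0_norm//; [lra|lra|apply/max_idPr; lra].
have clipd x y : `|y| <= K%:R -> `|y - clip x| <= `|y - x|.
  rewrite ler_norml => /andP[y1 y2]; rewrite /clip; case: (leP x K%:R) => xK.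
    case: (leP (- K%:R) x) => Kx //.
    by rewrite !ger0_norm; lra.
  by rewrite (_ : Num.max _ _ = K%:R); [rewrite !ler0_norm; lra|apply/max_idPr; lra].
have chi01 t : 0 <= chi t <= 1.
  by rewrite /chi le_max lexx /= ge_max ler01 ge_min lexx.
have chi1 t : `|t| <= K%:R -> chi t = 1.
  move=> tK; rewrite /chi min_l ?max_r//; lra.
have chi0 t : K%:R + 1 < `|t| -> chi t = 0.
  move=> tK; rewrite /chi max_l//; rewrite ge_min; apply/orP; right; lra.
have cg : continuous g.
  move=> t; apply: continuousM.
    apply: continuous_max; first exact: cst_continuous.
    apply: continuous_min; first exact: cst_continuous.
    by apply: continuousB; [exact: cst_continuous|exact: norm_continuous].
  apply: continuous_max; first exact: cst_continuous.
  by apply: continuous_min; [exact: ch|exact: cst_continuous].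
have mg : measurable_fun setT g by exact: continuous_measurable_fun.
have gK t : `|g t| <= K%:R.
  rewrite /g normrM; have /andP[c0 c1] := chi01 t; rewrite (ger0_norm c0).
  by have := clipK (h_ n t); have := normr_ge0 (clip (h_ n t)); nra.
have bg t : `|b t - g t| <= (if t \in E then `|b t - h_ n t| else 0).
  rewrite EE; case: ifPn => [tE|]; last first.
    by rewrite -ltNge => tE; rewrite /g chi0// b0 ?mul0r ?subr0 ?normr0//; lra.
  have [tK|tK] := leP `|t| K%:R; first by rewrite /g chi1// mul1r clipd.
  rewrite b0// !sub0r !normrN /g normrM; have /andP[c0 c1] := chi01 t.
  rewrite (ger0_norm c0); apply: le_trans (clipx (h_ n t)).
  by rewrite ler_piMl.
have d1 : (l1n (fun t => b t - g t)%R <= e'%:E)%E.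
  apply: le_trans (ltW hn); rewrite [leRHS]integral_mkcond.
  apply: ge0_le_integral => //.
  - by apply: measurable_norm_EFin; exact: measurable_funB.
  - apply: (iffLR (measurable_restrictT _ _)) => //.
    apply: measurable_funTS; apply: measurable_norm_EFin; apply: measurable_funB => //.
    exact: continuous_measurable_fun.
  - move=> t _; rewrite /patch; have := bg t; case: ifP => _; rewrite ?lee_fin//.
exists g; split => //.
- have b1 : (l1n b < +oo)%E.
    have /integrableP[_] := ib; apply: le_lt_trans.
    rewrite [leRHS]integral_mkcond; apply: ge0_le_integral => //.
    + exact: measurable_norm_EFin.
    + apply: (iffLR (measurable_restrictT _ _)) => //.
      by apply: measurable_funTS; exact: measurable_norm_EFin.
    + move=> t _; rewrite /patch EE; case: ifPn => [_|]; rewrite ?lee_fin//.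
      by rewrite -ltNge => tE; rewrite b0 ?normr0//; lra.
  have -> : g = fun t => b t + (- (b t - g t)) by apply/funext => t; ring.
  have md : measurable_fun setT (fun t => - (b t - g t)).
    exact: (measurable_funN (measurable_funB mb mg)).
  apply: (le_lt_trans (l1nD mb md)).
  apply: lte_add_pinfty => //; apply: le_lt_trans (ltry e').
  by apply: le_trans d1; rewrite /l1n; under eq_integral do rewrite normrN.
- apply: (le_trans d1); rewrite lee_fin /e' ler_pdivrMr ?ltr_wpDl ?mulr_ge0//.
  by rewrite ler_peMr ?(ltW e0)// lerDr mulr_ge0.
- apply: (@le_trans _ _ ((2 * K%:R)%:E * l1n (fun t => b t - g t)%R)%E).
    have md := measurable_norm_EFin (measurable_funB mb mg).
    have k0 : (0 <= (2 * K%:R : R)%:E)%E by rewrite lee_fin mulr_ge0.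
    rewrite /l1n -ge0_integralZl//.
    apply: ge0_le_integral => //.
    + by move=> t _; rewrite lee_fin sqr_ge0.
    + by apply: measurable_sqr_EFin; exact: measurable_funB.
    + apply: measurable_funeM; apply: measurable_norm_EFin; exact: measurable_funB.
    + move=> t _; rewrite -EFinM lee_fin -real_normK ?num_real// expr2 ler_wpM2r//.
      rewrite (le_trans (ler_normB _ _))//; have := bK t; have := gK t; lra.
  apply: (@le_trans _ _ ((2 * K%:R)%:E * e'%:E)%E); first by rewrite lee_wpmul2l.
  rewrite -EFinM lee_fin /e' mulrCA ger_pMr// ler_pdivrMr ?mul1r ?lerDl//.
Qed.

Lemma continuous_dense f (e : R) : 0 < e -> mu.-integrable setT (EFin \o f) ->
  (l2n f < +oo)%E -> exists g M, [/\ continuous g, forall t, `|g t| <= M,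
    mu.-integrable setT (EFin \o g), (l1n (fun t => f t - g t)%R <= e%:E)%E &
    (l2n (fun t => f t - g t)%R <= e%:E)%E].
Proof.
move=> e0 intf f2; have [_ mf] := l1n_integrable intf.
have e4 : 0 < e / 4 by rewrite divr_gt0.
have [K [b [mb bK b0 l1b l2b]]] := truncation_dense e4 intf f2.
have [g [cg gK ig l1g l2g]] := continuous_dense_bounded e4 mb bK b0.
have mg : measurable_fun setT g by exact: continuous_measurable_fun.
have mfb := measurable_funB mf mb; have mbg := measurable_funB mb mg.
have E : (fun t => f t - g t) = fun t => (f t - b t) + (b t - g t).
  by apply/funext => t; ring.
exists g, K%:R; split => //.
- exact: integrable_l1n.
- rewrite E; apply: (le_trans (l1nD mfb mbg)); apply: (le_trans (leeD l1b l1g)).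
  by rewrite -EFinD lee_fin; lra.
- rewrite E; apply: (le_trans (l2nD mfb mbg)).
  apply: (@le_trans _ _ (2%:E * (e / 4)%:E + 2%:E * (e / 4)%:E)%E).
    by apply: leeD; apply: lee_wpmul2l.
  by rewrite -!EFinM -EFinD lee_fin; lra.
Qed.

End Density.

(** * Plancherel for real functions in L^1 and L^2 *)

Section PlancherelReal.
Context {R : realType}.
Local Notation mu := (@lebesgue_measure R).
Implicit Types (f g h : R -> R).

Lemma costrD f g y : mu.-integrable setT (EFin \o f) -> mu.-integrable setT (EFin \o g) ->
  costr (fun t => f t + g t) y = costr f y + costr g y.
Proof.
move=> intf intg; rewrite /costr -RintegralD//; try exact: integrable_cos.
by apply: eq_Rintegral => t _; rewrite mulrDl.
Qed.

Lemma sintrD f g y : mu.-integrable setT (EFin \o f) -> mu.-integrable setT (EFin \o g) ->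
  sintr (fun t => f t + g t) y = sintr f y + sintr g y.
Proof.
move=> intf intg; rewrite /sintr -RintegralD//; try exact: integrable_sin.
by apply: eq_Rintegral => t _; rewrite mulrDl.
Qed.

Lemma costrZ k f y : mu.-integrable setT (EFin \o f) ->
  costr (fun t => k * f t) y = k * costr f y.
Proof.
move=> intf; rewrite /costr -RintegralZl//; last exact: integrable_cos.
by apply: eq_Rintegral => t _; rewrite mulrA.
Qed.

Lemma sintrZ k f y : mu.-integrable setT (EFin \o f) ->
  sintr (fun t => k * f t) y = k * sintr f y.
Proof.
move=> intf; rewrite /sintr -RintegralZl//; last exact: integrable_sin.
by apply: eq_Rintegral => t _; rewrite mulrA.
Qed.

Lemma integrableD_EFin f g : mu.-integrable setT (EFin \o f) ->
  mu.-integrable setT (EFin \o g) ->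
  mu.-integrable setT (EFin \o (fun t => f t + g t)).
Proof. by move=> intf intg; exact: (integrableD measurableT intf intg). Qed.

Lemma integrableB_EFin f g : mu.-integrable setT (EFin \o f) ->
  mu.-integrable setT (EFin \o g) ->
  mu.-integrable setT (EFin \o (fun t => f t - g t)).
Proof. by move=> intf intg; exact: (integrableB measurableT intf intg). Qed.

Lemma energy_parallelogram f g y : mu.-integrable setT (EFin \o f) ->
  mu.-integrable setT (EFin \o g) ->
  energy (fun t => f t + g t) y + energy (fun t => f t - g t) y =
  2 * energy f y + 2 * energy g y.
Proof.
move=> intf intg; have intNg := integrableZ_EFin (-1) measurableT intg.
have -> : (fun t => f t - g t) = fun t => f t + (-1) * g t.
  by apply/funext => t; rewrite mulN1r.
by rewrite /energy !costrD// !sintrD// costrZ// sintrZ//; ring.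
Qed.

Definition htn f : \bar R := (\int[mu]_y (energy f y)%:E)%E.

Lemma le_limn_einf (u v : (\bar R)^nat) : (forall n, (u n <= v n)%E) ->
  (limn_einf u <= limn_einf v)%E.
Proof.
move=> uv; rewrite !limn_einf_lim; apply: lee_lim; [exact: is_cvg_einfs..|].
apply: nearW => n; apply: le_ereal_inf_tmp => _ [k nk <-].
by apply: le_trans (uv k); apply: ereal_inf_lbound; exists k.
Qed.

(** L^1 convergence of continuous approximants gives pointwise convergence of their transforms, and
    Fatou's lemma then yields one inequality. *)
Lemma htn_le f : mu.-integrable setT (EFin \o f) -> (l2n f < +oo)%E ->
  (htn f <= l2n f)%E.
Proof.
move=> intf f2; have [_ mf] := l1n_integrable intf.
have f2f : l2n f \is a fin_num by rewrite ge0_fin_numE// l2n_ge0.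
pose d n : R := n.+1%:R^-1.
have d0 n : 0 < d n by rewrite invr_gt0.
have d20 n : 0 < d n ^+ 2 by rewrite exprn_gt0.
have /choice[g gP] : forall n, exists g, exists M, [/\ continuous g, forall t, `|g t| <= M,
    mu.-integrable setT (EFin \o g), (l1n (fun t => f t - g t)%R <= (d n ^+ 2)%:E)%E &
    (l2n (fun t => f t - g t)%R <= (d n ^+ 2)%:E)%E].
  by move=> n; exact: continuous_dense.
have ig n : mu.-integrable setT (EFin \o g n) by have [M []] := gP n.
have mg n : measurable_fun setT (g n) by have [] := l1n_integrable (ig n).
have d2cvg : d n ^+ 2 @[n --> \oo] --> (0 : R).
  have -> : (0 : R) = 0 * 0 by rewrite mulr0.
  by under eq_fun do rewrite expr2; apply: cvgM; exact: cvg_harmonic.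
have diffE n : \int[mu]_t `|f t - g n t| <= d n ^+ 2.
  have [M [_ _ _ h _]] := gP n.
  rewrite -lee_fin /Rintegral fineK//; apply: integrable_fin_num => //.
  by apply: integrable_norm; exact: integrableB_EFin.
have cc y : costr (g n) y @[n --> \oo] --> costr f y.
  apply/cvgrPdist_le => e e0; move/cvgrPdist_le: d2cvg => /(_ e e0).
  apply: filterS => n; rewrite sub0r normrN ger0_norm ?sqr_ge0// => dn.
  apply: le_trans dn; apply: le_trans (diffE n).
  have -> : costr f y - costr (g n) y = costr (fun t => f t - g n t) y.
    have -> : (fun t => f t - g n t) = fun t => f t + (-1) * g n t.
      by apply/funext => t; rewrite mulN1r.
    by rewrite costrD// ?costrZ ?mulN1r//; exact: integrableZ_EFin.
  exact: costr_bound (integrableB_EFin _ _).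
have cs y : sintr (g n) y @[n --> \oo] --> sintr f y.
  apply/cvgrPdist_le => e e0; move/cvgrPdist_le: d2cvg => /(_ e e0).
  apply: filterS => n; rewrite sub0r normrN ger0_norm ?sqr_ge0// => dn.
  apply: le_trans dn; apply: le_trans (diffE n).
  have -> : sintr f y - sintr (g n) y = sintr (fun t => f t - g n t) y.
    have -> : (fun t => f t - g n t) = fun t => f t + (-1) * g n t.
      by apply/funext => t; rewrite mulN1r.
    by rewrite sintrD// ?sintrZ ?mulN1r//; exact: integrableZ_EFin.
  exact: sintr_bound (integrableB_EFin _ _).
have ce y : (energy (g n) y)%:E @[n --> \oo] --> (energy f y)%:E.
  apply: cvg_EFin; first exact: nearW.
  by rewrite /energy; under eq_fun do rewrite !expr2; rewrite !expr2; apply: cvgD; apply: cvgM.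
have -> : htn f = (\int[mu]_y limn_einf (fun n => (energy (g n) y)%:E))%E.
  by apply: eq_integral => y _; rewrite (cvg_limn_einf_sup (ce y)).1.
have me n : measurable_fun setT (fun y => (energy (g n) y)%:E).
  by apply/measurable_EFinP; exact: measurable_energy.
have := @fatou _ _ _ mu setT measurableT (fun n y => (energy (g n) y)%:E) me
   (fun n y _ => energy_ge0 _ _).
move=> /le_trans; apply.
(* With error d^2 and weight d in [l2nD_weighted] the second term is (1 + 1/d) d^2 = d^2 + d, which
   tends to 0. *)
pose u n := ((1 + d n)%:E * l2n f + ((1 + (d n)^-1) * d n ^+ 2)%:E)%E.
have hu n : (\int[mu]_y (energy (g n) y)%:E <= u n)%E.
  have [M [cg gM _ _ l2g]] := gP n.
  rewrite (energy_continuous cg gM (ig n)).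
  have i2 : mu.-integrable setT (EFin \o (fun t => g n t ^+ 2)).
    have := integrable_mul_bounded measurableT (ig n) (mg n) gM.
    by apply: eq_integrable.
  rewrite /Rintegral (fineK (integrable_fin_num measurableT i2)).
  have -> : (\int[mu]_t (g n t ^+ 2)%:E = l2n (fun t => f t + (- (f t - g n t)))%R)%E.
    by apply: eq_integral => t _; congr EFin; ring.
  apply: (le_trans (l2nD_weighted (d0 n) mf _)).
    exact: (measurable_funN (measurable_funB mf (mg n))).
  rewrite /u EFinM; apply: leeD => //; apply: lee_wpmul2l.
    by rewrite lee_fin addr_ge0// invr_ge0 ltW.
  apply: le_trans l2g; rewrite /l2n.
  by under eq_integral do rewrite sqrrN.
have cu : u n @[n --> \oo] --> l2n f.
  pose F := fine (l2n f); have FE : l2n f = F%:E by rewrite /F fineK.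
  rewrite FE (_ : u = fun n => ((1 + d n) * F + (d n ^+ 2 + d n))%:E); last first.
    apply/funext => n; rewrite /u FE -EFinM -EFinD; congr (_ + _)%:E.
    by field; rewrite gt_eqF.
  apply: cvg_EFin; first exact: nearW.
  have dc : d n @[n --> \oo] --> (0 : R) by exact: cvg_harmonic.
  have : (1 + d n) * F + (d n ^+ 2 + d n) @[n --> \oo] --> (1 + 0) * F + (0 + 0).
    apply: cvgD; last exact: cvgD.
    by apply: cvgMr_tmp; apply: cvgD => //; exact: cvg_cst.
  by rewrite !addr0 mul1r.
by rewrite -(cvg_limn_einf_sup cu).1; exact: le_limn_einf.
Qed.

(** The reverse inequality comes from the parallelogram law. Write f = g + h with g continuous and h
    small: both [htn] and [l2n] satisfy the law, they agree on g, and [htn_le] for g - h gives l2n f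
    <= htn f + 2 l2n h. *)
Lemma plancherel_real f : mu.-integrable setT (EFin \o f) -> (l2n f < +oo)%E ->
  htn f = l2n f.
Proof.
move=> intf f2; have [_ mf] := l1n_integrable intf.
apply/eqP; rewrite eq_le htn_le//=; apply/lee_addgt0Pr => e e0.
have e2 : 0 < e / 2 by rewrite divr_gt0.
have [g [M [cg gM ig _ l2h]]] := continuous_dense e2 intf f2.
have [_ mg] := l1n_integrable ig.
pose h t := f t - g t.
have ih : mu.-integrable setT (EFin \o h) by exact: integrableB_EFin.
have [_ mh] := l1n_integrable ih.
have ighh : mu.-integrable setT (EFin \o (fun t => g t - h t)) by exact: integrableB_EFin.
have h2 : (l2n h < +oo)%E by exact: le_lt_trans l2h (ltry _).
have g2 : (l2n g < +oo)%E.
  have -> : g = fun t => f t + (- h t) by apply/funext => t; rewrite /h; ring.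
  apply: (le_lt_trans (l2nD mf (measurable_funN mh))).
  rewrite lte_add_pinfty// lte_mul_pinfty// /l2n.
  by under eq_integral do rewrite sqrrN.
have gh2 : (l2n (fun t => g t - h t)%R < +oo)%E.
  apply: (le_lt_trans (l2nD mg (measurable_funN mh))).
  rewrite lte_add_pinfty// lte_mul_pinfty// /l2n.
  by under eq_integral do rewrite sqrrN.
have Eg : htn g = l2n g.
  rewrite /htn (energy_continuous cg gM ig) /Rintegral fineK// ge0_fin_numE//.
  exact: l2n_ge0.
have fE : f = fun t => g t + h t by apply/funext => t; rewrite /h; ring.
have fin u : (l2n u < +oo)%E -> l2n u \is a fin_num.
  by move=> ?; rewrite ge0_fin_numE// l2n_ge0.
have two0 : (0 <= 2%:E :> \bar R)%E by rewrite lee_fin.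
have p1 : (htn f + htn (fun t => g t - h t)%R = 2%:E * l2n g + 2%:E * htn h)%E.
  rewrite -Eg /htn -!ge0_integralZl -?ge0_integralD//;
   try (by move=> t _; rewrite lee_fin energy_ge0);
   try (by move=> t _; apply: mule_ge0 => //; rewrite lee_fin energy_ge0);
   try (by apply/measurable_EFinP; exact: measurable_energy);
   try (by apply: measurable_funeM; apply/measurable_EFinP; exact: measurable_energy).
  apply: eq_integral => y _; rewrite -!EFinM -!EFinD {1}fE.
  by rewrite energy_parallelogram.
have p2 : (l2n f + l2n (fun t => g t - h t)%R = 2%:E * l2n g + 2%:E * l2n h)%E.
  have mgh := measurable_funB mg mh.
  rewrite /l2n -!ge0_integralZl -?ge0_integralD//;
   try (by move=> t _; rewrite lee_fin sqr_ge0);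
   try (by move=> t _; apply: mule_ge0 => //; rewrite lee_fin sqr_ge0);
   try (exact: measurable_sqr_EFin);
   try (by apply: measurable_funeM; exact: measurable_sqr_EFin).
  by apply: eq_integral => t _; rewrite -!EFinM -!EFinD {1}fE; congr EFin; ring.
have q1 := htn_le ighh gh2.
suff : (l2n f + l2n (fun t => g t - h t)%R <= htn f + e%:E + l2n (fun t => g t - h t)%R)%E.
  by rewrite leeD2rE//; exact: fin.
rewrite p2; apply: (@le_trans _ _ (2%:E * l2n g + e%:E)%E).
  rewrite leeD2l//; apply: (@le_trans _ _ (2%:E * (e / 2)%:E)%E).
    exact: lee_wpmul2l.
  by rewrite -EFinM lee_fin; lra.
rewrite addeAC leeD2r//; apply: (@le_trans _ _ (htn f + htn (fun t => g t - h t)%R)%E).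
  rewrite p1 leeDl// mule_ge0//; apply: integral_ge0 => y _.
  by rewrite lee_fin energy_ge0.
by rewrite leeD2l.
Qed.

End PlancherelReal.

(** * Complex-valued functions *)

Section ComplexL2.
Context {R : realType}.
Local Notation mu := (@lebesgue_measure R).
Local Notation Re := complex.Re.
Local Notation Im := complex.Im.
Implicit Types (f g h : R -> R[i]) (z w : R[i]).

Definition sqn f : \bar R := (\int[mu]_t (cmod (f t) ^+ 2)%:E)%E.

Local Notation N2 := (cLnorm 2%:E).

Lemma measurable_cmod f : cmeasurable f -> measurable_fun setT (fun t => cmod (f t)).
Proof.
move=> [mr mi].
have -> : (fun t => cmod (f t)) = fun t => Num.sqrt (Re (f t) ^+ 2 + Im (f t) ^+ 2).
  by apply/funext => t; rewrite -cmod_sqr sqrtr_sqr ger0_norm// cmod_ge0.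
have ms : measurable_fun setT (@Num.sqrt R).
  by apply: continuous_measurable_fun; exact: sqrt_continuous.
apply: (measurableT_comp ms).
by apply: measurable_funD; exact: measurable_funX.
Qed.

Lemma measurable_cmod2 f : cmeasurable f -> measurable_fun setT (fun t => (cmod (f t) ^+ 2)%:E).
Proof. by move=> mf; apply: measurable_sqr_EFin; exact: measurable_cmod. Qed.

Lemma cmeasurableD f g : cmeasurable f -> cmeasurable g -> cmeasurable (fun t => f t + g t).
Proof.
move=> [f1 f2] [g1 g2]; split.
  have -> : (fun t => Re (f t + g t)) = fun t => Re (f t) + Re (g t).
    by apply/funext => t; case: (f t) (g t) => a b [].
  exact: measurable_funD.
have -> : (fun t => Im (f t + g t)) = fun t => Im (f t) + Im (g t).
  by apply/funext => t; case: (f t) (g t) => a b [].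
exact: measurable_funD.
Qed.

Lemma cmeasurableM f g : cmeasurable f -> cmeasurable g -> cmeasurable (fun t => f t * g t).
Proof.
move=> [f1 f2] [g1 g2]; split.
  have -> : (fun t => Re (f t * g t)) = fun t => Re (f t) * Re (g t) - Im (f t) * Im (g t).
    by apply/funext => t; case: (f t) (g t) => a b [].
  by apply: measurable_funB; exact: measurable_funM.
have -> : (fun t => Im (f t * g t)) = fun t => Re (f t) * Im (g t) + Im (f t) * Re (g t).
  by apply/funext => t; case: (f t) (g t) => a b [].
by apply: measurable_funD; exact: measurable_funM.
Qed.

Lemma cmeasurable_cst z : cmeasurable (fun=> z).
Proof. by split; exact: measurable_cst. Qed.

Lemma cmeasurableZ z f : cmeasurable f -> cmeasurable (fun t => z * f t).
Proof. by move=> mf; apply: cmeasurableM => //; exact: cmeasurable_cst. Qed.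

Lemma cmeasurableB f g : cmeasurable f -> cmeasurable g -> cmeasurable (fun t => f t - g t).
Proof.
move=> mf mg; have -> : (fun t => f t - g t) = fun t => f t + (-1) * g t.
  by apply/funext => t; rewrite mulN1r.
by apply: cmeasurableD => //; exact: cmeasurableZ.
Qed.

Lemma cmeasurable_conj f : cmeasurable f -> cmeasurable (fun t => (f t)^*).
Proof.
move=> [mr mi]; split.
  have -> : (fun t => Re (f t)^*) = fun t => Re (f t).
    by apply/funext => t; case: (f t).
  exact: mr.
have -> : (fun t => Im (f t)^*) = fun t => - Im (f t).
  by apply/funext => t; case: (f t).
exact: measurable_funN.
Qed.

Lemma cmeasurable_sum (I : Type) (s : seq I) (F : I -> R -> R[i]) :
  (forall i, cmeasurable (F i)) -> cmeasurable (fun t => \sum_(i <- s) F i t).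
Proof.
move=> mF; elim: s => [|i s IH].
  have -> : (fun t => \sum_(i <- [::]) F i t) = fun=> 0.
    by apply/funext => t; rewrite big_nil.
  exact: cmeasurable_cst.
have -> : (fun t => \sum_(j <- i :: s) F j t) = fun t => F i t + \sum_(j <- s) F j t.
  by apply/funext => t; rewrite big_cons.
exact: cmeasurableD.
Qed.

Lemma cmeasurable_comp f (p : R -> R) : measurable_fun setT p -> cmeasurable f ->
  cmeasurable (fun t => f (p t)).
Proof.
by move=> mp [mr mi]; split; [exact: (measurableT_comp mr mp)|exact: (measurableT_comp mi mp)].
Qed.

Lemma cmeasurable_expchar n : cmeasurable (expchar n : R -> R[i]).
Proof.
have ma : measurable_fun setT (fun t : R => 2 * pi * n%:~R * t) by exact: measurable_funM.
split; [exact: (measurableT_comp measurable_cos ma)|exact: (measurableT_comp measurable_sin ma)].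
Qed.

Lemma cmeasurable_trig_poly (s : seq int) (c : int -> R[i]) : cmeasurable (trig_poly s c).
Proof.
apply: cmeasurable_sum => k; apply: cmeasurableZ; exact: cmeasurable_expchar.
Qed.

Lemma sqn_ge0 f : (0 <= sqn f)%E.
Proof. by apply: integral_ge0 => t _; rewrite lee_fin sqr_ge0. Qed.

Lemma cLnorm_ge0 p f : (0 <= cLnorm p f)%E.
Proof. exact: Lnorm_ge0. Qed.

Lemma cLnorm2E f : N2 f = (sqn f `^ 2^-1)%E.
Proof.
rewrite /cLnorm unlock /sqn; congr (_ `^ _)%E; apply: eq_integral => t _.
by rewrite /= (ger0_norm (cmod_ge0 _)) powR_mulrn// cmod_ge0.
Qed.

Lemma sqn_cLnorm f : sqn f = (N2 f * N2 f)%E.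
Proof.
have := sqn_ge0 f; rewrite cLnorm2E; case: (sqn f) => [r| |]//= r0.
  by rewrite -EFinM -expr2 -powR_mulrn ?powR_ge0// -powRrM mulVf// powRr1.
by rewrite ifF ?mulyy// invr_eq0; apply/negbTE; rewrite pnatr_eq0.
Qed.

Lemma cLnorm1E f : cLnorm 1 f = (\int[mu]_t (cmod (f t))%:E)%E.
Proof.
rewrite /cLnorm Lnorm1; apply: eq_integral => t _.
by rewrite /= ger0_norm// cmod_ge0.
Qed.

Lemma cL2_sqn f : cL2 f <-> cmeasurable f /\ (sqn f < +oo)%E.
Proof.
split => -[mf h]; split => //; move: h; rewrite cLnorm2E; last exact: poweR_lty.
by apply: lty_poweRy; rewrite invr_eq0 pnatr_eq0.
Qed.

Lemma cLnorm_le_sqn f (C : R) : 0 <= C -> (sqn f <= (C ^+ 2)%:E)%E -> (N2 f <= C%:E)%E.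
Proof.
move=> C0 h; rewrite cLnorm2E.
have -> : C%:E = ((C ^+ 2)%:E `^ 2^-1)%E.
  by rewrite /= -powR_mulrn// -powRrM mulfV// powRr1.
by apply: gt0_ler_poweR; rewrite ?in_itv /= ?leey ?andbT ?sqn_ge0 ?lee_fin ?sqr_ge0.
Qed.

Lemma sqn_le_cLnorm f (C : R) : 0 <= C -> (N2 f <= C%:E)%E -> (sqn f <= (C ^+ 2)%:E)%E.
Proof.
move=> C0 h; rewrite sqn_cLnorm expr2 EFinM.
by apply: lee_pmul => //; exact: cLnorm_ge0.
Qed.

Lemma eq_sqn_cLnorm f g : sqn f = sqn g -> N2 f = N2 g.
Proof. by rewrite !cLnorm2E => ->. Qed.

Lemma cLnormD f g : cmeasurable f -> cmeasurable g ->
  (N2 (fun t => f t + g t)%R <= N2 f + N2 g)%E.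
Proof.
move=> mf mg.
have mcf := measurable_cmod mf; have mcg := measurable_cmod mg.
have h := @minkowski_EFin _ _ _ mu (fun t => cmod (f t)) (fun t => cmod (g t)) 2 mcf mcg.
apply: le_trans (h _); last by rewrite ler1n.
have pos (F : R -> \bar R) : (0 <= \int[mu]_t (`|F t| `^ 2))%E.
  by apply: integral_ge0 => t _; exact: poweR_ge0.
rewrite /cLnorm unlock; apply: gt0_ler_poweR.
- by rewrite invr_ge0.
- by rewrite in_itv; apply/andP; split; [exact: pos|exact: leey].
- by rewrite in_itv; apply/andP; split; [exact: pos|exact: leey].
apply: ge0_le_integral => //.
- by move=> t _; rewrite lee_fin powR_ge0.
- apply/measurable_EFinP; under eq_fun do rewrite (powR_mulrn 2 (normr_ge0 _)).
  apply: measurable_funX; apply: measurableT_comp => //.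
  by apply: measurable_cmod; exact: cmeasurableD.
- apply/measurable_EFinP; under eq_fun do rewrite (powR_mulrn 2 (normr_ge0 _)).
  by apply: measurable_funX; apply: measurableT_comp => //; exact: measurable_funD.
move=> t _; rewrite lee_fin !powR_mulrn// lerXn2r ?nnegrE//.
rewrite !ger0_norm ?addr_ge0 ?cmod_ge0//; exact: cmodD.
Qed.

Lemma sqnZ z f : cmeasurable f -> sqn (fun t => z * f t) = ((cmod z ^+ 2)%:E * sqn f)%E.
Proof.
move=> mf; rewrite /sqn -ge0_integralZl//; last 3 first.
- exact: measurable_cmod2.
- by move=> t _; rewrite lee_fin sqr_ge0.
- by rewrite lee_fin sqr_ge0.
by apply: eq_integral => t _; rewrite -EFinM cmodM exprMn.
Qed.

Lemma cLnormZ z f : cmeasurable f -> N2 (fun t => z * f t) = ((cmod z)%:E * N2 f)%E.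
Proof.
move=> mf; rewrite !cLnorm2E sqnZ// poweRM ?sqn_ge0 ?lee_fin ?sqr_ge0//.
by rewrite /= -powR_mulrn ?cmod_ge0// -powRrM mulfV// powRr1// cmod_ge0.
Qed.

Lemma cL2D f g : cL2 f -> cL2 g -> cL2 (fun t => f t + g t).
Proof.
move=> [mf hf] [mg hg]; split; first exact: cmeasurableD.
by apply: (le_lt_trans (cLnormD mf mg)); exact: lte_add_pinfty.
Qed.

Lemma cL2Z z f : cL2 f -> cL2 (fun t => z * f t).
Proof.
move=> [mf hf]; split; first exact: cmeasurableZ.
by rewrite cLnormZ// lte_mul_pinfty// lee_fin cmod_ge0.
Qed.

Lemma cL2B f g : cL2 f -> cL2 g -> cL2 (fun t => f t - g t).
Proof.
move=> hf hg; have -> : (fun t => f t - g t) = fun t => f t + (-1) * g t.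
  by apply/funext => t; rewrite mulN1r.
by apply: cL2D => //; exact: cL2Z.
Qed.

Lemma cL2_0 : cL2 (fun=> 0 : R[i]).
Proof.
apply/cL2_sqn; split; first exact: cmeasurable_cst.
by rewrite /sqn; under eq_integral do rewrite cmod0 expr0n; rewrite integral0.
Qed.

Lemma cL2_sum (I : Type) (s : seq I) (F : I -> R -> R[i]) :
  (forall i, cL2 (F i)) -> cL2 (fun t => \sum_(i <- s) F i t).
Proof.
move=> mF; elim: s => [|i s IH].
  have -> : (fun t => \sum_(i <- [::]) F i t) = fun=> 0.
    by apply/funext => t; rewrite big_nil.
  exact: cL2_0.
have -> : (fun t => \sum_(j <- i :: s) F j t) = fun t => F i t + \sum_(j <- s) F j t.
  by apply/funext => t; rewrite big_cons.
exact: cL2D.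
Qed.

Lemma cLnormB_sym f g : N2 (fun t => f t - g t) = N2 (fun t => g t - f t).
Proof.
by apply: eq_sqn_cLnorm; apply: eq_integral => t _; rewrite -cmodN opprB.
Qed.

Lemma cLnorm_triangle h f g : cmeasurable f -> cmeasurable g -> cmeasurable h ->
  (N2 (fun t => f t - g t)%R <= N2 (fun t => f t - h t)%R + N2 (fun t => h t - g t)%R)%E.
Proof.
move=> mf mg mh; have := cLnormD (cmeasurableB mf mh) (cmeasurableB mh mg).
rewrite (_ : (fun t => f t - h t + (h t - g t)) = fun t => f t - g t)//.
by apply/funext => t; ring.
Qed.

Lemma cLnorm_sum (I : Type) (s : seq I) (F : I -> R -> R[i]) :
  (forall i, cmeasurable (F i)) ->
  (N2 (fun t => \sum_(i <- s) F i t)%R <= \sum_(i <- s) N2 (F i))%E.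
Proof.
move=> mF; elim: s => [|i s IH].
  rewrite big_nil cLnorm2E /sqn (_ : (\int[mu]_t _)%E = 0%E) ?poweR0r ?invr_eq0//.
  by under eq_integral do rewrite big_nil cmod0 expr0n; rewrite integral0.
have -> : (fun t => \sum_(j <- i :: s) F j t) = fun t => F i t + \sum_(j <- s) F j t.
  by apply/funext => t; rewrite big_cons.
rewrite big_cons; apply: (le_trans (cLnormD _ _)) => //; first exact: cmeasurable_sum.
by rewrite leeD2l.
Qed.

Lemma ae_eq_cLnorm f g : cmeasurable f -> cmeasurable g ->
  {ae mu, forall t, f t = g t} -> N2 f = N2 g.
Proof.
move=> mf mg fg; apply: eq_sqn_cLnorm; apply: ge0_ae_eq_integral => //.
- exact: measurable_cmod2.
- exact: measurable_cmod2.
- by move=> t _; rewrite lee_fin sqr_ge0.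
- by move=> t _; rewrite lee_fin sqr_ge0.
- have [A [mA A0 AP]] := fg; exists A; split => //.
  by move=> t /= h; apply: AP => /= ft; apply: h => _; rewrite ft.
Qed.

Lemma cLnorm_translate k f : cmeasurable f -> N2 (translate k f) = N2 f.
Proof.
move=> mf; apply: eq_sqn_cLnorm; rewrite /sqn /translate.
rewrite (@ge0_integral_translate R k%:~R (fun t => (cmod (f t) ^+ 2)%:E))//.
  exact: measurable_cmod2.
by move=> t; rewrite lee_fin sqr_ge0.
Qed.

Lemma cmeasurable_translate k f : cmeasurable f -> cmeasurable (translate k f).
Proof. by move=> mf; apply: cmeasurable_comp => //; exact: measurable_translate. Qed.

Lemma cL2_translate k f : cL2 f -> cL2 (translate k f).
Proof.
by move=> [mf hf]; split; [exact: cmeasurable_translate|rewrite cLnorm_translate].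
Qed.

End ComplexL2.

(** * The Fourier transform of complex-valued functions *)

Section FourierL1.
Context {R : realType}.
Local Notation mu := (@lebesgue_measure R).
Local Notation Re := complex.Re.
Local Notation Im := complex.Im.
Local Notation N2 := (cLnorm 2%:E).
Implicit Types (f g h : R -> R[i]) (z w : R[i]).

Definition cintegrable f : Prop :=
  mu.-integrable setT (EFin \o (fun t => Re (f t))) /\
  mu.-integrable setT (EFin \o (fun t => Im (f t))).

Lemma cL1_cintegrable f : cL1 f -> cintegrable f.
Proof.
move=> [mf hf]; have [mr mi] := mf; rewrite cLnorm1E in hf.
have mc := measurable_cmod mf.
split; (apply: integrable_l1n; first by []); apply: le_lt_trans hf; apply: ge0_le_integral => //.
- exact: measurable_norm_EFin.
- exact/measurable_EFinP.
- by move=> t _; rewrite lee_fin Re_le_cmod.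
- exact: measurable_norm_EFin.
- exact/measurable_EFinP.
- by move=> t _; rewrite lee_fin Im_le_cmod.
Qed.

Lemma cL1D f g : cL1 f -> cL1 g -> cL1 (fun t => f t + g t).
Proof.
move=> [mf hf] [mg hg]; split; first exact: cmeasurableD.
have mcf := measurable_cmod mf; have mcg := measurable_cmod mg.
rewrite !cLnorm1E in hf hg *.
apply: (@le_lt_trans _ _ (\int[mu]_t ((cmod (f t))%:E + (cmod (g t))%:E))%E).
  apply: ge0_le_integral => //.
  - by move=> t _; rewrite lee_fin cmod_ge0.
  - by apply/measurable_EFinP; apply: measurable_cmod; exact: cmeasurableD.
  - by apply: emeasurable_funD; exact/measurable_EFinP.
  - by move=> t _; rewrite -EFinD lee_fin cmodD.
rewrite ge0_integralD//; first exact: lte_add_pinfty.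
- by move=> t _; rewrite lee_fin cmod_ge0.
- exact/measurable_EFinP.
- by move=> t _; rewrite lee_fin cmod_ge0.
- exact/measurable_EFinP.
Qed.

Lemma cL1Z z f : cL1 f -> cL1 (fun t => z * f t).
Proof.
move=> [mf hf]; split; first exact: cmeasurableZ.
have mcf := measurable_cmod mf; rewrite !cLnorm1E in hf *.
under eq_integral do rewrite cmodM EFinM.
rewrite ge0_integralZl//.
- by rewrite lte_mul_pinfty// lee_fin cmod_ge0.
- exact/measurable_EFinP.
- by move=> t _; rewrite lee_fin cmod_ge0.
- by rewrite lee_fin cmod_ge0.
Qed.

Lemma cL1_sum (I : Type) (s : seq I) (F : I -> R -> R[i]) :
  (forall i, cL1 (F i)) -> cL1 (fun t => \sum_(i <- s) F i t).
Proof.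
move=> mF; elim: s => [|i s IH].
  have -> : (fun t => \sum_(i <- [::]) F i t) = fun=> 0.
    by apply/funext => t; rewrite big_nil.
  split; first exact: cmeasurable_cst.
  by rewrite cLnorm1E; under eq_integral do rewrite cmod0; rewrite integral0.
have -> : (fun t => \sum_(j <- i :: s) F j t) = fun t => F i t + \sum_(j <- s) F j t.
  by apply/funext => t; rewrite big_cons.
exact: cL1D.
Qed.

Lemma cL1_translate k f : cL1 f -> cL1 (translate k f).
Proof.
move=> [mf hf]; split; first exact: cmeasurable_translate.
rewrite !cLnorm1E in hf *; rewrite /translate.
rewrite (@ge0_integral_translate R k%:~R (fun t => (cmod (f t))%:E))//.
- by apply/measurable_EFinP; exact: measurable_cmod.
- by move=> t; rewrite lee_fin cmod_ge0.
Qed.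

Lemma cintegralD f g : cintegrable f -> cintegrable g ->
  cintegral (fun t => f t + g t) = cintegral f + cintegral g.
Proof.
move=> [f1 f2] [g1 g2]; rewrite /cintegral.
have -> : (fun t => Re (f t + g t)) = fun t => Re (f t) + Re (g t).
  by apply/funext => t; case: (f t) (g t) => a b [].
have -> : (fun t => Im (f t + g t)) = fun t => Im (f t) + Im (g t).
  by apply/funext => t; case: (f t) (g t) => a b [].
by rewrite !RintegralD.
Qed.

Lemma cintegralZ z f : cintegrable f -> cintegral (fun t => z * f t) = z * cintegral f.
Proof.
move=> [f1 f2]; rewrite /cintegral; case: z => a b.
have -> : (fun t => Re ((a +i* b) * f t)) = fun t => a * Re (f t) - b * Im (f t).
  by apply/funext => t; case: (f t).
have -> : (fun t => Im ((a +i* b) * f t)) = fun t => a * Im (f t) + b * Re (f t).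
  by apply/funext => t; case: (f t).
have i1 k := integrableZ_EFin k measurableT f1.
have i2 k := integrableZ_EFin k measurableT f2.
by rewrite RintegralB// RintegralD// !RintegralZl.
Qed.

Lemma cintegrableZ z f : cintegrable f -> cintegrable (fun t => z * f t).
Proof.
move=> [f1 f2]; case: z => a b; split.
  have -> : (fun t => Re ((a +i* b) * f t)) = fun t => a * Re (f t) - b * Im (f t).
    by apply/funext => t; case: (f t).
  by apply: integrableB_EFin; exact: integrableZ_EFin.
have -> : (fun t => Im ((a +i* b) * f t)) = fun t => a * Im (f t) + b * Re (f t).
  by apply/funext => t; case: (f t).
by apply: integrableD_EFin; exact: integrableZ_EFin.
Qed.

Lemma cintegrable_cis f (y : R) : cintegrable f ->
  cintegrable (fun x => f x * cis (- (2 * pi * x * y))).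
Proof.
move=> [f1 f2]; split.
  have -> : (fun t => Re (f t * cis (- (2 * pi * t * y)))) = fun t =>
     Re (f t) * cos (2 * pi * t * y) + Im (f t) * sin (2 * pi * t * y).
    by apply/funext => t; case: (f t) => a b /=; rewrite cosN sinN mulrN opprK.
  exact: integrableD_EFin (integrable_cos _ f1) (integrable_sin _ f2).
have -> : (fun t => Im (f t * cis (- (2 * pi * t * y)))) = fun t =>
     Im (f t) * cos (2 * pi * t * y) - Re (f t) * sin (2 * pi * t * y).
  by apply/funext => t; case: (f t) => a b /=; rewrite cosN sinN mulrN addrC.
exact: integrableB_EFin (integrable_cos _ f2) (integrable_sin _ f1).
Qed.

Lemma fourierE f y : cintegrable f -> fourier f y =
  (costr (fun t => Re (f t)) y + sintr (fun t => Im (f t)) y) +i*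
  (costr (fun t => Im (f t)) y - sintr (fun t => Re (f t)) y).
Proof.
move=> [f1 f2]; rewrite /fourier /cintegral.
have -> : (fun t => Re (f t * cis (- (2 * pi * t * y)))) = fun t =>
     Re (f t) * cos (2 * pi * t * y) + Im (f t) * sin (2 * pi * t * y).
  by apply/funext => t; case: (f t) => a b /=; rewrite cosN sinN mulrN opprK.
have -> : (fun t => Im (f t * cis (- (2 * pi * t * y)))) = fun t =>
     Im (f t) * cos (2 * pi * t * y) - Re (f t) * sin (2 * pi * t * y).
  by apply/funext => t; case: (f t) => a b /=; rewrite cosN sinN mulrN addrC.
rewrite RintegralD//; [|exact: integrable_cos|exact: integrable_sin].
by rewrite RintegralB//; [exact: integrable_cos|exact: integrable_sin].
Qed.

Lemma cmeasurable_fourier f : cintegrable f -> cmeasurable (fourier f).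
Proof.
move=> intf; have [f1 f2] := intf; split.
  have -> : (fun y => Re (fourier f y)) = fun y =>
      costr (fun t => Re (f t)) y + sintr (fun t => Im (f t)) y.
    by apply/funext => y; rewrite fourierE.
  by apply: measurable_funD; [exact: measurable_costr|exact: measurable_sintr].
have -> : (fun y => Im (fourier f y)) = fun y =>
      costr (fun t => Im (f t)) y - sintr (fun t => Re (f t)) y.
  by apply/funext => y; rewrite fourierE.
by apply: measurable_funB; [exact: measurable_costr|exact: measurable_sintr].
Qed.

Lemma fourierD f g y : cintegrable f -> cintegrable g ->
  fourier (fun t => f t + g t) y = fourier f y + fourier g y.
Proof.
move=> intf intg; rewrite /fourier -cintegralD; try exact: cintegrable_cis.
by congr cintegral; apply/funext => t; rewrite mulrDl.
Qed.

Lemma fourierZ z f y : cintegrable f -> fourier (fun t => z * f t) y = z * fourier f y.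
Proof.
move=> intf; rewrite /fourier -cintegralZ; last exact: cintegrable_cis.
by congr cintegral; apply/funext => t; rewrite mulrA.
Qed.

Lemma fourier_sum (I : Type) (s : seq I) (F : I -> R -> R[i]) y :
  (forall i, cL1 (F i)) ->
  fourier (fun t => \sum_(i <- s) F i t) y = \sum_(i <- s) fourier (F i) y.
Proof.
move=> hF; elim: s => [|i s IH].
  rewrite big_nil; have -> : (fun t => \sum_(i <- [::]) F i t) = fun=> 0.
    by apply/funext => t; rewrite big_nil.
  rewrite /fourier /cintegral /Rintegral.
  under eq_integral do rewrite mul0r /=.
  under [X in _ +i* fine X]eq_integral do rewrite mul0r /=.
  by rewrite integral0.
have -> : (fun t => \sum_(j <- i :: s) F j t) = fun t => F i t + \sum_(j <- s) F j t.
  by apply/funext => t; rewrite big_cons.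
rewrite big_cons fourierD ?IH//; apply: cL1_cintegrable => //; exact: cL1_sum.
Qed.

Lemma cintegral_translate (u : R) f : cintegrable f ->
  cintegral (fun t => f (t + u)) = cintegral f.
Proof.
move=> [f1 f2]; rewrite /cintegral.
by rewrite (Rintegral_translate u f1) (Rintegral_translate u f2).
Qed.

Lemma fourier_translate k f y : cintegrable f ->
  fourier (translate k f) y = expchar k y * fourier f y.
Proof.
move=> intf; rewrite /fourier -cintegralZ; last exact: cintegrable_cis.
rewrite -[RHS](cintegral_translate k%:~R); last by apply: cintegrableZ; exact: cintegrable_cis.
congr cintegral; apply/funext => t; rewrite /translate mulrCA /expchar -cisD.
by congr (_ * cis _); ring.
Qed.

Lemma EFin_ge0_on (u : R -> R) : (forall y, 0 <= u y) ->
  forall y, [set: R] y -> (0 <= (u y)%:E)%E.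
Proof. by move=> u0 y _; rewrite lee_fin. Qed.

Lemma ge0_double_inj (p q : \bar R) : (0 <= p -> 0 <= q -> q < +oo ->
  p + p = q + q -> p = q)%E.
Proof.
case: p q => [p||] [q||]//= _ _ _; rewrite -!EFinD => -[h]; congr EFin; lra.
Qed.

(** In |F(y)|^2 + |F(-y)|^2, with F the transform of a + i b, the cross terms cancel and twice the
    sum of the energies of a and b remains. Since reflection preserves the integral, the real case
    suffices. *)
Lemma plancherel f : cL1 f -> cL2 f -> sqn (fourier f) = sqn f.
Proof.
move=> f1 f2; have intf := cL1_cintegrable f1; have [ir ii] := intf.
have /cL2_sqn[mf sf] := f2; have [mr mi] := mf.
pose a t := Re (f t); pose b t := Im (f t).
have sE : sqn f = (l2n a + l2n b)%E.
  rewrite /l2n -ge0_integralD//; first by apply: eq_integral => t _; rewrite cmod_sqr.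
  - by move=> t _; rewrite lee_fin sqr_ge0.
  - exact: measurable_sqr_EFin.
  - by move=> t _; rewrite lee_fin sqr_ge0.
  - exact: measurable_sqr_EFin.
have a2 : (l2n a < +oo)%E by apply: le_lt_trans sf; rewrite sE leeDl// l2n_ge0.
have b2 : (l2n b < +oo)%E by apply: le_lt_trans sf; rewrite sE leeDr// l2n_ge0.
have mfh := cmeasurable_fourier intf.
have refl : sqn (fourier f) = (\int[mu]_y (cmod (fourier f (- y)) ^+ 2)%:E)%E.
  rewrite /sqn (@ge0_integral_affine R (-1) 0 (fun y => (cmod (fourier f y) ^+ 2)%:E)).
  - rewrite normrN1 mul1e; apply: eq_integral => y _.
    by rewrite /affine mulN1r addr0.
  - by rewrite oppr_eq0 oner_eq0.
  - exact: measurable_cmod2.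
  - by move=> y; rewrite lee_fin sqr_ge0.
have mfN : cmeasurable (fun y => fourier f (- y)).
  by apply: cmeasurable_comp => //; exact: (measurable_funN (measurable_id)).
have ma : measurable_fun setT (fun y => (energy a y)%:E).
  by apply/measurable_EFinP; exact: measurable_energy.
have mb : measurable_fun setT (fun y => (energy b y)%:E).
  by apply/measurable_EFinP; exact: measurable_energy.
have sum2 : (sqn (fourier f) + sqn (fourier f) = sqn f + sqn f)%E.
  rewrite {2}refl sE -(plancherel_real ir a2) -(plancherel_real ii b2) /htn.
  have dbl (u v : R -> R) : (forall y, 0 <= u y) -> (forall y, 0 <= v y) ->
      measurable_fun setT (fun y => (u y)%:E) -> measurable_fun setT (fun y => (v y)%:E) ->
      (\int[mu]_y (u y)%:E + \int[mu]_y (v y)%:E = \int[mu]_y (u y + v y)%:E)%E.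
    move=> u0 v0 mu' mv; apply/esym.
    exact: (@ge0_integralD _ _ _ mu setT measurableT (fun y => (u y)%:E)
      (fun y => (v y)%:E) (EFin_ge0_on u0) mu' (EFin_ge0_on v0) mv).
  rewrite dbl; [|by move=> y; exact: sqr_ge0|by move=> y; exact: sqr_ge0
    |exact: measurable_cmod2|exact: measurable_cmod2].
  have mab := emeasurable_funD ma mb.
  have ab0 y : 0 <= energy a y + energy b y.
    exact: addr_ge0 (energy_ge0 a y) (energy_ge0 b y).
  rewrite (dbl (energy a) (energy b)); [|by move=> y; exact: energy_ge0|by move=> y; exact: energy_ge0
    |exact: ma|exact: mb].
  rewrite (dbl (fun y => energy a y + energy b y)); [|exact: ab0|exact: ab0|exact: mab|exact: mab].
  apply: eq_integral => y _; congr EFin.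
  have cN u : costr u (- y) = costr u y.
    by apply: eq_Rintegral => t _; rewrite mulrN cosN.
  have sN u : mu.-integrable setT (EFin \o u) -> sintr u (- y) = - sintr u y.
    move=> iu; rewrite -[RHS]mulN1r /sintr -RintegralZl;
      [|exact: measurableT|exact: integrable_sin].
    by apply: eq_Rintegral => t _; rewrite mulrN sinN; ring.
  rewrite (fourierE y intf) (fourierE (- y) intf) !cmod_sqr /= !cN (sN _ ir) (sN _ ii) /energy.
  by ring.
exact: (ge0_double_inj (sqn_ge0 _) (sqn_ge0 _) sf sum2).
Qed.

Lemma fourierL2_isometry f g : fourierL2 f g -> N2 f = N2 g.
Proof.
move=> [[mf f2] [mg g2] h].
suff key (e : R) : 0 < e -> (N2 f <= N2 g + e%:E)%E /\ (N2 g <= N2 f + e%:E)%E.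
  by apply/eqP; rewrite eq_le; apply/andP; split; apply/lee_addgt0Pr => e /key[].
move=> e0; have e2 : 0 < e / 2 by rewrite divr_gt0.
have [k [k1 k2 fk gk]] := h _ e2.
have mk := k2.1; have mkh := cmeasurable_fourier (cL1_cintegrable k1).
have E := eq_sqn_cLnorm (plancherel k1 k2).
have half : (e%:E = (e / 2)%:E + (e / 2)%:E)%E by rewrite -EFinD; congr EFin; lra.
have tri u v : cmeasurable u -> cmeasurable v -> (L2dist u v < (e / 2)%:E)%E ->
    (N2 u <= N2 v + (e / 2)%:E)%E.
  move=> mu' mv uv; have -> : u = fun t => v t + (u t - v t).
    by apply/funext => t; ring.
  apply: (le_trans (cLnormD mv (cmeasurableB mu' mv))).
  by rewrite leeD2l// ltW.
have sym u v : L2dist u v = L2dist v u by exact: cLnormB_sym.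
rewrite half !addeA; split.
  apply: (le_trans (tri _ _ mf mk fk)); rewrite leeD2r// -E.
  by apply: tri => //; rewrite sym.
apply: (le_trans (tri _ _ mg mkh gk)); rewrite leeD2r// E.
by apply: tri => //; rewrite sym.
Qed.

(** The transform of [f] is known only through the closed graph. Adding multiples of [f] to a
    function [h] with an explicit transform lets the isometry be polarized in [fourierL2_inner]. *)
Lemma fourierL2_add w h f g : cL1 h -> cL2 h -> fourierL2 f g ->
  fourierL2 (fun t => h t + w * f t) (fun t => fourier h t + w * g t).
Proof.
move=> h1 h2 [f2 g2 hfg]; have ih := cL1_cintegrable h1.
have hh2 : cL2 (fourier h).
  apply/cL2_sqn; split; first exact: cmeasurable_fourier.
  by rewrite plancherel//; have /cL2_sqn[] := h2.
split; first by apply: cL2D => //; exact: cL2Z.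
  by apply: cL2D => //; exact: cL2Z.
move=> e e0; have d0 : 0 < e / (cmod w + 1) by rewrite divr_gt0// ltr_wpDl// cmod_ge0.
have [k [k1 k2 fk gk]] := hfg _ d0.
have ik := cL1_cintegrable k1.
exists (fun t => h t + w * k t); split.
- by apply: cL1D => //; exact: cL1Z.
- by apply: cL2D => //; exact: cL2Z.
- have -> : L2dist (fun t => h t + w * f t) (fun t => h t + w * k t) =
     ((cmod w)%:E * L2dist f k)%E.
    rewrite /L2dist -cLnormZ; last by apply: cmeasurableB; [exact: f2.1|exact: k2.1].
    by congr (cLnorm _ _); apply/funext => t; ring.
  apply: (@le_lt_trans _ _ ((cmod w)%:E * (e / (cmod w + 1))%:E)%E).
    by apply: lee_wpmul2l; [rewrite lee_fin cmod_ge0|exact: ltW].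
  rewrite -EFinM lte_fin mulrCA gtr_pMr// ltr_pdivrMr ?mul1r ?ltrDl//.
  by rewrite ltr_wpDl// cmod_ge0.
- have -> : L2dist (fun t => fourier h t + w * g t) (fourier (fun t => h t + w * k t)) =
     ((cmod w)%:E * L2dist g (fourier k))%E.
    rewrite /L2dist -cLnormZ; last first.
      by apply: cmeasurableB; [exact: g2.1|exact: cmeasurable_fourier].
    congr (cLnorm _ _); apply/funext => t.
    by rewrite fourierD// ?fourierZ//; [ring|exact: cintegrableZ].
  apply: (@le_lt_trans _ _ ((cmod w)%:E * (e / (cmod w + 1))%:E)%E).
    by apply: lee_wpmul2l; [rewrite lee_fin cmod_ge0|exact: ltW].
  rewrite -EFinM lte_fin mulrCA gtr_pMr// ltr_pdivrMr ?mul1r ?ltrDl//.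
  by rewrite ltr_wpDl// cmod_ge0.
Qed.

End FourierL1.

(** * Shift-invariant spaces *)

Section Periodization.
Context {R : realType}.
Local Notation mu := (@lebesgue_measure R).
Implicit Types (phi m : R -> R[i]).

Lemma esum_intE (a : int -> \bar R) : (forall k, 0 <= a k)%E ->
  (\esum_(k in [set: int]) a k = \sum_(0 <= n <oo) a (int_of_natb n))%E.
Proof.
move=> a0; rewrite nneseries_esumT// (reindex_esum setT setT int_of_natb)//.
exact: int_of_natb_bij.
Qed.

Lemma Phi_periodic phi t (j : int) : Phi phi (t + j%:~R) = Phi phi t.
Proof.
rewrite /Phi [RHS](reindex_esum setT setT (fun k : int => j + k)).
  by apply: eq_esum => k _; rewrite rmorphD /= addrA.
split => // [k l _ _ /addrI //|k _]; exists (k - j) => //; rewrite addrC subrK//.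
Qed.

Lemma sqn_fourier_periodic phi m : cintegrable phi -> cmeasurable m ->
  (forall t (k : int), m (t + k%:~R) = m t) ->
  sqn (fun t => m t * fourier phi t) =
  (\int[mu]_(t in `[0%R, 1%R[) ((cmod (m t) ^+ 2)%:E * Phi phi t))%E.
Proof.
move=> iphi mm per; rewrite /sqn ge0_integral_periodize; last 2 first.
- by apply: measurable_cmod2; apply: cmeasurableM => //; exact: cmeasurable_fourier.
- by move=> t; rewrite lee_fin sqr_ge0.
apply: eq_integral => t _; rewrite /Phi !esum_intE; last 2 first.
- by move=> k; rewrite lee_fin sqr_ge0.
- by move=> k; rewrite lee_fin sqr_ge0.
rewrite -nneseriesZl; last by move=> n _; rewrite lee_fin sqr_ge0.
by apply: eq_eseriesr => n _; rewrite -EFinM per cmodM exprMn.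
Qed.

End Periodization.

(** * Orthogonality of characters and Parseval's formula on a period *)

Section UnitInterval.
Context {R : realType}.
Local Notation mu := (@lebesgue_measure R).
Local Notation I01 := (`[0%R, 1%R[%classic : set R).
Local Notation Re := complex.Re.
Local Notation Im := complex.Im.

Lemma integrable01 (g : R -> R) : continuous g -> mu.-integrable I01 (EFin \o g).
Proof.
move=> cg; have : mu.-integrable `[0%R, 1%R]%classic (EFin \o g).
  apply: continuous_compact_integrable; first exact: segment_compact.
  exact: continuous_subspaceT.
by apply: integrableS => // t /=; rewrite !in_itv /= => /andP[-> /ltW ->].
Qed.

Lemma Rintegral01_FTC (g G : R -> R) : continuous g ->
  (forall t : R, is_derive t 1 G (g t)) -> \int[mu]_(t in I01) g t = G 1 - G 0.
Proof.
move=> cg dG; rewrite Rintegral_itv_bndo_bndc; last exact: integrable01.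
have cG : continuous G by move=> t; apply: derivable_continuous_at; exact: ex_derive.
rewrite /Rintegral (@continuous_FTC2 _ g G)//.
- exact: continuous_subspaceT.
- split; first by move=> t _; exact: ex_derive.
    by apply: cvg_at_right_filter; exact: cG.
  by apply: cvg_at_left_filter; exact: cG.
- by move=> t _; rewrite derive1E derive_val.
Qed.

Lemma continuous_Re_expchar (c : R[i]) k :
  continuous (fun t => Re (c * expchar k t)) /\ continuous (fun t => Im (c * expchar k t)).
Proof.
split => t; apply: derivable_continuous_at.
  have [h _] := is_derive_trig_poly [:: k] (fun=> c) t.
  rewrite (_ : (fun t => _) = fun u => Re (trig_poly [:: k] (fun=> c) u)); first exact: ex_derive.
  by apply/funext => u; rewrite /trig_poly big_seq1.
have [_ h] := is_derive_trig_poly [:: k] (fun=> c) t.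
rewrite (_ : (fun t => _) = fun u => Im (trig_poly [:: k] (fun=> c) u)); first exact: ex_derive.
by apply/funext => u; rewrite /trig_poly big_seq1.
Qed.

Lemma continuous_Re_trig_poly (s : seq int) (c : int -> R[i]) :
  continuous (fun t => Re (trig_poly s c t)) /\ continuous (fun t => Im (trig_poly s c t)).
Proof.
split => t; apply: derivable_continuous_at.
  by have [h _] := is_derive_trig_poly s c t; exact: ex_derive.
by have [_ h] := is_derive_trig_poly s c t; exact: ex_derive.
Qed.

Lemma Rintegral01_expchar (c : R[i]) k :
  \int[mu]_(t in I01) Re (c * expchar k t) = if k == 0 then Re c else 0.
Proof.
have [cr _] := continuous_Re_expchar c k.
case: eqVneq => [->|k0].
  have dG (t : R) : is_derive t 1 (fun t => Re c * t) (Re (c * expchar 0 t)).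
    by apply: is_derive_eq; rewrite expchar0 mulr1 /GRing.scale /=; ring.
  have [c0 _] := continuous_Re_expchar c 0.
  by rewrite (Rintegral01_FTC c0 dG) mulr1 mulr0 subr0.
have f0 : freq k != 0 :> R[i].
  apply/eqP => -[] /eqP; rewrite !mulf_eq0 pnatr_eq0 intr_eq0 (negbTE k0) orbF /=.
  by rewrite gt_eqF// pi_gt0.
have dG (t : R) : is_derive t 1 (fun t => Re ((freq k)^-1 * c * expchar k t))
    (Re (c * expchar k t)).
  have [h _] := is_derive_trig_poly [:: k] (fun=> (freq k)^-1 * c) t.
  move: h; rewrite /trig_poly big_seq1 mulrA mulfV// mul1r.
  by under [X in is_derive _ _ X _]eq_fun do rewrite big_seq1.
rewrite (Rintegral01_FTC cr dG) [expchar k 1](_ : _ = expchar k 0) ?subrr//.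
by rewrite -[in RHS](expchar_periodic k 0 1) add0r.
Qed.

Lemma Rintegral01_sum (J : Type) (s : seq J) (c : J -> R[i]) (k : J -> int) :
  \int[mu]_(t in I01) Re (\sum_(j <- s) c j * expchar (k j) t) =
  Re (\sum_(j <- s | k j == 0) c j).
Proof.
elim: s => [|j s IH].
  rewrite big_nil /=; rewrite /Rintegral; under eq_integral do rewrite big_nil /=.
  by rewrite integral0.
transitivity (\int[mu]_(t in I01) (Re (c j * expchar (k j) t) +
    Re (\sum_(j <- s) c j * expchar (k j) t))).
  by apply: eq_Rintegral => t _; rewrite big_cons; case: (_ * _) (\sum_(_ <- _) _) => a b [].
have cs : continuous (fun t => Re (\sum_(j <- s) c j * expchar (k j) t)).
  move=> t; elim: s {IH} => [|i s IH].
    by under eq_fun do rewrite big_nil; exact: cvg_cst.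
  rewrite /continuous_at; under eq_fun do rewrite big_cons.
  rewrite (_ : (fun u => _) = fun u => Re (c i * expchar (k i) u) +
     Re (\sum_(j <- s) c j * expchar (k j) u)); last first.
    by apply/funext => u; case: (_ * _) (\sum_(_ <- _) _) => a b [].
  rewrite big_cons.
  have -> : Re (c i * expchar (k i) t + \sum_(j0 <- s) c j0 * expchar (k j0) t) =
     Re (c i * expchar (k i) t) + Re (\sum_(j <- s) c j * expchar (k j) t).
    by case: (_ * _) (\sum_(_ <- _) _) => a b [].
  by apply: cvgD => //; have [h _] := continuous_Re_expchar (c i) (k i); exact: h.
rewrite RintegralD//; last 2 first.
- by apply: integrable01; have [] := continuous_Re_expchar (c j) (k j).
- exact: integrable01.
rewrite IH Rintegral01_expchar big_cons; case: ifP => _; last by rewrite add0r.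
by case: (c j) (\sum_(_ <- _ | _) _) => a b [].
Qed.

Lemma Re_sum (J : Type) (s : seq J) (F : J -> R[i]) :
  Re (\sum_(j <- s) F j) = \sum_(j <- s) Re (F j).
Proof. by apply: (big_morph (@complex.Re R)) => // -[? ?] [? ?]. Qed.

Lemma cmod2_Re (z : R[i]) : cmod z ^+ 2 = Re (z * z^*).
Proof. by rewrite cmod_sqr; case: z => a b /=; ring. Qed.

Lemma parseval_trig_poly (s : seq int) (d : int -> R[i]) : uniq s ->
  \int[mu]_(t in I01) (cmod (trig_poly s d t) ^+ 2) = \sum_(n <- s) cmod (d n) ^+ 2.
Proof.
move=> us.
pose ps := [seq (n, k) | n <- s, k <- s].
transitivity (\int[mu]_(t in I01) Re (\sum_(p <- ps) (d p.1 * (d p.2)^*) * expchar (p.1 - p.2) t)).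
  apply: eq_Rintegral => t _; rewrite cmod2_Re /trig_poly rmorph_sum big_distrl /=.
  congr Re; rewrite big_allpairs; apply: eq_bigr => n _; rewrite big_distrr /=.
  by apply: eq_bigr => k _; rewrite expcharD expcharN rmorphM mulrACA.
rewrite Rintegral01_sum big_mkcond big_allpairs Re_sum.
apply: eq_big_seq => n ns; rewrite cmod2_Re; congr Re.
rewrite (bigD1_seq n)//= subrr eqxx big1 ?addr0// => k kn.
by rewrite subr_eq0 eq_sym (negbTE kn).
Qed.

End UnitInterval.

(** * Comparison of the norm of a combination with its differences *)

Section NormEquivalence.
Context {R : realType}.
Local Notation mu := (@lebesgue_measure R).
Local Notation I01 := (`[0%R, 1%R[%classic : set R).
Local Notation Re := complex.Re.
Local Notation Im := complex.Im.
Implicit Types (b : int -> R[i]) (lo : int) (n : nat).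

Definition supported b lo n := forall k, k \notin consecutive lo n -> b k = 0.

Lemma big_consecutive (T : Type) (idx : T) (op : T -> T -> T) lo n (F : int -> T) :
  \big[op/idx]_(k <- consecutive lo n) F k = \big[op/idx]_(i < n) F (lo + (i : nat)%:Z).
Proof.
rewrite /consecutive big_map.
have -> : iota 0 n = index_iota 0 n by rewrite /index_iota subn0.
by rewrite big_mkord.
Qed.

Lemma uniq_consecutive lo n : uniq (consecutive lo n).
Proof.
have inj : injective (fun i : nat => lo + i%:Z) by move=> i i' /addrI [].
by rewrite /consecutive (map_inj_uniq inj) iota_uniq.
Qed.

Lemma zdiff_supported w b lo n : supported b lo n -> supported (zdiff w b) (lo - 1) n.+1.
Proof.
move=> sb k; rewrite mem_consecutive => kn; rewrite /zdiff !sb ?mulr0 ?subr0//.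
  by rewrite mem_consecutive; lia.
by rewrite mem_consecutive; lia.
Qed.

(** Lowering the index of the coefficients by one multiplies the series by the conjugate of
    [expchar 1]. The frequency range gains one place on the left to hold the shifted support. *)
Lemma zdiff_trig_poly w b lo n t : supported b lo n ->
  trig_poly (consecutive (lo - 1) n.+1) (zdiff w b) t =
  ((expchar 1 t)^*%C - w) * trig_poly (consecutive lo n) b t.
Proof.
move=> sb; rewrite /trig_poly !big_consecutive.
transitivity (\sum_(i < n.+1) b (lo + (i : nat)%:Z) * expchar (lo + (i : nat)%:Z) t * (expchar 1 t)^*%C -
   w * \sum_(i < n.+1) b (lo - 1 + (i : nat)%:Z) * expchar (lo - 1 + (i : nat)%:Z) t).
  rewrite mulr_sumr -sumrB; apply: eq_bigr => i _; rewrite /zdiff mulrBl.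
  rewrite (_ : lo - 1 + _ + 1 = lo + (i : nat)%:Z); last by lia.
  congr (_ - _); last by rewrite mulrA.
  by rewrite -mulrA -expcharN -expcharD; congr (_ * expchar _ _); lia.
rewrite big_ord_recr /= [b (lo + n%:Z)]sb ?mul0r ?addr0; last by rewrite mem_consecutive; lia.
rewrite big_ord_recl /= [b (lo - 1 + 0)]sb ?mul0r ?add0r; last by rewrite mem_consecutive; lia.
rewrite mulrBl; congr (_ - _); first by rewrite -mulr_suml mulrC.
congr (_ * _); apply: eq_bigr => i _; rewrite /bump /=.
by rewrite (_ : lo - 1 + _ = lo + (i : nat)%:Z)//; lia.
Qed.

Lemma zdiffs_trig_poly ws b lo n t : supported b lo n ->
  trig_poly (consecutive (lo - (size ws)%:Z) (n + size ws)) (zdiffs ws b) t =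
  \prod_(w <- ws) ((expchar 1 t)^*%C - w) * trig_poly (consecutive lo n) b t.
Proof.
elim: ws b lo n => [|w ws IH] b lo n sb.
  by rewrite big_nil mul1r subr0 addn0.
have := IH _ _ _ (zdiff_supported w sb).
rewrite zdiff_trig_poly// big_cons mulrCA mulrA => <- /=.
by congr (trig_poly (consecutive _ _) _ _); lia.
Qed.

Variables (phi : R -> R[i]) (s : nat) (x : 'I_s -> R) (lam : 'I_s -> nat) (P : R -> R).
Hypotheses (phi1 : cL1 phi) (phi2 : cL2 phi).
Hypotheses (P_trig : is_trig_poly P) (P_gt0 : forall t, 0 < P t).
Hypothesis Phi_factor : forall t, Phi phi t = (`|omega x lam t| ^+ 2 * P t)%:E.

Definition comb (sq : seq int) (b : int -> R[i]) : R -> R[i] :=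
  fun y => \sum_(k <- sq) b k * translate k phi y.

Lemma cL1_comb sq b : cL1 (comb sq b).
Proof. by apply: cL1_sum => k; apply: cL1Z; exact: cL1_translate. Qed.

Lemma cL2_comb sq b : cL2 (comb sq b).
Proof. by apply: cL2_sum => k; apply: cL2Z; exact: cL2_translate. Qed.

Lemma fourier_comb sq b t : fourier (comb sq b) t = trig_poly sq b t * fourier phi t.
Proof.
rewrite /comb fourier_sum => [|k]; last by apply: cL1Z; exact: cL1_translate.
rewrite /trig_poly mulr_suml; apply: eq_bigr => k _.
rewrite fourierZ; last by apply: cL1_cintegrable; exact: cL1_translate.
by rewrite fourier_translate ?mulrA//; exact: cL1_cintegrable.
Qed.

Lemma trig_poly_periodic (sq : seq int) b t (k : int) :
  trig_poly sq b (t + k%:~R) = trig_poly sq b t.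
Proof. by apply: eq_bigr => j _; rewrite expchar_periodic. Qed.

Lemma continuous_P : continuous P.
Proof.
have [sq [d PE]] := P_trig.
have -> : P = fun t => Re (trig_poly sq d t) by apply/funext => t; rewrite -PE.
by have [] := continuous_Re_trig_poly sq d.
Qed.

Lemma P_bounds : exists p : R * R, 0 < p.1 /\ forall t, 0 <= t <= 1 -> p.1 <= P t <= p.2.
Proof.
have cP : {within `[0, 1], continuous P}.
  by apply: continuous_subspaceT; exact: continuous_P.
have [u _ uP] := EVT_min (ler01 : 0 <= 1 :> R) cP.
have [v _ vP] := EVT_max (ler01 : 0 <= 1 :> R) cP.
by exists (P u, P v); split => /= [|t t01]; [exact: P_gt0|rewrite uP ?vP// in_itv].
Qed.

(** By Plancherel and periodization the norm is the integral of |b|^2 |omega|^2 P; the factor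
    |omega|^2 is 4^-L times the squared modulus of the symbol of D and is absorbed into D b. The
    remaining weight has no zeros. *)
Lemma sqn_comb b lo n : supported b lo n ->
  sqn (comb (consecutive lo n) b) =
  (\int[mu]_(t in I01) (4^-1 ^+ (\sum_(j < s) lam j) * P t *
     cmod (trig_poly (consecutive (lo - (\sum_(j < s) lam j)%N%:Z) (n + \sum_(j < s) lam j))
       (zdiffs (map conjc (nodes x lam)) b) t) ^+ 2)%:E)%E.
Proof.
move=> sb; rewrite -plancherel; [|exact: cL1_comb|exact: cL2_comb].
have -> : fourier (comb (consecutive lo n) b) = fun t => trig_poly (consecutive lo n) b t * fourier phi t.
  by apply/funext => t; exact: fourier_comb.
rewrite sqn_fourier_periodic; last 3 first.
- exact: cL1_cintegrable.
- exact: cmeasurable_trig_poly.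
- exact: trig_poly_periodic.
apply: eq_integral => t _; rewrite Phi_factor -EFinM; congr EFin.
have := @zdiffs_trig_poly (map conjc (nodes x lam)) b lo n t sb.
rewrite size_map size_nodes => ->; rewrite cmodM exprMn.
have -> : cmod (\prod_(w <- map conjc (nodes x lam)) ((expchar 1 t)^*%C - w)) ^+ 2 =
    4 ^+ (\sum_(j < s) lam j) * `|omega x lam t| ^+ 2.
  rewrite -prod_cmod_nodes big_map; elim: (nodes x lam) => [|z zs IH].
    by rewrite !big_nil /cmod ComplexField.Normc.normc1 expr1n.
  by rewrite !big_cons cmodM exprMn IH -rmorphB cmod_conj.
set L := (\sum_(j < s) lam j)%N.
have e4 : 4^-1 ^+ L * 4 ^+ L = 1 :> R by rewrite -exprMn mulVf ?expr1n// pnatr_eq0.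
move: (4^-1 ^+ L) (4 ^+ L) (cmod _ ^+ 2) (`|_| ^+ 2) (P t) e4 => u v A B p e4.
have -> : u * p * (v * B * A) = (u * v) * (A * (B * p)) by ring.
by rewrite e4 mul1r.
Qed.

Definition zdiff_norm b lo n : R :=
  \sum_(k <- consecutive (lo - (\sum_(j < s) lam j)%N%:Z) (n + \sum_(j < s) lam j))
    cmod (zdiffs (map conjc (nodes x lam)) b k) ^+ 2.

Lemma sqn_comb_equiv : exists C : R, 0 < C /\ forall b lo n, supported b lo n ->
  (sqn (comb (consecutive lo n) b) <= (C * zdiff_norm b lo n)%:E)%E /\
  ((zdiff_norm b lo n)%:E <= C%:E * sqn (comb (consecutive lo n) b))%E.
Proof.
have [[p0 p1] [/= p00 pP]] := P_bounds.
have p10 : 0 < p1.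
  have h01 : 0 <= (0 : R) <= 1 by rewrite lexx ler01.
  by have /andP[h1 h2] := pP 0 h01; exact: lt_le_trans p00 (le_trans h1 h2).
set L := (\sum_(j < s) lam j)%N.
set q := 4^-1 ^+ L : R; have q0 : 0 < q by rewrite exprn_gt0.
(* One summand serves the upper estimate, the other the lower; both are positive, so their sum
   serves both. *)
exists (q * p1 + (q * p0)^-1); split.
  by rewrite addr_gt0 ?invr_gt0 ?mulr_gt0.
move=> b lo n sb; rewrite /zdiff_norm sqn_comb// -/L -/q.
set d := zdiffs _ b; set W := consecutive _ _; set S := \sum_(k <- W) _.
have S0 : 0 <= S by apply: sumr_ge0 => k _; exact: sqr_ge0.
have cm2 : continuous (fun t => cmod (trig_poly W d t) ^+ 2).
  have [cr ci] := continuous_Re_trig_poly W d.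
  have -> : (fun t => cmod (trig_poly W d t) ^+ 2) = fun t =>
     Re (trig_poly W d t) * Re (trig_poly W d t) + Im (trig_poly W d t) * Im (trig_poly W d t).
    by apply/funext => t; rewrite cmod_sqr !expr2.
  by move=> t; apply: cvgD; apply: cvgM; [exact: cr|exact: cr|exact: ci|exact: ci].
have ic := integrable01 cm2.
have par : (\int[mu]_(t in I01) (cmod (trig_poly W d t) ^+ 2)%:E = S%:E)%E.
  rewrite -(fineK (integrable_fin_num _ ic))//; congr EFin.
  by rewrite -[LHS]/(\int[mu]_(t in I01) (cmod (trig_poly W d t) ^+ 2)) parseval_trig_poly// uniq_consecutive.
have mcm : measurable_fun I01 (fun t => (cmod (trig_poly W d t) ^+ 2)%:E).
  by apply: measurable_int ic.
have mPc : measurable_fun I01 (fun t => (q * P t * cmod (trig_poly W d t) ^+ 2)%:E).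
  apply/measurable_EFinP; apply: measurable_funTS; apply: continuous_measurable_fun => t.
  apply: cvgM; last exact: cm2.
  by apply: cvgMl_tmp; exact: continuous_P.
have sq0 t : 0 <= cmod (trig_poly W d t) ^+ 2 by exact: sqr_ge0.
have Pt t : I01 t -> p0 <= P t <= p1.
  by rewrite /= in_itv /= => /andP[t0 /ltW t1]; apply: pP; rewrite t0.
have up : (\int[mu]_(t in I01) (q * P t * cmod (trig_poly W d t) ^+ 2)%:E <= (q * p1 * S)%:E)%E.
  rewrite EFinM -par -ge0_integralZl//; last 2 first.
  - by move=> t _; rewrite lee_fin.
  - by rewrite lee_fin mulr_ge0// ltW.
  apply: ge0_le_integral => //.
  - by move=> t _; rewrite lee_fin mulr_ge0// mulr_ge0// ltW.
  - exact: measurable_funeM.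
  - move=> t /Pt/andP[_ h]; rewrite -EFinM lee_fin ler_wpM2r// ler_wpM2l//; exact: ltW.
have low : ((q * p0 * S)%:E <= \int[mu]_(t in I01) (q * P t * cmod (trig_poly W d t) ^+ 2)%:E)%E.
  rewrite EFinM -par -ge0_integralZl//; last 2 first.
  - by move=> t _; rewrite lee_fin.
  - by rewrite lee_fin mulr_ge0// ltW.
  apply: ge0_le_integral => //.
  - by move=> t _; rewrite -EFinM lee_fin mulr_ge0// mulr_ge0// ltW.
  - exact: measurable_funeM.
  - move=> t /Pt/andP[h _]; rewrite -EFinM lee_fin ler_wpM2r// ler_wpM2l//; exact: ltW.
have i0 : 0 <= (q * p0)^-1 by rewrite invr_ge0 mulr_ge0// ltW.
split.
  by apply: (le_trans up); rewrite lee_fin ler_wpM2r// lerDl.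
apply: (@le_trans _ _ ((q * p0)^-1%:E * (q * p0 * S)%:E)%E).
  by rewrite -EFinM mulrA mulVf ?mul1r// gt_eqF// mulr_gt0.
apply: (le_trans (lee_wpmul2l _ low)); first by rewrite lee_fin.
apply: lee_wpmul2r; last by rewrite lee_fin lerDr mulr_ge0// ltW.
by apply: integral_ge0 => t _; rewrite lee_fin mulr_ge0// mulr_ge0// ltW.
Qed.

End NormEquivalence.

(** * Inner products with the dual functions *)

Section Biorthogonality.
Context {R : realType}.
Local Notation mu := (@lebesgue_measure R).
Local Notation I01 := (`[0%R, 1%R[%classic : set R).
Local Notation Re := complex.Re.
Local Notation Im := complex.Im.

Lemma measurable_invr : measurable_fun setT (fun t : R => t^-1).
Proof.
have -> : [set: R] = [set~ 0] `|` [set 0] by rewrite setUC setUv.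
apply/measurable_funU => //; first exact: measurableC.
split; last exact: measurable_fun_set1.
apply: open_continuous_measurable_fun.
  by rewrite openC; exact: closed_eq.
by move=> t; rewrite inE /= => /eqP t0; exact: inv_continuous.
Qed.

Lemma polarization (p q : R[i]) :
  cmod (p + q) ^+ 2 - cmod (p - q) ^+ 2 = 4 * Re (p * q^*%C).
Proof. by rewrite !cmod_sqr; case: p q => a b [c d] /=; ring. Qed.

Lemma trig_poly_inner (sq sq2 : seq int) (b e : int -> R[i]) (w : R[i]) :
  uniq sq -> (forall k, k \notin sq -> b k = 0) ->
  \int[mu]_(t in I01) Re (trig_poly sq b t * (w * trig_poly sq2 e t)^*%C) =
  Re (w^*%C * \sum_(l <- sq2) b l * (e l)^*%C).
Proof.
move=> usq b0.
transitivity (\int[mu]_(t in I01) Re (\sum_(p <- [seq (l, k) | l <- sq2, k <- sq])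
   (w^*%C * (b p.2 * (e p.1)^*%C)) * expchar (p.2 - p.1) t)).
  apply: eq_Rintegral => t _; congr Re; rewrite big_allpairs.
  have -> : (w * trig_poly sq2 e t)^*%C = w^*%C * \sum_(l <- sq2) (e l * expchar l t)^*%C.
    by rewrite rmorphM rmorph_sum.
  rewrite mulrCA [X in _ * X]mulrC mulr_suml mulr_sumr; apply: eq_bigr => l _.
  rewrite /trig_poly !mulr_sumr; apply: eq_bigr => k _.
  have -> : (e l * expchar l t)^*%C = (e l)^*%C * (expchar l t)^*%C by exact: rmorphM.
  rewrite expcharD expcharN.
  by move: (expchar k t) (conjc (expchar l t)) (conjc w) (conjc (e l)) => u v p q; ring.
rewrite Rintegral01_sum big_mkcond big_allpairs big_distrr /=; congr Re.
apply: eq_bigr => l _.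
case: (boolP (l \in sq)) => lsq; last first.
  rewrite b0// mul0r mulr0 big1_seq// => k /andP[_ ksq].
  by rewrite subr_eq0; case: eqP => // kl; rewrite kl (negbTE lsq) in ksq.
rewrite (bigD1_seq l)//= subrr eqxx big1 ?addr0// => k kl.
by rewrite subr_eq0 (negbTE kl).
Qed.

Variables (phi : R -> R[i]) (Psi : R -> R).
Hypotheses (phi1 : cL1 phi) (phi2 : cL2 phi).
Hypothesis PsiE : forall t, Phi phi t = (Psi t)%:E.
Hypothesis mPsi : measurable_fun setT Psi.
Hypothesis Psi0 : countable [set t | Psi t = 0].

(** The isometry is applied to f + w eta and f - w eta, and the difference of the squared norms is
    four times the real inner product. After periodization the weight [Psi] cancels its inverse in
    the cross term, leaving trigonometric polynomials. *)
Lemma fourierL2_inner (sq sq2 : seq int) (a e : int -> R[i]) (eta : R -> R[i]) (w : R[i]) :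
  fourierL2 eta (fun t => fourier phi t * ((fine (Phi phi t))^-1)%:C * trig_poly sq2 e t) ->
  \int[mu]_t Re (comb phi sq a t * (w * eta t)^*%C) =
  \int[mu]_(t in I01) Re (trig_poly sq a t * (w * trig_poly sq2 e t)^*%C).
Proof.
move=> Feta; have [eta2 _ _] := Feta.
have iphi := cL1_cintegrable phi1.
have f1 := cL1_comb phi1 sq a; have f2 := cL2_comb phi2 sq a.
set f := comb phi sq a in f1 f2 *.
pose v t := ((Psi t)^-1)%:C * trig_poly sq2 e t.
have mI : measurable_fun setT (fun t => (Psi t)^-1).
  exact: (measurableT_comp measurable_invr mPsi).
have mv : cmeasurable v.
  apply: cmeasurableM; last exact: cmeasurable_trig_poly.
  by split => //=; exact: measurable_cst.
have mtr := cmeasurable_trig_poly sq a.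
have Psi_per t (k : int) : Psi (t + k%:~R) = Psi t.
  by apply: EFin_inj; rewrite -!PsiE Phi_periodic.
pose m z t := trig_poly sq a t + z * v t.
have mm z : cmeasurable (m z) by apply: cmeasurableD => //; exact: cmeasurableZ.
pose G z t := cmod (m z t) ^+ 2 * Psi t.
have sG z : sqn (fun t => f t + z * eta t) = (\int[mu]_(t in I01) (G z t)%:E)%E.
  have := fourierL2_isometry (fourierL2_add z f1 f2 Feta).
  rewrite sqn_cLnorm => ->; rewrite -sqn_cLnorm.
  rewrite (_ : (fun t => fourier f t + _) = fun t => m z t * fourier phi t).
    rewrite sqn_fourier_periodic//.
      by apply: eq_integral => t _; rewrite PsiE -EFinM.
    by move=> t k; rewrite /m /v Psi_per !trig_poly_periodic.
  apply/funext => t; rewrite fourier_comb// /m /v PsiE /=; ring.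
have L2z z : cL2 (fun t => f t + z * eta t) by apply: cL2D => //; exact: cL2Z.
have fin z : sqn (fun t => f t + z * eta t) \is a fin_num.
  by rewrite ge0_fin_numE ?sqn_ge0//; have /cL2_sqn[] := L2z z.
have Psi_ge0 t : 0 <= Psi t.
  rewrite -lee_fin -PsiE; apply: esum_ge0 => k _; by rewrite lee_fin sqr_ge0.
have mG z : measurable_fun setT (G z).
  by apply: measurable_funM => //; apply: measurable_funX; exact: measurable_cmod.
have iG z : mu.-integrable I01 (EFin \o G z).
  apply/integrableP; split.
    by apply: measurable_funTS; apply/measurable_EFinP; exact: mG.
  rewrite (_ : (\int[mu]_(t in I01) _)%E = sqn (fun t => f t + z * eta t)).
    by rewrite ltey_eq fin.
  by rewrite sG; apply: eq_integral => t _ /=; rewrite ger0_norm// mulr_ge0// sqr_ge0.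
have iS z : mu.-integrable setT (EFin \o (fun t => cmod (f t + z * eta t) ^+ 2)).
  apply/integrableP; split; first by apply: measurable_cmod2; exact: (L2z z).1.
  rewrite (_ : (\int[mu]_t _)%E = sqn (fun t => f t + z * eta t)).
    by rewrite ltey_eq fin.
  by apply: eq_integral => t _ /=; rewrite ger0_norm// sqr_ge0.
apply: (@mulfI _ 4); first by rewrite pnatr_eq0.
transitivity (\int[mu]_t (cmod (f t + w * eta t) ^+ 2 - cmod (f t + (- w) * eta t) ^+ 2)).
  rewrite -RintegralZl//; last first.
    have : mu.-integrable setT (EFin \o (fun t => 4^-1 * (cmod (f t + w * eta t) ^+ 2 -
       cmod (f t + (- w) * eta t) ^+ 2))).
      by apply: integrableZ_EFin => //; exact: integrableB_EFin.
    apply: eq_integrable => // t _ /=; congr EFin.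
    by rewrite mulNr polarization mulrA mulVf ?mul1r// pnatr_eq0.
  by apply: eq_Rintegral => t _; rewrite mulNr polarization.
rewrite RintegralB//.
have toG z : \int[mu]_t (cmod (f t + z * eta t) ^+ 2) = \int[mu]_(t in I01) G z t.
  by rewrite /Rintegral -sG.
rewrite !toG -RintegralB//.
transitivity (\int[mu]_(t in I01) (4 * Re (trig_poly sq a t * (w * trig_poly sq2 e t)^*%C))).
  rewrite /Rintegral; congr fine; apply: ae_eq_integral => //.
  - by apply: measurable_funTS; apply/measurable_EFinP; apply: measurable_funB; exact: mG.
  - apply: measurable_funTS; apply/measurable_EFinP; apply: measurable_funM => //.
    have h : cmeasurable (fun t => trig_poly sq a t * (w * trig_poly sq2 e t)^*%C).
      apply: cmeasurableM => //; apply: cmeasurable_conj; apply: cmeasurableZ.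
      exact: cmeasurable_trig_poly.
    exact: h.1.
  (* On the zero set the inverse is 0 by convention and the cancellation fails, but this set is
     countable, hence null. *)
  exists [set t | Psi t = 0]; split.
  - exact: countable_measurable.
  - exact: countable_lebesgue_measure0.
  move=> t /= h; apply: contrapT => Pt; apply: h => _; congr EFin.
  rewrite /G -mulrBl /m mulNr polarization /v -mulrA; congr (4 * _).
  have -> : (w * (((Psi t)^-1)%:C * trig_poly sq2 e t))^*%C =
      ((Psi t)^-1)%:C * (w * trig_poly sq2 e t)^*%C.
    by rewrite mulrCA rmorphM; congr (_ * _); exact: conjc_real.
  case: (w * _)^*%C (trig_poly sq a t) => p q [p' q'] /=; field.
  exact/eqP.
rewrite RintegralZl//; apply: integrable01.
have [ar ai] := continuous_Re_trig_poly sq a.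
have [er ei] := continuous_Re_trig_poly sq2 e.
have -> : (fun t => Re (trig_poly sq a t * (w * trig_poly sq2 e t)^*%C)) = fun t =>
   Re (trig_poly sq a t) * (Re w * Re (trig_poly sq2 e t) - Im w * Im (trig_poly sq2 e t)) +
   Im (trig_poly sq a t) * (Re w * Im (trig_poly sq2 e t) + Im w * Re (trig_poly sq2 e t)).
  apply/funext => t; case: (trig_poly sq a t) (trig_poly sq2 e t) (w) => p q [p' q'] [p'' q''] /=.
  by ring.
move=> t; apply: cvgD; apply: cvgM; [exact: ar| |exact: ai|].
- by apply: cvgB; apply: cvgMl_tmp; [exact: er|exact: ei].
- by apply: cvgD; apply: cvgMl_tmp; [exact: ei|exact: er].
Qed.

Lemma cintegral_comb_dual (sq sq2 : seq int) (b e : int -> R[i]) (eta : R -> R[i]) :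
  uniq sq -> (forall k, k \notin sq -> b k = 0) ->
  fourierL2 eta (fun t => fourier phi t * ((fine (Phi phi t))^-1)%:C * trig_poly sq2 e t) ->
  cintegral (fun t => comb phi sq b t * (eta t)^*%C) =
  \sum_(l <- sq2) b l * (e l)^*%C.
Proof.
move=> usq b0 Feta; rewrite /cintegral.
have h w := @fourierL2_inner sq sq2 b e eta w Feta.
have {}h w : \int[mu]_t Re (comb phi sq b t * (w * eta t)^*%C) =
    Re (w^*%C * \sum_(l <- sq2) b l * (e l)^*%C).
  by rewrite h trig_poly_inner.
(* w = 1 gives the real part and w = i the imaginary part, because the conjugate of i is -i. *)
have h1 := h 1; have h2 := h 'i%C; move: h1 h2; set Z := \sum_(l <- _) _ => h1 h2.
have -> : \int[mu]_t Re (comb phi sq b t * (eta t)^*%C) = Re Z.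
  have -> : Re Z = Re (1^*%C * Z) by rewrite rmorph1 mul1r.
  by rewrite -h1; apply: eq_Rintegral => t _; rewrite mul1r.
have -> : \int[mu]_t Im (comb phi sq b t * (eta t)^*%C) = Im Z.
  have -> : Im Z = Re ('i^*%C * Z) by case: (Z) => p q /=; ring.
  rewrite -h2; apply: eq_Rintegral => t _.
  by case: (comb phi sq b t) (eta t) => p q [p' q'] /=; ring.
by case: (Z).
Qed.

End Biorthogonality.

(** * Finite windows of integers and tails of sums *)

Section Windows.
Context {R : realType}.
Implicit Types (u v c : int -> R[i]) (a : int) (N : nat).

Lemma eq_sum_support (V : nmodType) (s1 s2 : seq int) (G : int -> V) :
  uniq s1 -> uniq s2 ->
  (forall k, k \in s1 -> k \notin s2 -> G k = 0) ->
  (forall k, k \in s2 -> k \notin s1 -> G k = 0) ->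
  \sum_(k <- s1) G k = \sum_(k <- s2) G k.
Proof.
have restr (t1 t2 : seq int) : (forall k, k \in t1 -> k \notin t2 -> G k = 0) ->
    \sum_(k <- t1) G k = \sum_(k <- [seq k <- t1 | k \in t2]) G k.
  move=> h; rewrite big_filter [in RHS]big_mkcond /= !big_seq; apply: eq_bigr => k kt.
  by case: ifPn => // /(h _ kt).
move=> u1 u2 h1 h2; rewrite (restr _ _ h1) (restr _ _ h2); apply: perm_big.
by apply: uniq_perm; rewrite ?filter_uniq// => k; rewrite !mem_filter andbC.
Qed.

Lemma ler_sum_support (s1 s2 : seq int) (F : int -> R) :
  uniq s1 -> uniq s2 -> (forall k, 0 <= F k) ->
  (forall k, k \in s1 -> k \notin s2 -> F k = 0) ->
  \sum_(k <- s1) F k <= \sum_(k <- s2) F k.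
Proof.
move=> u1 u2 F0 h; rewrite (@eq_sum_support _ s1 [seq k <- s2 | k \in s1])//.
- by rewrite big_filter [leLHS]big_mkcond; apply: ler_sum => k _; case: ifP.
- by rewrite filter_uniq.
- by move=> k k1; rewrite mem_filter k1 => /(h _ k1).
- by move=> k; rewrite mem_filter => /andP[->].
Qed.

Definition window a N : seq int := consecutive (a - N%:Z) (N + N).

Lemma uniq_window a N : uniq (window a N).
Proof. exact: uniq_consecutive. Qed.

Lemma mem_window a N (n : int) : (n \in window a N) = (a - N%:Z <= n < a + N%:Z).
Proof. by rewrite mem_consecutive; congr (_ && _); lia. Qed.

Lemma window_subset a N M : (N <= M)%N -> {subset window a N <= window a M}.
Proof. by move=> NM k; rewrite !mem_window; lia. Qed.

Lemma wl1E a (F : int -> R) N : wl1 a F N = \sum_(k <- window a N) F k.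
Proof.
rewrite /window big_consecutive big_split_ord /= /wl1 big_split /= addrC; congr (_ + _).
  rewrite (reindex_inj rev_ord_inj) /=; apply: eq_bigr => i _.
  by congr F; have := ltn_ord i; lia.
by apply: eq_bigr => i _; congr F; lia.
Qed.

Lemma wsumE a u N : wsum a u N = \sum_(k <- window a N) cmod (u k) ^+ 2.
Proof. by rewrite -wl1E /wl1 big_split. Qed.

Lemma wsumD a u v N :
  wsum a (fun n => u n + v n) N <= 2 * wsum a u N + 2 * wsum a v N.
Proof.
rewrite !wsumE !mulr_sumr -big_split; apply: ler_sum => n _; exact: cmodD_sqr.
Qed.

Lemma le_wsum_sq a u N : wsum a u N <= wl1 a (fun n => cmod (u n)) N ^+ 2.
Proof.
rewrite wsumE wl1E; elim: (window a N) => [|k s IH].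
  by rewrite !big_nil expr0n.
have s0 : 0 <= \sum_(j <- s) cmod (u j) by apply: sumr_ge0 => j _; exact: cmod_ge0.
by rewrite !big_cons sqrrD; have := cmod_ge0 (u k); nra.
Qed.

Lemma summable_tail a (F : int -> R) B : (forall k, 0 <= F k) ->
  (forall N, wl1 a F N <= B) -> forall e, 0 < e ->
  exists M0, forall N (s : seq int), {subset window a M0 <= s} ->
    \sum_(k <- window a N | k \notin s) F k <= e.
Proof.
move=> F0 FB e e0.
pose S := [set wl1 a F N | N in [set: nat]].
have supS : has_sup S.
  split; first by exists (wl1 a F 0), 0%N.
  by exists B => _ [N _ <-].
have [_ [M0 _ <-] hM] := sup_adherent e0 supS.
exists M0 => N s sub.
have hle : wl1 a F (maxn M0 N) <= sup S by apply: (ub_le_sup supS.2); exists (maxn M0 N).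
suff : \sum_(k <- window a N | k \notin s) F k + wl1 a F M0 <= wl1 a F (maxn M0 N) by lra.
rewrite !wl1E -big_filter -big_cat; apply: ler_sum_support => //.
- rewrite cat_uniq filter_uniq ?uniq_window//= andbT.
  by apply/hasPn => k /sub ks; rewrite mem_filter ks.
- exact: uniq_window.
- move=> k; rewrite mem_cat mem_filter !mem_window => h1 /negP h2; exfalso; apply: h2.
  by move: h1 => /orP[/andP[_]|] => h1; have := leq_maxl M0 N; have := leq_maxr M0 N; lia.
Qed.

Lemma zdiffsB ws u v (n : int) :
  zdiffs ws (fun n => u n - v n) n = zdiffs ws u n - zdiffs ws v n.
Proof.
elim: ws u v => //= w ws IH u v; rewrite -IH; congr (zdiffs _ _ _).
by apply/funext => k; rewrite /zdiff; ring.
Qed.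

Lemma zdiffs_l1 ws a u N : (forall w, w \in ws -> cmod w = 1) ->
  wl1 a (fun n => cmod (zdiffs ws u n)) N <=
  2 ^+ size ws * wl1 a (fun n => cmod (u n)) (N + size ws).
Proof.
elim: ws u => [|w ws IH] u ws1 /=; first by rewrite expr0 mul1r addn0.
apply: le_trans (IH _ _) _; first by move=> z zs; apply: ws1; rewrite inE zs orbT.
rewrite exprSr -mulrA ler_wpM2l ?exprn_ge0//.
set K := (N + size ws)%N; have -> : (N + (size ws).+1)%N = K.+1 by rewrite addnS.
apply: (@le_trans _ _ (\sum_(k <- window a K) (cmod (u (k + 1)) + cmod (u k)))).
  rewrite wl1E; apply: ler_sum => k _; rewrite /zdiff.
  by apply: le_trans (cmodB _ _) _; rewrite cmodM (ws1 w (mem_head _ _)) mul1r.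
rewrite big_split mulrDl mul1r /=; apply: lerD; last first.
  rewrite wl1E; apply: ler_sum_support; [exact: uniq_window..|by move=> k; exact: cmod_ge0|].
  by move=> k; rewrite !mem_window; lia.
rewrite wl1E -(big_map (fun k => k + 1) xpredT (fun k => cmod (u k))).
apply: ler_sum_support => //.
- by rewrite map_inj_uniq ?uniq_window//; exact: addIr.
- exact: uniq_window.
- by move=> k; exact: cmod_ge0.
- by move=> k /mapP[j]; rewrite !mem_window => h ->; lia.
Qed.

(** Each value of the differences involves finitely many values of u, so the new bound is linear in
    [d] with a factor depending on n. No uniformity in n is claimed. *)
Lemma zdiffs_bound ws (M : int -> R) : exists M' : int -> R, forall u d,
  (forall n, cmod (u n) <= M n * d) -> forall n, cmod (zdiffs ws u n) <= M' n * d.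
Proof.
elim: ws M => [|w ws IH] M; first by exists M.
have [M' hM'] := IH (fun n => M (n + 1) + cmod w * M n).
exists M' => u d hu; apply: hM' => n; rewrite /zdiff.
apply: le_trans (cmodB _ _) _; rewrite cmodM mulrDl; apply: lerD => //.
by rewrite -mulrA ler_wpM2l// cmod_ge0.
Qed.

Lemma window_cover a (s : seq int) : exists N, {subset s <= window a N}.
Proof.
elim: s => [|k s [N IH]]; first by exists 0%N.
exists (N + absz (k - a) + 1)%N => j; rewrite inE => /orP[/eqP->|/IH].
  by rewrite mem_window; lia.
by rewrite !mem_window; lia.
Qed.

End Windows.

(** * Compact support, and integrals of products *)

Section Duality.
Context {R : realType}.
Local Notation mu := (@lebesgue_measure R).
Local Notation Re := complex.Re.
Local Notation Im := complex.Im.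
Local Notation N2 := (cLnorm 2%:E).
Implicit Types (f g phi : R -> R[i]).

(** A representative vanishing everywhere, and not just almost everywhere, outside a bounded
    interval; sums of its translates are finite at every point. *)
Definition cutoff (B : R) phi (y : R) : R[i] := if `|y| <= B then phi y else 0.

Lemma cmeasurable_cutoff B phi : cmeasurable phi -> cmeasurable (cutoff B phi).
Proof.
move=> [mr mi].
have mb : measurable_fun setT (fun y : R => `|y| <= B).
  by apply: measurable_fun_ler => //; exact: measurable_cst.
split.
  have -> : (fun y => Re (cutoff B phi y)) = fun y => if `|y| <= B then Re (phi y) else 0.
    by apply/funext => y; rewrite /cutoff; case: ifP.
  by apply: measurable_fun_ifT => //; exact: measurable_cst.
have -> : (fun y => Im (cutoff B phi y)) = fun y => if `|y| <= B then Im (phi y) else 0.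
  by apply/funext => y; rewrite /cutoff; case: ifP.
by apply: measurable_fun_ifT => //; exact: measurable_cst.
Qed.

Lemma compactly_supported_cutoff phi : compactly_supported phi ->
  exists B : nat, {ae mu, forall y, phi y = cutoff B%:R phi y}.
Proof.
move=> [K [cK [A [mA A0 AP]]]].
have [M [_ hM]] := compact_bounded cK.
pose B := (Num.truncn (`|M| + 1)).+1.
have MB : M < B%:R.
  have h := truncnS_gt (`|M| + 1); apply: lt_trans h.
  by have := ler_norm M; lra.
exists B, A; split => // y /= h; apply: AP => /= h2; apply: h; rewrite /cutoff.
case: ifPn => // yB; apply: h2 => Ky.
by move: yB; rewrite (hM _ MB y Ky).
Qed.

Lemma cL1_compactly_supported phi : cL2 phi -> compactly_supported phi -> cL1 phi.
Proof.
move=> phi2 /compactly_supported_cutoff[B hB]; have [mphi _] := phi2.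
have mc := cmeasurable_cutoff B%:R mphi.
have /cL2_sqn[_ sphi] := phi2.
split=> //; rewrite cLnorm1E.
have mcm := measurable_cmod mphi.
have mcmc := measurable_cmod mc.
pose I := `[- B%:R, B%:R]%classic : set R.
have mI : measurable I by exact: measurable_itv.
have muI : (mu I < +oo)%E.
  by rewrite /I lebesgue_measure_itv /=; case: ifP => // _; rewrite -EFinB ltry.
have -> : (\int[mu]_t (cmod (phi t))%:E = \int[mu]_t (cmod (cutoff B%:R phi t))%:E)%E.
  apply: ge0_ae_eq_integral => //.
  - exact/measurable_EFinP.
  - exact/measurable_EFinP.
  - by move=> t _; rewrite lee_fin cmod_ge0.
  - by move=> t _; rewrite lee_fin cmod_ge0.
  - move: hB => [A [mA A0 AP]]; exists A; split => // t /= h; apply: AP => /= h2.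
    by apply: h => _; rewrite -h2.
(* The inequality v <= 1 + v^2, applied on an interval of finite measure. *)
apply: (@le_lt_trans _ _ (\int[mu]_t ((\1_I t)%:E + (cmod (phi t) ^+ 2)%:E))%E).
  apply: ge0_le_integral => //.
  - by move=> t _; rewrite lee_fin cmod_ge0.
  - exact/measurable_EFinP.
  - by apply: emeasurable_funD; [apply/measurable_EFinP|exact: measurable_cmod2].
  move=> t _; rewrite -EFinD lee_fin /cutoff indicE.
  case: ifPn => tB.
    rewrite mem_set /=; last by rewrite /I /= in_itv /= -ler_norml.
    by have := cmod_ge0 (phi t); nra.
  by rewrite cmod0 addr_ge0// sqr_ge0.
rewrite ge0_integralD//.
- by rewrite integral_indic// setIT; exact: lte_add_pinfty.
- exact/measurable_EFinP.
- by move=> t _; rewrite lee_fin sqr_ge0.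
- exact: measurable_cmod2.
Qed.

Lemma hoelder_cL2 f g : cmeasurable f -> cmeasurable g ->
  (cLnorm 1 (fun t => f t * (g t)^*%C)%R <= N2 f * N2 g)%E.
Proof.
move=> mf mg; have := @hoelder _ _ _ mu (fun t => cmod (f t)) (fun t => cmod (g t)) 2 2
  (measurable_cmod mf) (measurable_cmod mg).
have -> : cLnorm 1 (fun t => f t * (g t)^*%C) =
    Lnorm mu 1 (EFin \o ((fun t => cmod (f t)) \* (fun t => cmod (g t)))).
  rewrite /cLnorm; congr (Lnorm mu 1 _); apply/funext => t /=.
  by rewrite cmodM cmod_conj.
by apply => //; lra.
Qed.

Lemma cL1_mul_conj f g : cL2 f -> cL2 g -> cL1 (fun t => f t * (g t)^*%C).
Proof.
move=> [mf hf] [mg hg]; split.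
  by apply: cmeasurableM => //; exact: cmeasurable_conj.
apply: le_lt_trans (hoelder_cL2 mf mg) _.
rewrite lte_mul_pinfty// ?cLnorm_ge0//.
by rewrite ge0_fin_numE// cLnorm_ge0.
Qed.

(** The factor 2 arises from bounding real and imaginary parts separately; only the existence of a
    constant matters for [coefficient_bound]. *)
Lemma cmod_cintegral_le f : cL1 f -> ((cmod (cintegral f))%:E <= 2%:E * cLnorm 1 f)%E.
Proof.
move=> f1; have [mf hf] := f1; have [f1r f1i] := cL1_cintegrable f1.
have mcf := measurable_cmod mf.
have part (h : R -> R) : (forall t, `|h t| <= cmod (f t)) ->
    mu.-integrable setT (EFin \o h) -> (`|Rintegral mu setT h|%:E <= cLnorm 1 f)%E.
  move=> hb ih; have mh : measurable_fun setT h.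
    by apply/measurable_EFinP; apply: measurable_int ih.
  apply: (@le_trans _ _ (\int[mu]_t `|h t|)%:E).
    by rewrite lee_fin; exact: (le_normr_Rintegral measurableT ih).
  have ih' : mu.-integrable setT (EFin \o (fun t => `|h t|)) by exact: integrable_norm.
  rewrite /Rintegral fineK; last exact: (integrable_fin_num measurableT ih').
  rewrite cLnorm1E; apply: ge0_le_integral => //.
  - by apply/measurable_EFinP; exact: measurableT_comp.
  - exact/measurable_EFinP.
  by move=> t _; rewrite lee_fin.
have hr := part _ (fun t => Re_le_cmod (f t)) f1r.
have hi := part _ (fun t => Im_le_cmod (f t)) f1i.
rewrite (_ : 2%:E * _ = cLnorm 1 f + cLnorm 1 f)%E; last first.
  by rewrite -[in RHS](mul1e (cLnorm 1 f)) -ge0_muleDl// -EFinD.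
apply: le_trans (leeD hr hi); rewrite -EFinD lee_fin.
exact: (cmod_le_Re_Im (cintegral f)).
Qed.

End Duality.

(** * The coefficients of f and their differences *)

Section Coefficients.
Context {R : realType}.
Local Notation Re := complex.Re.
Local Notation Im := complex.Im.
Local Notation N2 := (cLnorm 2%:E).

Lemma zdiffs_supported ws (b : int -> R[i]) lo n : supported b lo n ->
  supported (zdiffs ws b) (lo - (size ws)%:Z) (n + size ws).
Proof.
elim: ws b lo n => [|w ws IH] b lo n sb; first by rewrite subr0 addn0.
move=> k hk; apply: (IH _ _ _ (zdiff_supported w sb)).
by move: hk; rewrite !mem_consecutive /=; lia.
Qed.

Lemma supported_sub (b : int -> R[i]) (a : int) N M : (N <= M)%N ->
  supported b (a - N%:Z) (N + N) -> supported b (a - M%:Z) (M + M).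
Proof.
by move=> NM sb k; rewrite mem_consecutive => h; apply: sb; rewrite mem_consecutive; lia.
Qed.

Lemma comb_widen (phi : R -> R[i]) (b : int -> R[i]) (a : int) N M : (N <= M)%N ->
  supported b (a - N%:Z) (N + N) -> comb phi (window a M) b = comb phi (window a N) b.
Proof.
move=> NM sb; apply/funext => y; apply: eq_sum_support; try exact: uniq_window.
  by move=> k _ /sb ->; rewrite mul0r.
by move=> k; rewrite !mem_window; lia.
Qed.

Lemma combB (phi : R -> R[i]) sq (b b' : int -> R[i]) y :
  comb phi sq (fun k => b k - b' k) y = comb phi sq b y - comb phi sq b' y.
Proof. by rewrite /comb -sumrB; apply: eq_bigr => k _; rewrite mulrBl. Qed.

Lemma shift_space_window (phi f : R -> R[i]) (a : int) : shift_space phi f ->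
  forall e : R, 0 < e -> exists N b, supported b (a - N%:Z) (N + N) /\
    (N2 (fun y => f y - comb phi (window a N) b y)%R < e%:E)%E.
Proof.
move=> [_ fS] e e0; have [sq [al h]] := fS e e0.
have [N sN] := window_cover a sq.
(* The list [sq] may repeat a shift, so the coefficients belonging to equal shifts are added up. *)
exists N, (fun k => \sum_(j <- sq) (j == k)%:R * al j); split.
  move=> k kN; rewrite big1_seq// => j /andP[_ jsq].
  by case: eqP => [jk|_]; rewrite ?mul0r// -jk sN in kN *.
rewrite (_ : comb phi _ _ = fun y => \sum_(k <- sq) al k * translate k phi y)//.
apply/funext => y; rewrite /comb.
under eq_bigr do rewrite mulr_suml.
rewrite exchange_big /= !big_seq; apply: eq_bigr => j jsq.
rewrite (bigD1_seq j) ?uniq_window ?sN//= eqxx mul1r big1 ?addr0// => k kj.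
by rewrite eq_sym (negbTE kj) !mul0r.
Qed.

Variables (phi : R -> R[i]) (s : nat) (x : 'I_s -> R) (lam : 'I_s -> nat) (P : R -> R).
Hypotheses (phi1 : cL1 phi) (phi2 : cL2 phi).
Hypothesis x_distinct : forall i j : 'I_s, eq_mod1 (x i) (x j) -> i = j.
Hypothesis x_zeros : forall t : R, Phi phi t = 0%E <-> exists j : 'I_s, eq_mod1 t (x j).
Hypotheses (P_trig : is_trig_poly P) (P_gt0 : forall t, 0 < P t).
Hypothesis Phi_factor : forall t, Phi phi t = (`|omega x lam t| ^+ 2 * P t)%:E.
Variables (a : int) (Omega : seq int).
Hypothesis Omega_def : Omega = consecutive a (\sum_(j < s) lam j)%N.
Variable c : int -> int -> R[i].
Hypothesis T_interp : forall n : int, n \notin Omega ->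
  interpolates x lam (trig_poly Omega (c n)) (expchar n).
Variable eta : int -> R -> R[i].
Hypothesis eta_def : forall n : int, n \notin Omega ->
  fourierL2 (eta n) (fun t : R =>
    fourier phi t * ((fine (Phi phi t))^-1)%:C *
      (expchar n t - trig_poly Omega (c n) t)).

Local Notation coef := (coefficient Omega eta).
Local Notation D := (zdiffs (map conjc (nodes x lam))).
Local Notation L := (\sum_(j < s) lam j)%N.

Local Notation Psi := (fun t => `|omega x lam t| ^+ 2 * P t).

Lemma measurable_factored : measurable_fun setT Psi.
Proof.
apply: measurable_funM; last first.
  by apply: continuous_measurable_fun; exact: (continuous_P P_trig).
apply: measurable_funX; apply: measurableT_comp => //; rewrite /omega.
apply: measurable_prod => j _; apply: measurable_funX.
apply: (measurableT_comp measurable_sin); apply: measurable_funM => //.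
exact: measurable_funB.
Qed.

Lemma countable_zeros : countable [set t | Psi t = 0].
Proof.
pose g (p : 'I_s * int) : R := x p.1 + p.2%:~R.
apply: (@sub_countable _ _ _ [set: 'I_s * int]); last exact: countableP.
apply: card_le_trans (card_image_le g _); apply: subset_card_le => t /= Pt.
have /x_zeros[j /intrP[k tk]] : Phi phi t = 0%E by rewrite Phi_factor Pt.
by exists (j, k) => //; rewrite /g /= -tk addrC subrK.
Qed.

Lemma coefficient_comb sq b (n : int) : uniq sq -> (forall k, k \notin sq -> b k = 0) ->
  coef (comb phi sq b) n = b n - \sum_(k <- Omega) b k * (interp_coef Omega c n k)^*%C.
Proof.
move=> usq b0; rewrite /coefficient /interp_coef.
have uO : uniq Omega by rewrite Omega_def uniq_consecutive.
case: ifPn => nO.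
  rewrite (bigD1_seq n)//= eqxx rmorph1 mulr1 big1 ?addr0 ?subrr// => k kn.
  by rewrite eq_sym (negbTE kn) rmorph0 mulr0.
(* Coefficients of e_n - T_n as a single trigonometric polynomial with frequencies in
   [n :: Omega]. *)
pose e (l : int) : R[i] := if l == n then 1 else - c n l.
rewrite (@cintegral_comb_dual _ _ Psi phi1 phi2 Phi_factor measurable_factored countable_zeros
  sq (n :: Omega) b e)//.
  rewrite big_cons /e eqxx rmorph1 mulr1 -sumrN; congr (_ + _).
  rewrite !big_seq; apply: eq_bigr => k kO; rewrite ifN ?rmorphN ?mulrN//.
  by apply: contraNneq nO => <-.
rewrite (_ : (fun t => _) = fun t => fourier phi t * ((fine (Phi phi t))^-1)%:C *
      (expchar n t - trig_poly Omega (c n) t)); first exact: eta_def.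
apply/funext => t; congr (_ * _); rewrite /trig_poly big_cons /e eqxx mul1r -sumrN.
congr (_ + _); rewrite !big_seq; apply: eq_bigr => k kO; rewrite ifN ?mulNr//.
by apply: contraNneq nO => <-.
Qed.

(** The correction terms depend on n only through the conjugated interpolation coefficients, which D
    annihilates. *)
Lemma zdiffs_coefficient_comb sq b (n : int) : uniq sq ->
  (forall k, k \notin sq -> b k = 0) -> D (coef (comb phi sq b)) n = D b n.
Proof.
move=> usq b0.
have -> : coef (comb phi sq b) = fun n => b n -
    \sum_(k <- Omega) b k * (interp_coef Omega c n k)^*%C.
  by apply/funext => m; exact: coefficient_comb.
rewrite zdiffsB (zdiffs_sum Omega _ b (fun k n => (interp_coef Omega c n k)^*%C)).
rewrite big1_seq ?subr0// => k /andP[_ kO].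
rewrite (zdiffs_conj (nodes x lam) (fun n => interp_coef Omega c n k)).
by rewrite (zdiffs_interp_coef x_distinct Omega_def T_interp)// rmorph0 mulr0.
Qed.

Lemma cL2_dual n : n \notin Omega -> cL2 (eta n).
Proof. by move=> /eta_def[]. Qed.

Lemma coefficientB f g (n : int) : cL2 f -> cL2 g ->
  coef (fun y => f y - g y) n = coef f n - coef g n.
Proof.
move=> f2 g2; rewrite /coefficient; case: ifPn => nO; first by rewrite subrr.
have eta2 := cL2_dual nO.
have i1 := cL1_cintegrable (cL1_mul_conj f2 eta2).
have i2 := cL1_cintegrable (cL1_mul_conj g2 eta2).
rewrite -mulN1r -cintegralZ// -cintegralD//; last exact: cintegrableZ.
by congr cintegral; apply/funext => t; rewrite mulN1r mulrBl.
Qed.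

(** Continuity of each coefficient functional, with a constant proportional to the norm of the dual
    function and hence not uniform in n. *)
Lemma coefficient_bound : exists M : int -> R, forall f d, cL2 f -> (N2 f <= d%:E)%E ->
  forall n, cmod (coef f n) <= M n * d.
Proof.
exists (fun n => if n \in Omega then 0 else 2 * fine (N2 (eta n))) => f d f2 fd n.
rewrite /coefficient; case: ifPn => nO; first by rewrite cmod0 mul0r.
have eta2 := cL2_dual nO.
have d0 : 0 <= d by rewrite -lee_fin (le_trans (cLnorm_ge0 _ _) fd).
have fin : N2 (eta n) \is a fin_num.
  by rewrite ge0_fin_numE ?cLnorm_ge0//; exact: eta2.2.
rewrite -lee_fin; apply: le_trans (cmod_cintegral_le (cL1_mul_conj f2 eta2)) _.
rewrite -mulrA EFinM lee_wpmul2l ?lee_fin//.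
apply: le_trans (hoelder_cL2 f2.1 eta2.1) _.
by rewrite EFinM fineK// muleC; apply: lee_wpmul2l => //; exact: cLnorm_ge0.
Qed.

Lemma cLnorm_comb_equiv : exists C : R, 0 < C /\ forall b N (d : R),
  supported b (a - N%:Z) (N + N) -> 0 <= d ->
  ((N2 (comb phi (window a N) b) <= d%:E)%E -> forall K, wsum a (D b) K <= (C * d) ^+ 2) /\
  ((forall K, wsum a (D b) K <= d ^+ 2) -> (N2 (comb phi (window a N) b) <= (C * d)%:E)%E).
Proof.
have [C [C0 hC]] := sqn_comb_equiv phi1 phi2 P_trig P_gt0 Phi_factor.
have C1 d : C * d ^+ 2 <= ((1 + C) * d) ^+ 2.
  by rewrite exprMn ler_wpM2r ?sqr_ge0//; nra.
(* C compares squares; passing to norms uses C d^2 <= ((1 + C) d)^2. *)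
exists (1 + C); split => [|b N d sb d0]; first by rewrite addr_gt0.
have [up low] := hC b _ _ sb.
have sD := @zdiffs_supported (map conjc (nodes x lam)) _ _ _ sb.
rewrite size_map size_nodes in sD.
split => [hd K|hd].
  apply: le_trans (C1 d); apply: (@le_trans _ _ (zdiff_norm x lam b (a - N%:Z) (N + N))).
    rewrite wsumE; apply: ler_sum_support => [||k|k _ /sD ->].
    - exact: uniq_window.
    - exact: uniq_consecutive.
    - exact: sqr_ge0.
    - by rewrite cmod0 expr0n.
  rewrite -lee_fin; apply: (le_trans low); rewrite EFinM.
  by apply: lee_wpmul2l; [rewrite lee_fin ltW|exact: sqn_le_cLnorm].
apply: cLnorm_le_sqn; first by rewrite mulr_ge0// addr_ge0// ltW.
apply: (le_trans up); rewrite lee_fin; apply: le_trans (C1 d).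
apply: ler_wpM2l; first exact: ltW.
(* D enlarges the support of b by L places to the left, so the window of radius N + L contains
   it. *)
apply: le_trans (hd (N + L)%N).
rewrite wsumE; apply: ler_sum_support => [||k|k].
- exact: uniq_consecutive.
- exact: uniq_window.
- exact: sqr_ge0.
- by rewrite mem_window mem_consecutive; lia.
Qed.

(** The window K is fixed and f is approximated by a second combination b' within e. The part coming
    from f - comb b' is bounded by e times a constant depending on K, and the part D b' - D b by the
    uniform norm comparison. Letting e tend to 0 removes the dependence on K. *)
Lemma zdiffs_coefficient_le : exists C : R, 0 < C /\ forall f b N (d : R),
  shift_space phi f -> supported b (a - N%:Z) (N + N) -> 0 <= d ->
  (N2 (fun y => f y - comb phi (window a N) b y)%R <= d%:E)%E ->
  forall K, wsum a (fun n => D (coef f) n - D b n) K <= (C * d) ^+ 2.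
Proof.
have [C [C0 hC]] := cLnorm_comb_equiv.
have [M hM] := coefficient_bound.
have [M' hM'] := zdiffs_bound (map conjc (nodes x lam)) M.
exists (2 * C); split => [|f b N d fS sb d0 fd K]; first by rewrite mulr_gt0.
have f2 : cL2 f by case: fS.
pose KM := wsum a (fun n => (M' n)%:C) K.
have KM0 : 0 <= KM by exact: wsum_ge0.
suff step e : 0 < e -> wsum a (fun n => D (coef f) n - D b n) K <=
    2 * (KM * e ^+ 2) + 2 * (C * (d + e)) ^+ 2.
  apply/ler_addgt0Pr => e e0.
  (* Expanding (d + e)^2 <= 2 d^2 + 2 e^2 leaves (2 C d)^2 plus at most A e'^2, and e' is chosen so
     that A e'^2 <= A e' <= e. *)
  pose A := 2 * KM + 4 * C ^+ 2 + 1.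
  have A0 : 0 < A by rewrite /A; have := sqr_ge0 C; lra.
  pose e' := Num.min 1 (e / A).
  have e'0 : 0 < e' by rewrite lt_min ltr01 divr_gt0.
  have e'1 : e' <= 1 by rewrite ge_min lexx.
  have e'A : e' * A <= e by rewrite -ler_pdivlMr// ge_min lexx orbT.
  apply: le_trans (step _ e'0) _.
  have : 2 * (C * (d + e')) ^+ 2 <= 4 * C ^+ 2 * d ^+ 2 + 4 * C ^+ 2 * e' ^+ 2.
    by have := mulr_ge0 (sqr_ge0 C) (sqr_ge0 (d - e')); nra.
  have : A * e' ^+ 2 <= e' * A by rewrite mulrC expr2 -mulrA ler_pM2l// ler_piMl// ltW.
  set E2 := e' ^+ 2; have E20 : 0 <= E2 by exact: sqr_ge0.
  rewrite /A !exprMn; set C2 := C ^+ 2; have : 2 ^+ 2 = 4 :> R by ring.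
  move=> ->; move: e'A; rewrite /A -/C2; lra.
move=> e0; have [N' [b' [sb' fb']]] := shift_space_window a fS e0.
have c2 := cL2_comb phi2 (window a N') b'.
apply: le_trans (_ : 2 * wsum a (fun n => D (coef f) n - D b' n) K +
    2 * wsum a (fun n => D b' n - D b n) K <= _).
  apply: le_trans (wsumD _ _ _ _); rewrite le_eqVlt; apply/orP; left; apply/eqP.
  by congr (wsum a _ K); apply/funext => n; rewrite addrA subrK.
apply: lerD; rewrite ler_wpM2l//.
  have hg := hM _ e (cL2B f2 c2) (ltW fb').
  have {}hg := hM' _ _ hg.
  rewrite /KM !wsumE mulr_suml; apply: ler_sum => n _.
  rewrite -(zdiffs_coefficient_comb n (uniq_window a N') sb').
  rewrite -zdiffsB (_ : (fun n => _) = coef (fun y => f y - comb phi (window a N') b' y)); last first.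
    by apply/funext => k; rewrite coefficientB.
  rewrite cmod_real real_normK ?num_real// -exprMn lerXn2r ?nnegrE ?cmod_ge0//.
  exact: le_trans (cmod_ge0 _) (hg n).
pose Q := maxn N N'.
have sQ : supported (fun k => b' k - b k) (a - Q%:Z) (Q + Q).
  move=> k kQ; rewrite (supported_sub (leq_maxl N N') sb)//.
  by rewrite (supported_sub (leq_maxr N N') sb')// subrr.
have de0 : 0 <= d + e by rewrite addr_ge0// ltW.
have [h _] := hC _ _ _ sQ de0.
apply: le_trans (h _ K); last first.
  have -> : comb phi (window a Q) (fun k => b' k - b k) =
      fun y => comb phi (window a N') b' y - comb phi (window a N) b y.
    apply/funext => y; rewrite combB (comb_widen phi (leq_maxl N N') sb).
    by rewrite (comb_widen phi (leq_maxr N N') sb').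
  have cb2 := cL2_comb phi2 (window a N) b.
  apply: le_trans (cLnorm_triangle c2.1 cb2.1 f2.1) _.
  rewrite [d + e]addrC (EFinD e d); apply: leeD; last exact: fd.
  by rewrite cLnormB_sym ltW.
rewrite le_eqVlt; apply/orP; left; apply/eqP; congr (wsum a _ K).
by apply/funext => n; rewrite zdiffsB.
Qed.

End Coefficients.

(** * Convergence of the Abel means *)

Section LocallyFiniteSum.
Context {R : realType}.
Local Notation mu := (@lebesgue_measure R).
Local Notation Re := complex.Re.
Local Notation Im := complex.Im.
Local Notation N2 := (cLnorm 2%:E).

Lemma cvge0P {T : Type} (G : set_system T) {FF : Filter G} (h : T -> \bar R) :
  (forall p, 0 <= h p)%E ->
  (forall e : R, 0 < e -> \forall p \near G, (h p <= e%:E)%E) -> h @ G --> 0%E.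
Proof.
move=> h0 hG; apply/fine_cvgP; split.
  apply: filterS (hG 1 ltr01) => p hp.
  by rewrite ge0_fin_numE//; exact: le_lt_trans hp (ltry _).
apply/cvgr0Pnorm_le => e e0; apply: filterS (hG e e0) => p hp.
have fin : h p \is a fin_num by rewrite ge0_fin_numE//; exact: le_lt_trans hp (ltry _).
by rewrite /= ger0_norm ?fine_ge0// -lee_fin fineK.
Qed.

Variables (phi : R -> R[i]) (B : nat) (a : int) (u : int -> R[i]).
Hypothesis phi2 : cL2 phi.
Hypothesis phiB : {ae mu, forall y, phi y = cutoff B%:R phi y}.

Local Notation ph := (cutoff B%:R phi).

(** The cut-off function shifted by k can be nonzero at y only when |k| <= B + |floor y|. Adding |a|
    covers windows centred at [a], and the 2 leaves slack at the half-open ends. *)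
Let reach (y : R) : nat := (`|a| + `|Num.floor y| + B + 2)%N.

(* Each point lies in the support of only finitely many translates of the
   cut-off function, so the whole series is a finite sum there. *)
Definition local_sum (y : R) : R[i] := comb ph (window a (reach y)) u y.

Let translate_cutoff0 k y : k \notin window a (reach y) -> translate k ph y = 0.
Proof.
rewrite mem_window /translate /cutoff => hk; rewrite ifN// -ltNge.
have /andP[f1 f2] := floor_itv y.
set fl := Num.floor y in hk f1 f2; rewrite rmorphD /= rmorph1 in f2.
have : (B%:Z + fl + 1 <= - k) || (B%:Z - fl < k).
  by move: hk; rewrite /reach -/fl; lia.
case/orP => h.
  have : (B%:Z + fl + 1)%:~R <= (- k)%:~R :> R by rewrite ler_int.
  rewrite !rmorphD /= rmorph1 rmorphN /= -pmulrn => h'.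
  by rewrite -normrN; apply: lt_le_trans (ler_norm _); lra.
have : (B%:Z - fl)%:~R < k%:~R :> R by rewrite ltr_int.
rewrite rmorphB /= -pmulrn => h'.
by apply: lt_le_trans (ler_norm _); lra.
Qed.

Lemma comb_local_sum sq y : uniq sq -> {subset window a (reach y) <= sq} ->
  comb ph sq u y = local_sum y.
Proof.
move=> usq sub; apply: eq_sum_support; [exact: usq|exact: uniq_window| |].
  by move=> k _ /translate_cutoff0 ->; rewrite mulr0.
by move=> k /sub ->.
Qed.

Let comb_window_near y M : (reach y <= M)%N -> comb ph (window a M) u y = local_sum y.
Proof.
move=> yM; apply: comb_local_sum; first exact: uniq_window.
by move=> k; rewrite !mem_window; lia.
Qed.

Let mph : cmeasurable ph.
Proof. by apply: cmeasurable_cutoff; exact: phi2.1. Qed.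

Let N2ph : N2 ph = N2 phi.
Proof.
apply: ae_eq_cLnorm => //; first exact: phi2.1.
by move: phiB => [A [mA A0 AP]]; exists A; split => // y /= h; apply: AP => /= h2; exact: h.
Qed.

Let ph2 : cL2 ph.
Proof. by split => //; rewrite N2ph; exact: phi2.2. Qed.

Lemma cmeasurable_local_sum : cmeasurable local_sum.
Proof.
have m M : cmeasurable (comb ph (window a M) u) by exact: (cL2_comb ph2 _ _).1.
split.
  apply: (@measurable_fun_cvg _ _ _ _ (fun M y => Re (comb ph (window a M) u y))) => [M|y _].
    exact: (m M).1.
  apply: cvg_near_cst; exists (reach y) => // M /= yM.
  by rewrite comb_window_near.
apply: (@measurable_fun_cvg _ _ _ _ (fun M y => Im (comb ph (window a M) u y))) => [M|y _].
  exact: (m M).2.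
apply: cvg_near_cst; exists (reach y) => // M /= yM.
by rewrite comb_window_near.
Qed.

Let comb_ae sq : {ae mu, forall y, comb phi sq u y = comb ph sq u y}.
Proof.
elim: sq => [|k sq IH].
  by apply: aeW => y; rewrite /comb !big_nil.
move: IH (ae_translate k%:~R phiB) => [A [mA A0 AP]] [A' [mA' A0' AP']].
exists (A `|` A'); split; first exact: measurableU.
  by rewrite -[RHS]A0; exact: measureU0.
move=> y /= h; apply: contrapT => /not_orP[nA nA']; apply: h.
have h1 : comb phi sq u y = comb ph sq u y.
  by apply: contrapT => h1; apply: nA; apply: AP.
have h2 : phi (y + k%:~R) = ph (y + k%:~R).
  by apply: contrapT => h2; apply: nA'; apply: AP'.
by move: h1; rewrite /comb !big_cons /translate h2 => ->.
Qed.

Let comb_diff sq M : uniq sq -> {subset sq <= window a M} -> forall e,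
  \sum_(k <- window a M | k \notin sq) cmod (u k) <= e ->
  (N2 (fun y => comb ph (window a M) u y - comb ph sq u y)%R <= e%:E * N2 phi)%E.
Proof.
move=> usq sub e he.
have -> : (fun y => comb ph (window a M) u y - comb ph sq u y) =
    fun y => \sum_(k <- [seq k <- window a M | k \notin sq]) u k * translate k ph y.
  apply/funext => y; rewrite big_filter /comb (bigID (mem sq)) /=.
  rewrite -big_filter (@eq_sum_support _ [seq k <- window a M | k \in sq] sq).
  - by rewrite addrC addrK.
  - by rewrite filter_uniq// uniq_window.
  - exact: usq.
  - by move=> k; rewrite mem_filter => /andP[->].
  - by move=> k ksq; rewrite mem_filter ksq sub.
apply: le_trans (cLnorm_sum _ _) _.
  by move=> k; apply: cmeasurableZ; exact: cmeasurable_translate.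
rewrite (eq_bigr (fun k => (cmod (u k))%:E * N2 phi)%E); last first.
  move=> k _; rewrite cLnormZ; last exact: cmeasurable_translate.
  by rewrite cLnorm_translate// N2ph.
rewrite -ge0_sume_distrl; last by move=> k _; rewrite lee_fin cmod_ge0.
apply: lee_wpmul2r; first exact: cLnorm_ge0.
by rewrite sumEFin lee_fin big_filter.
Qed.

Variable V : R.
Hypothesis uV : forall N, wl1 a (fun n => cmod (u n)) N <= V.

(** The pointwise finite sum stands in for the limit that completeness of L^2 would provide. Sums
    over growing windows are eventually constant at each point, so the l^1 tail bound on their
    differences passes to [local_sum] by Fatou's lemma. *)
Lemma local_sum_tail (e : R) : 0 < e -> exists M0, forall sq, uniq sq ->
  {subset window a M0 <= sq} ->
  (N2 (fun y => local_sum y - comb phi sq u y)%R <= e%:E * N2 phi)%E.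
Proof.
move=> e0; have [M0 hM0] := summable_tail (fun k => cmod_ge0 (u k)) uV e0.
exists M0 => sq usq sub.
have msum := cmeasurable_local_sum.
have mc (sq' : seq int) : cmeasurable (comb ph sq' u) by exact: (cL2_comb ph2 _ _).1.
have -> : N2 (fun y => local_sum y - comb phi sq u y) =
    N2 (fun y => local_sum y - comb ph sq u y).
  apply: ae_eq_cLnorm.
  - by apply: cmeasurableB => //; exact: (cL2_comb phi2 _ _).1.
  - exact: cmeasurableB.
  - move: (comb_ae sq) => [A [mA A0 AP]]; exists A; split => // y /= h; apply: AP => /= h2.
    by apply: h; rewrite h2.
have [M1 hM1] := window_cover a sq.
have phifin : N2 phi \is a fin_num by rewrite ge0_fin_numE ?cLnorm_ge0//; exact: phi2.2.
have n0 : 0 <= fine (N2 phi) by rewrite fine_ge0// cLnorm_ge0.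
rewrite -(fineK phifin) -EFinM; apply: cLnorm_le_sqn; first by rewrite mulr_ge0// ltW.
pose h (m : nat) y := (cmod (comb ph (window a (m + M1)) u y - comb ph sq u y) ^+ 2)%:E.
have mh m : measurable_fun setT (h m) by apply: measurable_cmod2; exact: cmeasurableB.
have h0 m y : [set: R] y -> (0 <= h m y)%E by move=> _; rewrite lee_fin sqr_ge0.
have := fatou mu measurableT mh h0.
have -> : (\int[mu]_y limn_einf (h ^~ y))%E = sqn (fun y => local_sum y - comb ph sq u y).
  apply: eq_integral => y _.
  have cu : h ^~ y @ \oo --> (cmod (local_sum y - comb ph sq u y) ^+ 2)%:E.
    apply: cvg_near_cst; exists (reach y) => // m /= ym.
    by rewrite /h comb_window_near//; apply: leq_trans ym _; rewrite leq_addr.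
  exact: (cvg_limn_einf_sup cu).1.
move=> /le_trans; apply.
pose cst (m : nat) : \bar R := ((e * fine (N2 phi)) ^+ 2)%:E.
apply: (@le_trans _ _ (limn_einf cst)); last first.
  by rewrite (cvg_limn_einf_sup (cvg_cst _ : cst @ \oo --> _)).1.
apply: le_limn_einf => m; apply: sqn_le_cLnorm; first by rewrite mulr_ge0// ltW.
rewrite EFinM fineK//; apply: comb_diff => //; last exact: hM0.
by move=> k /hM1; rewrite !mem_window; lia.
Qed.

Lemma cL2_local_sum : cL2 local_sum.
Proof.
have [M0 hM0] := local_sum_tail ltr01.
have c2 := cL2_comb phi2 (window a M0) u.
split; first exact: cmeasurable_local_sum.
have -> : local_sum = fun y => (local_sum y - comb phi (window a M0) u y) + comb phi (window a M0) u y.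
  by apply/funext => y; rewrite subrK.
apply: le_lt_trans (cLnormD _ c2.1) _.
  by apply: cmeasurableB; [exact: cmeasurable_local_sum|exact: c2.1].
apply: lte_add_pinfty; last exact: c2.2.
apply: le_lt_trans (hM0 _ (uniq_window _ _) _) _ => //.
by rewrite mul1e; exact: phi2.2.
Qed.

Lemma L2_sum_local_sum : L2_sum (fun n y => u n * translate n phi y) local_sum.
Proof.
split; first by move=> n; apply: cL2Z; exact: cL2_translate.
  exact: cL2_local_sum.
apply: cvge0P => [p|e e0]; first exact: cLnorm_ge0.
have phifin : N2 phi \is a fin_num by rewrite ge0_fin_numE ?cLnorm_ge0//; exact: phi2.2.
have n0 : 0 <= fine (N2 phi) by rewrite fine_ge0// cLnorm_ge0.
have d0 : 0 < e / (fine (N2 phi) + 1) by rewrite divr_gt0// ltr_wpDl.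
have [M0 hM0] := local_sum_tail d0.
(* The partial sums run over -m <= n <= n', centred at the origin; K makes this range contain the
   window of radius M0 about [a]. *)
pose K := (M0 + `|a|)%N.
exists ([set m | (K <= m)%N], [set m | (K <= m)%N]); first by split; exists K.
move=> [m n] [/= Km Kn].
apply: le_trans (hM0 _ (uniq_consecutive _ _) _) _.
  by move=> k; rewrite mem_window mem_consecutive /K in Km Kn *; lia.
rewrite -(fineK phifin) -EFinM lee_fin mulrAC ler_pdivrMr; last by rewrite ltr_wpDl.
by rewrite ler_wpM2l ?ltW// ltrDl.
Qed.

End LocallyFiniteSum.

Section AbelError.
Context {R : realType}.

Lemma wl1_truncation (a : int) (u : int -> R[i]) M J :
  wl1 a (fun k => cmod (u k - (if k \in window a M then u k else 0))) J =
  \sum_(k <- window a J | k \notin window a M) cmod (u k).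
Proof.
rewrite wl1E [RHS]big_mkcond; apply: eq_bigr => k _ /=.
by case: ifP; rewrite ?subrr ?subr0 ?cmod0.
Qed.

(** Each difference at most doubles the l^1 norm, and the l^2 norm is at most the l^1 norm, so a
    small l^1 tail remains small after D. *)
Lemma zdiffs_truncation ws (a : int) (u : int -> R[i]) M d :
  (forall w, w \in ws -> cmod w = 1) ->
  (forall J, \sum_(k <- window a J | k \notin window a M) cmod (u k) <= d) ->
  forall K, wsum a (zdiffs ws (fun k => u k - (if k \in window a M then u k else 0))) K <=
    (2 ^+ size ws * d) ^+ 2.
Proof.
move=> ws1 hd K; apply: le_trans (le_wsum_sq _ _ _) _.
have d0 : 0 <= d by apply: le_trans (hd 0%N); apply: sumr_ge0 => k _; exact: cmod_ge0.
have p0 : 0 <= 2 ^+ size ws :> R by rewrite exprn_ge0.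
rewrite lerXn2r ?nnegrE ?mulr_ge0//.
  by rewrite wl1E; apply: sumr_ge0 => k _; exact: cmod_ge0.
apply: le_trans (zdiffs_l1 a _ K ws1) _.
by apply: ler_wpM2l => //; rewrite wl1_truncation.
Qed.

End AbelError.

Theorem theorem2 (R : realType) (phi : R -> R[i])
    (phi_L2 : cL2 phi)
    (phi_neq0 : ~ {ae @lebesgue_measure R, forall x, phi x = 0})
    (phi_supp : compactly_supported phi)
    (s : nat) (s_gt0 : (0 < s)%N)
    (x : 'I_s -> R)
    (x_distinct : forall i j : 'I_s, eq_mod1 (x i) (x j) -> i = j)
    (x_zeros : forall t : R, Phi phi t = 0%E <-> exists j : 'I_s, eq_mod1 t (x j))
    (lam : 'I_s -> nat) (lam_gt0 : forall j : 'I_s, (0 < lam j)%N)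
    (P : R -> R) (P_trig : is_trig_poly P) (P_gt0 : forall t : R, 0 < P t)
    (Phi_factor : forall t : R,
       Phi phi t = (`|omega x lam t| ^+ 2 * P t)%:E)
    (a : int) (Omega : seq int)
    (Omega_def : Omega = consecutive a (\sum_(j < s) lam j)%N)
    (c : int -> int -> R[i])
    (T_interp : forall n : int, n \notin Omega ->
       interpolates x lam (trig_poly Omega (c n)) (expchar n))
    (eta : int -> R -> R[i])
    (eta_def : forall n : int, n \notin Omega ->
       fourierL2 (eta n) (fun t : R =>
         fourier phi t * ((fine (Phi phi t))^-1)%:C *
           (expchar n t - trig_poly Omega (c n) t)))
    (f : R -> R[i]) (f_in : f \in shift_space phi) :
  exists F : R -> R -> R[i],
    (forall r : R, 0 <= r < 1 ->
       L2_sum (fun (n : int) (y : R) =>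
         (r ^+ `|n|%N)%:C * coefficient Omega eta f n * translate n phi y)
         (F r)) /\
    L2dist f (F r) @[r --> 1^'-] --> 0%E.
Proof.
have fS : shift_space phi f by move: f_in; rewrite inE.
have f2 : cL2 f by case: fS.
have phi1 := cL1_compactly_supported phi_L2 phi_supp.
have [B phiB] := compactly_supported_cutoff phi_supp.
pose g := coefficient Omega eta f.
pose ws := map conjc (nodes x lam).
have zs1 := @cmod_nodes R s x lam.
have ws1 w : w \in ws -> cmod w = 1 by move=> /mapP[z /zs1 z1 ->]; rewrite cmod_conj.
have g0 : {in consecutive a (size (nodes x lam)), forall n, g n = 0}.
  by move=> n; rewrite size_nodes -Omega_def /g /coefficient => ->.
have [C1 [C10 hC1]] := zdiffs_coefficient_le phi1 phi_L2 x_distinct x_zeros P_trig P_gt0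
  Phi_factor Omega_def T_interp eta_def.
have [C2 [C20 hC2]] := cLnorm_comb_equiv phi1 phi_L2 P_trig P_gt0 Phi_factor a.
(* A single approximant at distance 1 suffices: its own differences are square-summable, and those
   of the error are bounded by [zdiffs_coefficient_le]. *)
have gV : exists V, forall N, wsum a (zdiffs ws g) N <= V.
  have [N [b [sb fb]]] := shift_space_window a fS (ltr01 : 0 < (1 : R)).
  pose d := fine (cLnorm 2%:E (comb phi (window a N) b)).
  have d0 : 0 <= d by rewrite fine_ge0// cLnorm_ge0.
  exists (2 * (C1 * 1) ^+ 2 + 2 * (C2 * d) ^+ 2) => K.
  apply: le_trans (_ : 2 * wsum a (fun n => zdiffs ws g n - zdiffs ws b n) K +
      2 * wsum a (zdiffs ws b) K <= _).
    apply: le_trans (wsumD _ _ _ _); rewrite le_eqVlt; apply/orP; left; apply/eqP.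
    by congr (wsum a _ K); apply/funext => n; rewrite subrK.
  apply: lerD; (apply: ler_wpM2l; first by []).
    exact: (hC1 _ _ _ _ fS sb ler01 (ltW fb)).
  have [h _] := hC2 _ _ _ sb d0; apply: h.
  rewrite /d fineK// ge0_fin_numE ?cLnorm_ge0//; exact: (cL2_comb phi_L2 _ _).2.
have summ r : 0 <= r < 1 -> exists V, forall N, wl1 a (fun n => cmod (abelz r g n)) N <= V.
  by move=> r01; exact: (zdiffs_abel_summable zs1 g0 gV r01).
exists (fun r => local_sum phi B a (abelz r g)); split => [r r01|].
  by have [V hV] := summ r r01; exact: (L2_sum_local_sum phi_L2 phiB hV).
apply: cvge0P => [r|e e0]; first exact: cLnorm_ge0.
pose n2 := fine (cLnorm 2%:E phi).
have phifin : cLnorm 2%:E phi \is a fin_num.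
  by rewrite ge0_fin_numE ?cLnorm_ge0//; exact: phi_L2.2.
have n20 : 0 <= n2 by rewrite fine_ge0// cLnorm_ge0.
pose p : R := 2 ^+ size ws; have p0 : 0 <= p by rewrite exprn_ge0.
(* A d will bound D of the difference between b and the truncated Abel coefficients; C1, 1 and p
   account for the approximation, the Abel weight and the truncation, each doubled to absorb the
   factors of [wsumD]. *)
pose A := 2 * C1 + 2 + 2 * p.
have A0 : 0 <= A by rewrite /A; lra.
(* Three errors, each a multiple of d: f against the approximant, the approximant against the
   truncated Abel sum, and the truncated sum against the full one. *)
pose Q := 1 + C2 * A + n2.
have Q0 : 0 < Q by rewrite /Q; have := mulr_ge0 (ltW C20) A0; lra.
have [d d0 dQ] : exists2 d, 0 < d & d * Q = e.
  by exists (e / Q); [rewrite divr_gt0|rewrite divfK// gt_eqF].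
have [N [b [sb fb]]] := shift_space_window a fS d0.
have gb := hC1 _ _ _ _ fS sb (ltW d0) (ltW fb).
have d20 : 0 < d ^+ 2 by rewrite exprn_gt0.
(* The approximant b is chosen before r. From here on r is fixed, and the truncation radius may
   depend on it, since the l^1 bound on the weighted coefficients is not uniform in r. *)
apply: filterS2 (near_left1 ltr01) (zdiffs_abel_cvg zs1 g0 gV d20) => r [r01 _] ug.
have [V hV] := summ r r01; set u := abelz r g in hV ug *.
have [M0 hM0] := local_sum_tail phi_L2 phiB hV d0.
have [M1 hM1] := summable_tail (fun k => cmod_ge0 (u k)) hV d0.
(* The window must contain the support of b, leave a small tail in L^2, and leave a small l^1 tail
   of coefficients. *)
pose M := (N + M0 + M1)%N.
have trunc J : \sum_(k <- window a J | k \notin window a M) cmod (u k) <= d.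
  by apply: hM1; apply: window_subset; rewrite /M leq_addl.
have := zdiffs_truncation ws1 trunc; rewrite -/p => tr.
pose uM k := if k \in window a M then u k else 0.
have NM : (N <= M)%N by rewrite /M -addnA leq_addr.
have sg : supported (fun k => b k - uM k) (a - M%:Z) (M + M).
  move=> k kM; rewrite (supported_sub NM sb)// /uM ifN ?subrr//.
have cu2 := cL2_comb phi_L2 (window a M) u.
have cb2 := cL2_comb phi_L2 (window a N) b.
have cg : comb phi (window a M) (fun k => b k - uM k) =
    fun y => comb phi (window a N) b y - comb phi (window a M) u y.
  apply/funext => y; rewrite combB (comb_widen phi NM sb); congr (_ - _).
  by rewrite /comb !big_seq; apply: eq_bigr => k kM; rewrite /uM kM.
have wg K : wsum a (zdiffs ws (fun k => b k - uM k)) K <= (A * d) ^+ 2.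
  (* Telescoping through D u and D g: [D1] is the approximation error, [D2] the effect of the Abel
     weight, [D3] the truncation error. *)
  pose D1 n := zdiffs ws g n - zdiffs ws b n.
  pose D2 n := zdiffs ws u n - zdiffs ws g n.
  pose D3 n := zdiffs ws (fun k => u k - uM k) n.
  have -> : zdiffs ws (fun k => b k - uM k) = fun n => (D3 n - D2 n) - D1 n.
    by apply/funext => n; rewrite /D1 /D2 /D3 !zdiffsB; ring.
  have wN v : wsum a (fun n => - v n) K = wsum a v K.
    by rewrite !wsumE; apply: eq_bigr => n _; rewrite cmodN.
  have h1 := wsumD a (fun n => D3 n - D2 n) (fun n => - D1 n) K.
  have h2 := wsumD a D3 (fun n => - D2 n) K.
  rewrite !wN in h1 h2.
  have := gb K; have := ug K; have := tr K.
  rewrite -[X in X <= (p * d) ^+ 2]/(wsum a D3 K) -[X in X <= d ^+ 2]/(wsum a D2 K).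
  rewrite -[X in X <= (C1 * d) ^+ 2]/(wsum a D1 K) => t3 t2 t1.
  apply: (le_trans h1); rewrite !exprMn in t1 t3 *.
  have : 4 * p ^+ 2 + 4 + 2 * C1 ^+ 2 <= A ^+ 2.
    by rewrite /A; have := mulr_ge0 p0 (ltW C10); nra.
  move=> /(ler_wpM2r (ltW d20)); apply: le_trans.
  have -> : (4 * p ^+ 2 + 4 + 2 * C1 ^+ 2) * d ^+ 2 =
      4 * (p ^+ 2 * d ^+ 2) + 4 * d ^+ 2 + 2 * (C1 ^+ 2 * d ^+ 2) by ring.
  move: h2 t1 t2 t3; move: (p ^+ 2 * d ^+ 2) (C1 ^+ 2 * d ^+ 2) (d ^+ 2).
  move: (wsum a _ K) (wsum a D1 K) (wsum a D2 K) (wsum a D3 K) => w1 w2 w3 w4 q1 q2 q3.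
  by clear; lra.
have [_ hg] := hC2 _ _ _ sg (mulr_ge0 A0 (ltW d0)).
have {}hg := hg wg; rewrite cg in hg.
have hF := hM0 _ (uniq_window a M).
have {}hF : (cLnorm 2%:E (fun y => local_sum phi B a u y - comb phi (window a M) u y)%R <=
    (d * n2)%:E)%E.
  by rewrite EFinM /n2 fineK//; apply: hF; apply: window_subset; rewrite /M addnAC leq_addl.
have mF : cmeasurable (local_sum phi B a u) by exact: cmeasurable_local_sum.
apply: le_trans (cLnorm_triangle f2.1 mF cb2.1) _.
apply: (@le_trans _ _ (d%:E + ((C2 * (A * d))%:E + (d * n2)%:E))%E).
  apply: leeD; first exact: ltW.
  apply: le_trans (cLnorm_triangle cb2.1 mF cu2.1) _.
  by apply: leeD => //; rewrite cLnormB_sym.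
by rewrite -!EFinD lee_fin -dQ /Q le_eqVlt; apply/orP; left; apply/eqP; ring.
Qed.
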